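(* Let $\Delta$ be the root system of a symmetrizable Kac--Moody algebra $\mathfrak g$ over $\mathbb C$. Let $\alpha,\beta\in\Delta$ be distinct roots with $(\alpha,\beta)<0$. Then $$\dim\mathfrak g_{\alpha+\beta}\ \ge\ \dim\mathfrak g_\alpha+\dim\mathfrak g_\beta-1.$$
   Context: A generalized Cartan matrix is an integral matrix $A=(A_{ij})_{i,j\in I}$, $I$ finite, with $A_{ii}=2$, $A_{ij}\le 0$ for $i\ne j$, and $A_{ij}=0\iff A_{ji}=0$. It is symmetrizable if there is a diagonal matrix $D$ with positive rational diagonal entries $q_i$ such that $DA$ is symmetric. Let $\mathfrak h$ be a complex vector space of dimension $2|I|-\operatorname{rank}A$ with linearly independent sets $\{\alpha_i\}_{i\in I}\subseteq\mathfrak h^*$ (simple roots) and $\{\alpha_i^\vee\}_{i\in I}\subseteq\mathfrak h$ such that $\langle\alpha_j,\alpha_i^\vee\rangle=A_{ij}$. Let $\tilde{\mathfrak g}(A)$ be the Lie algebra generated by $\mathfrak h$ and $\tilde e_i,\tilde f_i$ ($i\in I$) with relations $[h,h']=0$, $[\tilde e_i,\tilde f_j]=\delta_{ij}\alpha_i^\vee$, $[h,\tilde e_i]=\langle\alpha_i,h\rangle\tilde e_i$, $[h,\tilde f_i]=-\langle\alpha_i,h\rangle\tilde f_i$ (together with the linear relations of $\mathfrak h$). The Kac--Moody algebra is $\mathfrak g=\mathfrak g(A)=\tilde{\mathfrak g}(A)/S(A)$, where $S(A)$ is the unique maximal ideal meeting $\mathfrak h$ trivially; it is called symmetrizable if $A$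 is symmetrizable. For $\gamma\in\mathfrak h^*$ put $\mathfrak g_\gamma=\{x\in\mathfrak g:[h,x]=\gamma(h)x\ \forall h\in\mathfrak h\}$; $\Delta=\{\gamma\ne0:\mathfrak g_\gamma\neq0\}$ is the set of roots, and $\mathfrak g_0=\mathfrak h$. The form $(\cdot,\cdot)$ is a non-degenerate symmetric bilinear form on $\mathfrak h^*$ with $(\alpha_i,\gamma)=q_i\langle\gamma,\alpha_i^\vee\rangle$ for all $i\in I$, $\gamma\in\mathfrak h^*$. *)

(* Defs.v *)
From HB Require Import structures.
From mathcomp Require Import all_boot all_order all_algebra.
From mathcomp Require Import boolp classical_sets reals ereal.
From mathcomp Require Import complex.

Set Implicit Arguments.
Unset Strict Implicit.
Unset Printing Implicit Defensive.

Import Order.TTheory GRing.Theory Num.Theory.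
Local Open Scope classical_set_scope.
Local Open Scope ring_scope.
Local Open Scope quotient_scope.

HB.mixin Record isLieAlgebra (K : fieldType) L of GRing.Lmodule K L := {
  lie : L -> L -> L ;
  lie_linearl : forall z a x y, lie (a *: x + y) z = a *: lie x z + lie y z ;
  lie_linearr : forall z a x y, lie z (a *: x + y) = a *: lie z x + lie z y ;
  lie_xx : forall x, lie x x = 0 ;
  lie_jacobi : forall x y z,
    lie x (lie y z) + lie y (lie z x) + lie z (lie x y) = 0
}.

#[short(type="lieAlgType")]
HB.structure Definition LieAlgebra (K : fieldType) :=
  { L of isLieAlgebra K L & GRing.Lmodule K L }.

Inductive lie_term (K X : Type) : Type :=
| TGen of X
| TZero
| TAdd of lie_term K X & lie_term K X
| TScale of K & lie_term K X
| TLie of lie_term K X & lie_term K X.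
Arguments TGen {K X}.
Arguments TZero {K X}.

HB.instance Definition _ (K X : Type) := gen_eqMixin (lie_term K X).
HB.instance Definition _ (K X : Type) := gen_choiceMixin (lie_term K X).

Section Presentation.
Variables (K : fieldType) (X : Type).
Notation term := (lie_term K X).
Variable rel : term -> term -> Prop.

(* The least congruence that contains [rel] and the axioms of Lie algebras;
   the opposite of [t] is [TScale (-1) t]. *)
Inductive lie_cong : term -> term -> Prop :=
| CRel s t : rel s t -> lie_cong s t
| CRefl t : lie_cong t t
| CSym s t : lie_cong s t -> lie_cong t s
| CTrans t s u : lie_cong s t -> lie_cong t u -> lie_cong s u
| CAdd s s' t t' : lie_cong s s' -> lie_cong t t' ->
    lie_cong (TAdd s t) (TAdd s' t')
| CScale a t t' : lie_cong t t' -> lie_cong (TScale a t) (TScale a t')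
| CLie s s' t t' : lie_cong s s' -> lie_cong t t' ->
    lie_cong (TLie s t) (TLie s' t')
| CAddA s t u : lie_cong (TAdd s (TAdd t u)) (TAdd (TAdd s t) u)
| CAddC s t : lie_cong (TAdd s t) (TAdd t s)
| CAdd0 t : lie_cong (TAdd TZero t) t
| CAddN t : lie_cong (TAdd (TScale (-1) t) t) TZero
| CScaleA a b t : lie_cong (TScale a (TScale b t)) (TScale (a * b) t)
| CScale1 t : lie_cong (TScale 1 t) t
| CScaleDr a s t :
    lie_cong (TScale a (TAdd s t)) (TAdd (TScale a s) (TScale a t))
| CScaleDl a b t :
    lie_cong (TScale (a + b) t) (TAdd (TScale a t) (TScale b t))
| CLieL u a s t :
    lie_cong (TLie (TAdd (TScale a s) t) u) (TAdd (TScale a (TLie s u)) (TLie t u))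
| CLieR u a s t :
    lie_cong (TLie u (TAdd (TScale a s) t)) (TAdd (TScale a (TLie u s)) (TLie u t))
| CLieXX t : lie_cong (TLie t t) TZero
| CJacobi s t u :
    lie_cong (TAdd (TAdd (TLie s (TLie t u)) (TLie t (TLie u s)))
                   (TLie u (TLie s t))) TZero.

Definition lie_congb (s t : term) : bool := `[< lie_cong s t >].

Lemma lie_congb_refl : reflexive lie_congb.
Proof. by move=> t; apply/asboolP; exact: CRefl. Qed.
Lemma lie_congb_sym : symmetric lie_congb.
Proof. by move=> s t; apply/asboolP/asboolP; exact: CSym. Qed.
Lemma lie_congb_trans : transitive lie_congb.
Proof.
by move=> t s u /asboolP st /asboolP tu; apply/asboolP; exact: CTrans st tu.
Qed.

Canonical lie_cong_equiv :=
  EquivRel lie_congb lie_congb_refl lie_congb_sym lie_congb_trans.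

Definition presented : Type := {eq_quot lie_cong_equiv}.
HB.instance Definition _ := Choice.on presented.
HB.instance Definition _ := EqQuotient.on presented.

Definition pclass (t : term) : presented := \pi_presented t.
Definition pgen (x : X) : presented := pclass (TGen x).

Lemma pclassP s t : pclass s = pclass t <-> lie_cong s t.
Proof.
split=> [/eqP|st]; first by rewrite /pclass eqmodE => /asboolP.
by apply/eqP; rewrite /pclass eqmodE; apply/asboolP.
Qed.

Lemma pclassK x : pclass (repr x) = x. Proof. exact: reprK. Qed.

Lemma lie_cong_repr t : lie_cong (repr (pclass t)) t.
Proof. by apply/pclassP; rewrite pclassK. Qed.

Definition padd (x y : presented) := pclass (TAdd (repr x) (repr y)).
Definition popp (x : presented) := pclass (TScale (-1) (repr x)).
Definition pscale (a : K) (x : presented) := pclass (TScale a (repr x)).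
Definition plie (x y : presented) := pclass (TLie (repr x) (repr y)).

Lemma pclassD s t : padd (pclass s) (pclass t) = pclass (TAdd s t).
Proof. by apply/pclassP; apply: CAdd; exact: lie_cong_repr. Qed.
Lemma pclassN t : popp (pclass t) = pclass (TScale (-1) t).
Proof. by apply/pclassP; apply: CScale; exact: lie_cong_repr. Qed.
Lemma pclassZ a t : pscale a (pclass t) = pclass (TScale a t).
Proof. by apply/pclassP; apply: CScale; exact: lie_cong_repr. Qed.
Lemma pclassL s t : plie (pclass s) (pclass t) = pclass (TLie s t).
Proof. by apply/pclassP; apply: CLie; exact: lie_cong_repr. Qed.

Let pE := (pclassD, pclassN, pclassZ, pclassL).

Lemma paddA : associative padd.
Proof.
move=> x y z; rewrite -[x]pclassK -[y]pclassK -[z]pclassK !pE.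
by apply/pclassP; exact: CAddA.
Qed.
Lemma paddC : commutative padd.
Proof.
by move=> x y; rewrite -[x]pclassK -[y]pclassK !pE; apply/pclassP; exact: CAddC.
Qed.
Lemma padd0 : left_id (pclass TZero) padd.
Proof. by move=> x; rewrite -[x]pclassK !pE; apply/pclassP; exact: CAdd0. Qed.
Lemma paddN : left_inverse (pclass TZero) popp padd.
Proof. by move=> x; rewrite -[x]pclassK !pE; apply/pclassP; exact: CAddN. Qed.

HB.instance Definition _ :=
  GRing.isZmodule.Build presented paddA paddC padd0 paddN.

Lemma pscaleA a b x : pscale a (pscale b x) = pscale (a * b) x.
Proof. by rewrite -[x]pclassK !pE; apply/pclassP; exact: CScaleA. Qed.
Lemma pscale1 : left_id 1 pscale.
Proof. by move=> x; rewrite -[x]pclassK !pE; apply/pclassP; exact: CScale1. Qed.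
Lemma pscaleDr : right_distributive pscale +%R.
Proof.
move=> a x y; rewrite -[x]pclassK -[y]pclassK /GRing.add /= !pE.
by apply/pclassP; exact: CScaleDr.
Qed.
Lemma pscaleDl x : {morph pscale^~ x : a b / a + b}.
Proof.
move=> a b; rewrite -[x]pclassK -[RHS]/(padd _ _) !pE.
by apply/pclassP; exact: CScaleDl.
Qed.

HB.instance Definition _ := GRing.Zmodule_isLmodule.Build K presented
  pscaleA pscale1 pscaleDr pscaleDl.

Lemma plie_linearl z a x y : plie (a *: x + y) z = a *: plie x z + plie y z.
Proof.
rewrite -[x]pclassK -[y]pclassK -[z]pclassK.
rewrite -[RHS]/(padd (pscale _ _) _) -[_ *: _ + _]/(padd (pscale _ _) _) !pE.
by apply/pclassP; exact: CLieL.
Qed.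
Lemma plie_linearr z a x y : plie z (a *: x + y) = a *: plie z x + plie z y.
Proof.
rewrite -[x]pclassK -[y]pclassK -[z]pclassK.
rewrite -[RHS]/(padd (pscale _ _) _) -[_ *: _ + _]/(padd (pscale _ _) _) !pE.
by apply/pclassP; exact: CLieR.
Qed.
Lemma plie_xx x : plie x x = 0.
Proof. by rewrite -[x]pclassK !pE; apply/pclassP; exact: CLieXX. Qed.
Lemma plie_jacobi x y z :
  plie x (plie y z) + plie y (plie z x) + plie z (plie x y) = 0.
Proof.
rewrite -[x]pclassK -[y]pclassK -[z]pclassK -[LHS]/(padd (padd _ _) _) !pE.
by apply/pclassP; exact: CJacobi.
Qed.

HB.instance Definition _ := isLieAlgebra.Build K presented
  plie_linearl plie_linearr plie_xx plie_jacobi.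

End Presentation.

Record lie_ideal (K : fieldType) (L : lieAlgType K) := LieIdeal {
  ideal_set :> L -> Prop ;
  ideal0 : ideal_set 0 ;
  ideal_lin : forall a x y,
    ideal_set x -> ideal_set y -> ideal_set (a *: x + y) ;
  ideal_lie : forall x y, ideal_set y -> ideal_set (lie x y)
}.

Section Quotient.
Variables (K : fieldType) (L : lieAlgType K) (J : lie_ideal L).

Lemma idealZ a x : J x -> J (a *: x).
Proof. by move=> Jx; rewrite -[_ *: _]addr0; apply: ideal_lin Jx (ideal0 J). Qed.
Lemma idealN x : J x -> J (- x).
Proof. by rewrite -scaleN1r; exact: idealZ. Qed.
Lemma idealD x y : J x -> J y -> J (x + y).
Proof. by move=> Jx Jy; rewrite -[x]scale1r; exact: ideal_lin. Qed.
Lemma lie0l (x : L) : lie 0 x = 0.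
Proof. by have := lie_linearl x (-1) 0 0; rewrite scaler0 addr0 scaleN1r addNr. Qed.
Lemma lie0r (x : L) : lie x 0 = 0.
Proof. by have := lie_linearr x (-1) 0 0; rewrite scaler0 addr0 scaleN1r addNr. Qed.
Lemma lieDl (x y z : L) : lie (x + y) z = lie x z + lie y z.
Proof. by rewrite -[x]scale1r lie_linearl !scale1r. Qed.
Lemma lieDr (x y z : L) : lie z (x + y) = lie z x + lie z y.
Proof. by rewrite -[x]scale1r lie_linearr !scale1r. Qed.
Lemma lieC (x y : L) : lie x y = - lie y x.
Proof.
have := lie_xx (x + y); rewrite lieDl !lieDr !lie_xx add0r addr0.
by move/eqP; rewrite addr_eq0 => /eqP.
Qed.
Lemma lieBl (x y z : L) : lie (x - y) z = lie x z - lie y z.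
Proof. by rewrite addrC -scaleN1r lie_linearl scaleN1r addrC. Qed.
Lemma lieBr (x y z : L) : lie z (x - y) = lie z x - lie z y.
Proof. by rewrite addrC -scaleN1r lie_linearr scaleN1r addrC. Qed.

Definition ideal_eqb (x y : L) : bool := `[< J (x - y) >].

Lemma ideal_eqb_refl : reflexive ideal_eqb.
Proof. by move=> x; apply/asboolP; rewrite subrr; exact: ideal0. Qed.
Lemma ideal_eqb_sym : symmetric ideal_eqb.
Proof.
by move=> x y; apply/asboolP/asboolP => /idealN; rewrite opprB.
Qed.
Lemma ideal_eqb_trans : transitive ideal_eqb.
Proof.
move=> y x z /asboolP xy /asboolP yz; apply/asboolP.
by rewrite -(subrKA y); exact: idealD.
Qed.

Canonical ideal_equiv :=
  EquivRel ideal_eqb ideal_eqb_refl ideal_eqb_sym ideal_eqb_trans.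

Definition lie_quot : Type := {eq_quot ideal_equiv}.
HB.instance Definition _ := Choice.on lie_quot.
HB.instance Definition _ := EqQuotient.on lie_quot.

Definition qclass (x : L) : lie_quot := \pi_lie_quot x.

Lemma qclassP x y : qclass x = qclass y <-> J (x - y).
Proof.
split=> [/eqP|xy]; first by rewrite /qclass eqmodE => /asboolP.
by apply/eqP; rewrite /qclass eqmodE; apply/asboolP.
Qed.

Lemma qclassK x : qclass (repr x) = x. Proof. exact: reprK. Qed.

Lemma ideal_repr x : J (repr (qclass x) - x).
Proof. by apply/qclassP; rewrite qclassK. Qed.

Definition qadd (x y : lie_quot) := qclass (repr x + repr y).
Definition qopp (x : lie_quot) := qclass (- repr x).
Definition qscale (a : K) (x : lie_quot) := qclass (a *: repr x).
Definition qlie (x y : lie_quot) := qclass (lie (repr x) (repr y)).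

Lemma qclassD0 x y : qadd (qclass x) (qclass y) = qclass (x + y).
Proof.
by apply/qclassP; rewrite opprD addrACA; apply: idealD; exact: ideal_repr.
Qed.
Lemma qclassN0 x : qopp (qclass x) = qclass (- x).
Proof. by apply/qclassP; rewrite -opprD; apply: idealN; exact: ideal_repr. Qed.
Lemma qclassZ0 a x : qscale a (qclass x) = qclass (a *: x).
Proof. by apply/qclassP; rewrite -scalerBr; apply: idealZ; exact: ideal_repr. Qed.
Lemma qclassL0 x y : qlie (qclass x) (qclass y) = qclass (lie x y).
Proof.
apply/qclassP; rewrite -(subrKA (lie (repr (qclass x)) y)) -lieBr -lieBl.
apply: idealD; first by apply: ideal_lie; exact: ideal_repr.
by rewrite lieC; apply/idealN/ideal_lie; exact: ideal_repr.
Qed.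

Let qE := (qclassD0, qclassN0, qclassZ0, qclassL0).

Lemma qaddA : associative qadd.
Proof.
by move=> x y z; rewrite -[x]qclassK -[y]qclassK -[z]qclassK !qE addrA.
Qed.
Lemma qaddC : commutative qadd.
Proof. by move=> x y; rewrite -[x]qclassK -[y]qclassK !qE addrC. Qed.
Lemma qadd0 : left_id (qclass 0) qadd.
Proof. by move=> x; rewrite -[x]qclassK !qE add0r. Qed.
Lemma qaddN : left_inverse (qclass 0) qopp qadd.
Proof. by move=> x; rewrite -[x]qclassK !qE addNr. Qed.

HB.instance Definition _ :=
  GRing.isZmodule.Build lie_quot qaddA qaddC qadd0 qaddN.

Lemma qscaleA a b x : qscale a (qscale b x) = qscale (a * b) x.
Proof. by rewrite -[x]qclassK !qE scalerA. Qed.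
Lemma qscale1 : left_id 1 qscale.
Proof. by move=> x; rewrite -[x]qclassK !qE scale1r. Qed.
Lemma qscaleDr : right_distributive qscale +%R.
Proof.
move=> a x y; rewrite -[x]qclassK -[y]qclassK -[RHS]/(qadd _ _).
by rewrite -[_ + _ in LHS]/(qadd _ _) !qE scalerDr.
Qed.
Lemma qscaleDl x : {morph qscale^~ x : a b / a + b}.
Proof. by move=> a b; rewrite -[x]qclassK -[RHS]/(qadd _ _) !qE scalerDl. Qed.

HB.instance Definition _ := GRing.Zmodule_isLmodule.Build K lie_quot
  qscaleA qscale1 qscaleDr qscaleDl.

Lemma qlie_linearl z a x y : qlie (a *: x + y) z = a *: qlie x z + qlie y z.
Proof.
rewrite -[x]qclassK -[y]qclassK -[z]qclassK.
rewrite -[RHS]/(qadd (qscale _ _) _) -[_ *: _ + _]/(qadd (qscale _ _) _) !qE.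
by rewrite lie_linearl.
Qed.
Lemma qlie_linearr z a x y : qlie z (a *: x + y) = a *: qlie z x + qlie z y.
Proof.
rewrite -[x]qclassK -[y]qclassK -[z]qclassK.
rewrite -[RHS]/(qadd (qscale _ _) _) -[_ *: _ + _]/(qadd (qscale _ _) _) !qE.
by rewrite lie_linearr.
Qed.
Lemma qlie_xx x : qlie x x = 0.
Proof. by rewrite -[x]qclassK !qE lie_xx. Qed.
Lemma qlie_jacobi x y z :
  qlie x (qlie y z) + qlie y (qlie z x) + qlie z (qlie x y) = 0.
Proof.
rewrite -[x]qclassK -[y]qclassK -[z]qclassK -[LHS]/(qadd (qadd _ _) _) !qE.
by rewrite lie_jacobi.
Qed.

HB.instance Definition _ := isLieAlgebra.Build K lie_quot
  qlie_linearl qlie_linearr qlie_xx qlie_jacobi.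

End Quotient.

Section Dimension.
Variables (K : fieldType) (V : lmodType K).

Definition is_basis (W : set V) m (b : 'I_m -> V) :=
  (forall c : 'I_m -> K, \sum_i c i *: b i = 0 -> forall i, c i = 0) /\
  W = [set \sum_i c i *: b i | c in [set: 'I_m -> K]].

(* The cardinality of a finite basis of [W] if there is one, [+oo] otherwise. *)
Definition sdim (R : realType) (W : set V) : \bar R :=
  xget +oo%E [set d | exists m (b : 'I_m -> V), is_basis W b /\ d = m%:R%:E].

End Dimension.

Definition gen_cartan n (A : 'M[int]_n) :=
  [/\ forall i, A i i = 2,
      forall i j, i != j -> A i j <= 0 &
      forall i j, A i j = 0 <-> A j i = 0].

Definition symmetrizer n (A : 'M[int]_n) (q : 'rV[rat]_n) :=
  (forall i, 0 < q 0 i) /\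
  let DA := diag_mx q *m map_mx intr A in DA^T = DA.

Section KacMoody.
Variables (K : fieldType) (h : vectType K) (n : nat).
Variables (alpha : 'I_n -> 'Hom(h, K^o)) (alphav : 'I_n -> h).

Definition realization (A : 'M[int]_n) :=
  [/\ \dim {:h} = (2 * n - \rank (map_mx intr A : 'M[rat]_n))%N,
      free [seq alpha i | i : 'I_n],
      free [seq alphav i | i : 'I_n] &
      forall i j, alpha j (alphav i) = (A i j)%:~R].

Inductive km_gen := GenH of h | GenE of 'I_n | GenF of 'I_n.

Notation tH x := (TGen (GenH x)).
Notation tE i := (TGen (GenE i)).
Notation tF i := (TGen (GenF i)).

Inductive km_rel : lie_term K km_gen -> lie_term K km_gen -> Prop :=
| RelLin a x y : km_rel (tH (a *: x + y)) (TAdd (TScale a (tH x)) (tH y))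
| RelHH x y : km_rel (TLie (tH x) (tH y)) TZero
| RelEF i j : km_rel (TLie (tE i) (tF j)) (if i == j then tH (alphav i) else TZero)
| RelHE x i : km_rel (TLie (tH x) (tE i)) (TScale (alpha i x) (tE i))
| RelHF x i : km_rel (TLie (tH x) (tF i)) (TScale (- alpha i x) (tF i)).

Definition km_tilde : lieAlgType K := presented km_rel.

Definition tildeH (x : h) : km_tilde := pgen km_rel (GenH x).

Definition meets_h_trivially (J : lie_ideal km_tilde) :=
  forall x, J (tildeH x) -> tildeH x = 0.

(* Maximality already determines [S] uniquely. *)
Definition maximal_ideal (S : lie_ideal km_tilde) :=
  meets_h_trivially S /\
  forall J : lie_ideal km_tilde, meets_h_trivially J ->
    (forall x, S x -> J x) -> forall x, J x -> S x.

Variable S : lie_ideal km_tilde.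

Definition kac_moody : lieAlgType K := lie_quot S.

Definition kmH (x : h) : kac_moody := qclass S (tildeH x).

Definition root_space (gamma : 'Hom(h, K^o)) : set kac_moody :=
  [set x | forall y : h, lie (kmH y) x = (gamma y : K) *: x].

Definition km_root (gamma : 'Hom(h, K^o)) :=
  gamma != 0 /\ exists2 x, root_space gamma x & x != 0.

End KacMoody.

Arguments root_space {K h n alpha alphav} S gamma _.

(* Main.v *)
Require Import Defs.
From HB Require Import structures.
From mathcomp Require Import all_boot all_order all_algebra.
From mathcomp Require Import boolp classical_sets reals ereal.
From mathcomp Require Import complex.
From mathcomp Require Import ring zify.

Set Implicit Arguments.
Unset Strict Implicit.
Unset Printing Implicit Defensive.

Import Order.TTheory GRing.Theory Num.Theory.
Local Open Scope ring_scope.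

(** Let [x] and [y] be nonzero elements of [g_a] and [g_b], with [a <> b] and
[(a, b) < 0].  The algebra carries an antilinear anti-involution [star] that
exchanges the Chevalley generators, and an invariant symmetric bilinear form;
the Hermitian form [(u | star v)] is positive definite on every root space (Kac
and Peterson).  Since [[x, star x] = |x|^2 nu^-1(a)], the assumption
[[x, y] = 0] would give [[star x, y]], a vector of the root space of
[b - a <> 0], the squared norm [|x|^2 (a, b) |y|^2 < 0].  So the bracket
[g_a x g_b -> g_(a+b)] has no nontrivial zeros, and the inequality follows from
Hopf's lemma on nonsingular bilinear maps over an algebraically closed field.

Positivity follows by induction on the height.  If [(u_i)] is an orthonormal
basis of the spaces of smaller height, [sum_i [u_i, [star u_i, x]]] equals
[(2 (rho, a) - (a, a)) x] for [x] in [g_a]; the scalar is positive when [a] is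
a positive root that is not simple, by reflections, and pairing with [x] writes
a positive multiple of [|x|^2] as a sum of squares.

Hopf's lemma compares Hilbert functions.  If [r] bilinear forms in [m] and [n]
variables generated all bihomogeneous polynomials of some bidegree [(N, N)], the
dimension in bidegree [(d, d)] would grow at most like [d^(r-1)], whereas it
grows like [d^(m+n-2)].  So for [r <= m + n - 2] they generate a proper ideal in
every bidegree; a maximal space of bilinear forms with this property is a
hyperplane, and this hyperplane defines a common zero. *)

(** * Lie brackets, spans and eigenvectors *)

(** The algebra is given by generators and relations, so no grading is at hand. Degrees are read off
    as eigenvalues of the bracket with one [rho] in h on which every simple root is 1 (a coweight,
    unlike the rho of the Casimir scalar), and most statements are predicates closed under linear
    combinations, checked on iterated brackets of generators. The invariant form is not extended
    degree by degree but given by one formula, (x | y) = (rho | [x, y]) / k in degrees k and -k. It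
    is then well defined at once, and the work lies in its invariance. Maximality of S(A) is used
    twice: the anti-involution descends to the quotient, and a vector of positive degree killed by
    all f_i is 0. The second fact yields the Serre relations, hence local nilpotency of the e_i and
    the reflections; it also reduces the Casimir identity to brackets with the f_m and makes the sum
    of squares strictly positive. Finite dimension of root spaces is not taken from the theory:
    without a finite basis of the target the inequality is trivial, and with one the bracket itself
    bounds the two factors. *)

Section LieBasics.
Variables (K : fieldType) (L : lieAlgType K).
Implicit Types x y z : L.

Lemma lieZl a x y : lie (a *: x) y = a *: lie x y.
Proof. by rewrite -[a *: x]addr0 lie_linearl lie0l addr0. Qed.

Lemma lieZr a x y : lie x (a *: y) = a *: lie x y.
Proof. by rewrite -[a *: y]addr0 lie_linearr lie0r addr0. Qed.

Lemma lieNl x y : lie (- x) y = - lie x y.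
Proof. by rewrite -scaleN1r lieZl scaleN1r. Qed.

Lemma lieNr x y : lie x (- y) = - lie x y.
Proof. by rewrite -scaleN1r lieZr scaleN1r. Qed.

Lemma lieA x y z : lie x (lie y z) = lie (lie x y) z + lie y (lie x z).
Proof.
have /eqP := lie_jacobi x y z.
rewrite -addrA addr_eq0 => /eqP ->.
by rewrite opprD addrC [lie z (lie x y)]lieC opprK [lie z x]lieC lieNr opprK.
Qed.

Lemma lieAl x y z : lie (lie x y) z = lie x (lie y z) - lie y (lie x z).
Proof. by rewrite lieA addrK. Qed.

Lemma lie_sumr (I : Type) (s : seq I) (P : pred I) (f : I -> L) x :
  lie x (\sum_(i <- s | P i) f i) = \sum_(i <- s | P i) lie x (f i).
Proof. by apply: (big_morph (lie x)) => [u v|]; rewrite ?lie0r ?lieDr. Qed.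

Lemma lie_suml (I : Type) (s : seq I) (P : pred I) (f : I -> L) x :
  lie (\sum_(i <- s | P i) f i) x = \sum_(i <- s | P i) lie (f i) x.
Proof. by apply: (big_morph (lie^~ x)) => [u v|]; rewrite ?lie0l ?lieDl. Qed.

End LieBasics.

Section Span.
Variables (K : fieldType) (V : lmodType K).

Record lin_closed (P : V -> Prop) : Prop := LinClosed {
  lin_closed0 : P 0;
  lin_closedP : forall a x y, P x -> P y -> P (a *: x + y) }.

Lemma lin_closedZ P a x : lin_closed P -> P x -> P (a *: x).
Proof. by case=> P0 PL Px; rewrite -[_ *: _]addr0; exact: PL. Qed.

Lemma lin_closedD P x y : lin_closed P -> P x -> P y -> P (x + y).
Proof. by case=> P0 PL Px Py; rewrite -[x]scale1r; exact: PL. Qed.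

Lemma lin_closedN P x : lin_closed P -> P x -> P (- x).
Proof. by rewrite -scaleN1r; exact: lin_closedZ. Qed.

Lemma lin_closed_sum P (I : Type) (s : seq I) (f : I -> V) :
  lin_closed P -> (forall i, P (f i)) -> P (\sum_(i <- s) f i).
Proof.
move=> PL Pf; elim/big_rec: _ => [|i x _ Px]; first exact: lin_closed0.
exact: lin_closedD.
Qed.

(** The impredicative form makes induction over a span a mere application; no coefficients have to
    be named. *)
Definition lspan (s : seq V) (x : V) : Prop :=
  forall P, lin_closed P -> (forall v, v \in s -> P v) -> P x.

Lemma lspan_lin s : lin_closed (lspan s).
Proof.
split=> [P PL _|a x y sx sy P PL Ps]; first exact: lin_closed0.
by apply: (lin_closedP PL); [exact: sx | exact: sy].
Qed.

Lemma mem_lspan s v : v \in s -> lspan s v.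
Proof. by move=> vs P _; apply. Qed.

Section Eigen.
Variables (T : Type) (D : T -> V -> V).
Hypothesis D_lin : forall t a x y, D t (a *: x + y) = a *: D t x + D t y.
Implicit Types chi : T -> K.

Definition eigen chi x := forall t, D t x = chi t *: x.

Lemma eigen_lin chi : lin_closed (eigen chi).
Proof.
split=> [t|a x y ex ey t].
  by have := D_lin t (-1) 0 0; rewrite !scaler0 addr0 scaleN1r addNr.
by rewrite D_lin ex ey scalerDr !scalerA mulrC.
Qed.

(** The length [m] is what [eigen_away] descends on. The operators are indexed by a type [T] so that
    one development serves both the single operator ad [rho] and the whole of h. *)
Fixpoint away chi m z : Prop :=
  if m is m'.+1 then
    exists chi' u v, [/\ z = u + v, eigen chi' u, exists t, chi' t <> chi t
                       & away chi m' v]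
  else z = 0.

Lemma away_scale chi m a x : away chi m x -> away chi m (a *: x).
Proof.
elim: m x => [|m IH] x /=; first by move->; rewrite scaler0.
move=> [chi' [u [v [-> eu ne /IH av]]]]; exists chi', (a *: u), (a *: v).
by rewrite scalerDr; split=> //; exact: lin_closedZ (eigen_lin _) eu.
Qed.

Lemma away_add chi m1 m2 x y :
  away chi m1 x -> away chi m2 y -> away chi (m1 + m2) (x + y).
Proof.
move=> + ay; elim: m1 x => [|m IH] x /=; first by move->; rewrite add0r.
move=> [chi' [u [v [-> eu ne /IH av]]]]; exists chi', u, (v + y).
by rewrite addrA.
Qed.

Definition awayx chi x := exists m, away chi m x.

Lemma awayx_lin chi : lin_closed (awayx chi).
Proof.
split=> [|a x y [m1 ax] [m2 ay]]; first by exists 0%N.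
by exists (m1 + m2)%N; apply: away_add ay; exact: away_scale.
Qed.

Lemma eigen_awayx chi chi' x :
  eigen chi' x -> (exists t, chi' t <> chi t) -> awayx chi x.
Proof. by move=> ex ne; exists 1%N, chi', x, 0; rewrite addr0. Qed.

Let opB t c x := D t x - c *: x.

Lemma opBD t c x y : opB t c (x + y) = opB t c x + opB t c y.
Proof.
by rewrite /opB -[x in D t (x + _)]scale1r D_lin scale1r scalerDr opprD addrACA.
Qed.

Lemma opB_eigen chi t c x : eigen chi x -> opB t c x = (chi t - c) *: x.
Proof. by move=> ex; rewrite /opB ex scalerBl. Qed.

Lemma away_op chi m t c x : away chi m x -> away chi m (opB t c x).
Proof.
elim: m x => [|m IH] x /=.
  move->; have := D_lin t (-1) 0 0; rewrite /opB !scaler0 addr0 scaleN1r addNr.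
  by move->; rewrite subr0.
move=> [chi' [u [v [-> eu ne /IH av]]]].
exists chi', ((chi' t - c) *: u), (opB t c v).
rewrite opBD (opB_eigen _ _ eu); split=> //.
exact: lin_closedZ (eigen_lin _) eu.
Qed.

(** Applying D t - chi'(t) to y + z removes one summand of z and multiplies y by a nonzero scalar.
    This is the usual proof that a stable subspace contains the weight components of its
    elements. *)
Lemma eigen_away chi (J : V -> Prop) y z :
  lin_closed J -> (forall t x, J x -> J (D t x)) ->
  eigen chi y -> awayx chi z -> J (y + z) -> J y.
Proof.
move=> JL JD ey [m az]; elim: m y z ey az => [|m IH] y z ey /=.
  by move->; rewrite addr0.
move=> [chi' [u [v [-> eu [t ne] av]]]] Jyz.
have := lin_closedP JL (- chi' t) Jyz (JD t _ Jyz).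
rewrite addrC scaleNr -/(opB _ _ _) !opBD (opB_eigen _ _ ey) (opB_eigen _ _ eu).
rewrite subrr scale0r add0r => /IH J2.
have /(lin_closedZ (chi t - chi' t)^-1 JL) : J ((chi t - chi' t) *: y).
  by apply: J2; [exact: lin_closedZ (eigen_lin _) ey | exact: away_op].
rewrite scalerA mulVf ?scale1r // subr_eq0.
by apply/eqP => e; apply: ne.
Qed.

End Eigen.
End Span.

(** * Triangular decomposition *)

Section Words.
Variables (K : fieldType) (L : lieAlgType K) (n : nat) (X : 'I_n -> L).
Implicit Types (w : seq 'I_n) (x : L).

Fixpoint words k : seq (seq 'I_n) :=
  if k is k'.+1 then [seq i :: w | i <- enum 'I_n, w <- words k'] else [:: [::]].

Lemma mem_words k w : (w \in words k) = (size w == k).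
Proof.
elim: k w => [|k IH] [|i w] //=.
  by apply/negbTE/negP => /allpairsP[p [_ _]].
rewrite eqSS -IH; apply/allpairsP/idP => [[[j v] /= [_ vk [_ ->]]] //|wk].
by exists (i, w); rewrite mem_enum.
Qed.

(** Right-normed brackets of generators. The empty word has the default value 0, so the meaningful
    levels are those of index [k.+1]; degree 0 is h and is treated apart. *)
Fixpoint ew w : L :=
  if w is i :: w' then if w' is [::] then X i else lie (X i) (ew w') else 0.

Lemma ew_cons i w : (0 < size w)%N -> ew (i :: w) = lie (X i) (ew w).
Proof. by case: w. Qed.

Definition lev k x := lspan [seq ew w | w <- words k] x.

Lemma lev_lin k : lin_closed (lev k).
Proof. exact: lspan_lin. Qed.

Lemma lev_ew w : lev (size w) (ew w).
Proof. by apply: mem_lspan; apply: (map_f ew); rewrite mem_words. Qed.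

Lemma lev_ind k (P : L -> Prop) : lin_closed P ->
  (forall w, size w = k -> P (ew w)) -> forall x, lev k x -> P x.
Proof.
move=> PL Pw x; apply=> // v /mapP[w]; rewrite mem_words => /eqP wk ->; exact: Pw.
Qed.

Lemma lev1 i : lev 1 (X i). Proof. exact: (@lev_ew [:: i]). Qed.

Lemma lie_lin_closed (P : L -> Prop) (z : L) :
  lin_closed P -> lin_closed (fun x => P (lie z x)).
Proof.
move=> PL; split=> [|a x y Px Py]; first by rewrite lie0r; case: PL.
by rewrite lie_linearr; exact: lin_closedP.
Qed.

Lemma levS k i x : lev k.+1 x -> lev k.+2 (lie (X i) x).
Proof.
move: x; apply: lev_ind; first exact: lie_lin_closed (lev_lin _).
by move=> w wk; rewrite -ew_cons ?wk // -wk; exact: (@lev_ew (i :: w)).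
Qed.

Lemma lev1_case (P : L -> Prop) : lin_closed P ->
  (forall i, P (X i)) -> forall x, lev 1 x -> P x.
Proof. by move=> PL PX; apply: lev_ind => // -[|i [|j w]] //= _; exact: PX. Qed.

Lemma levS_case k (P : L -> Prop) : lin_closed P ->
  (forall i y, lev k.+1 y -> P (lie (X i) y)) -> forall x, lev k.+2 x -> P x.
Proof.
move=> PL PX; apply: lev_ind => // -[|i w] // [wk]; rewrite ew_cons ?wk //.
by apply: PX; rewrite -wk; exact: lev_ew.
Qed.

End Words.

Section Triangular.
Variables (C : numClosedFieldType) (h : vectType C) (n : nat) (L : lieAlgType C).
Variables (alpha : 'I_n -> 'Hom(h, C^o)) (alphav : 'I_n -> h).
Variables (H : h -> L) (E F : 'I_n -> L).
Implicit Types (w : seq 'I_n) (x y z : L) (gamma : 'Hom(h, C^o)).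

(** Shared by [km_tilde] and by its quotient, so that the triangular decomposition is proved once
    for both. The field [km_ind] says that the images of the generators generate. *)
Record km_relations : Prop := KmRelations {
  H_linear : forall a u v, H (a *: u + v) = a *: H u + H v;
  lieHH : forall u v, lie (H u) (H v) = 0;
  lieEF : forall i j, lie (E i) (F j) = if i == j then H (alphav i) else 0;
  lieHE : forall u i, lie (H u) (E i) = (alpha i u : C) *: E i;
  lieHF : forall u i, lie (H u) (F i) = - (alpha i u : C) *: F i;
  km_ind : forall P : L -> Prop, lin_closed P ->
    (forall x y, P x -> P y -> P (lie x y)) ->
    (forall u, P (H u)) -> (forall i, P (E i)) -> (forall i, P (F i)) ->
    forall x, P x }.

Definition wt w : 'Hom(h, C^o) := \sum_(i <- w) alpha i.

Definition rs gamma x := forall u, lie (H u) x = (gamma u : C) *: x.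

Lemma wt_cons i w : wt (i :: w) = alpha i + wt w.
Proof. by rewrite /wt big_cons. Qed.

Lemma rs_lin gamma : lin_closed (rs gamma).
Proof.
split=> [u|a x y ex ey u]; first by rewrite lie0r scaler0.
by rewrite lie_linearr ex ey scalerDr !scalerA mulrC.
Qed.

Lemma rs_lie g1 g2 x y : rs g1 x -> rs g2 y -> rs (g1 + g2) (lie x y).
Proof.
by move=> ex ey u; rewrite lieA ex ey lieZl lieZr -scalerDl add_lfunE.
Qed.

Hypothesis km : km_relations.

Lemma H0 : H 0 = 0.
Proof. by have := H_linear km (-1) 0 0; rewrite scaler0 addr0 scaleN1r addNr. Qed.

Lemma HD u v : H (u + v) = H u + H v.
Proof. by have := H_linear km 1 u v; rewrite !scale1r. Qed.

Lemma HZ a u : H (a *: u) = a *: H u.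
Proof. by have := H_linear km a u 0; rewrite H0 !addr0. Qed.

Lemma HN u : H (- u) = - H u.
Proof. by rewrite -scaleN1r HZ scaleN1r. Qed.

Lemma rsE i : rs (alpha i) (E i).
Proof. by move=> v; rewrite (lieHE km). Qed.

Lemma rsF i : rs (- alpha i) (F i).
Proof. by move=> v; rewrite (lieHF km) opp_lfunE. Qed.

Lemma wt0 : wt [::] = 0. Proof. by rewrite /wt big_nil. Qed.

Lemma rs_ewE w : rs (wt w) (ew E w).
Proof.
elim: w => [|i w IH]; first exact: lin_closed0 (rs_lin _).
case: w IH => [|j w] IH; rewrite wt_cons; first by rewrite wt0 addr0; exact: rsE.
by rewrite ew_cons //; apply: rs_lie => //; exact: rsE.
Qed.

Lemma rs_ewF w : rs (- wt w) (ew F w).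
Proof.
elim: w => [|i w IH]; first exact: lin_closed0 (rs_lin _).
case: w IH => [|j w] IH; rewrite wt_cons opprD.
  by rewrite wt0 oppr0 addr0; exact: rsF.
by rewrite ew_cons //; apply: rs_lie => //; exact: rsF.
Qed.

Definition piece (k : int) x : Prop :=
  match k with
  | Posz 0 => exists u, x = H u
  | Posz k'.+1 => lev E k'.+1 x
  | Negz k' => lev F k'.+1 x
  end.

Lemma piece_lin k : lin_closed (piece k).
Proof.
case: k => [[|k]|k]; try exact: lev_lin.
split=> [|a _ _ [u ->] [v ->]]; first by exists 0; rewrite H0.
by exists (a *: u + v); rewrite (H_linear km).
Qed.

Lemma piece_lieH k u x : piece k x -> piece k (lie (H u) x).
Proof.
case: k => [[|k]|k] /=.
- by move=> [v ->]; exists 0; rewrite H0 (lieHH km).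
- move: x; apply: lev_ind; first exact: lie_lin_closed (lev_lin _ _).
  move=> w wk; rewrite rs_ewE; apply: lin_closedZ (lev_lin _ _) _.
  by rewrite -wk; exact: lev_ew.
- move: x; apply: lev_ind; first exact: lie_lin_closed (lev_lin _ _).
  move=> w wk; rewrite rs_ewF; apply: lin_closedZ (lev_lin _ _) _.
  by rewrite -wk; exact: lev_ew.
Qed.

Lemma piece_lieE_neg k i x : lev F k.+1 x -> piece (- (k%:Z)) (lie (E i) x).
Proof.
elim: k x => [|k IH] x.
  move: x; apply: lev1_case; first exact: lie_lin_closed (piece_lin 0).
  by move=> j /=; rewrite (lieEF km); case: eqP => _; [exists (alphav i)|exists 0; rewrite H0].
move: x; apply: levS_case; first exact: lie_lin_closed (piece_lin _).
move=> j y ky; rewrite lieA; apply: lin_closedD (piece_lin _) _ _.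
  rewrite (lieEF km); case: eqP => _; last by rewrite lie0l; exact: lin_closed0 (piece_lin _).
  exact: (@piece_lieH (Negz k)).
have := IH _ ky; case: k ky {IH} => [|k] ky /=.
  move=> [u ->]; rewrite lieC (lieHF km); apply: lin_closedN (lev_lin _ _) _.
  by apply: lin_closedZ (lev_lin _ _) _; exact: lev1.
exact: levS.
Qed.

Lemma piece_lieF_pos k i x : lev E k.+1 x -> piece k%:Z (lie (F i) x).
Proof.
elim: k x => [|k IH] x.
  move: x; apply: lev1_case; first exact: lie_lin_closed (piece_lin 0).
  move=> j /=; rewrite lieC (lieEF km); case: eqP => _.
    by exists (- alphav j); rewrite HN.
  by exists 0; rewrite H0 oppr0.
move: x; apply: levS_case; first exact: lie_lin_closed (piece_lin k.+1).
move=> j y ky; rewrite lieA; apply: lin_closedD (piece_lin k.+1) _ _.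
  rewrite [lie (F i) _]lieC (lieEF km) lieNl; apply: lin_closedN (piece_lin k.+1) _.
  case: eqP => _; last by rewrite lie0l; exact: lin_closed0 (piece_lin k.+1).
  exact: (@piece_lieH k.+1).
have := IH _ ky; case: k ky {IH} => [|k] ky /=.
  move=> [u ->]; rewrite lieC (lieHE km); apply: lin_closedN (lev_lin _ _) _.
  by apply: lin_closedZ (lev_lin _ _) _; exact: lev1.
exact: levS.
Qed.

Lemma piece_lieE k i x : piece k x -> piece (k + 1) (lie (E i) x).
Proof.
case: k => [[|k]|k].
- move=> [u ->]; rewrite lieC (lieHE km); apply: lin_closedN (lev_lin _ _) _.
  by apply: lin_closedZ (lev_lin _ _) _; exact: lev1.
- have -> : k.+1%:Z + 1 = k.+2 by lia.
  exact: levS.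
- have -> : Negz k + 1 = - k%:Z by lia.
  exact: piece_lieE_neg.
Qed.

Lemma piece_lieF k i x : piece k x -> piece (k - 1) (lie (F i) x).
Proof.
case: k => [[|k]|k].
- move=> [u ->]; rewrite lieC (lieHF km); apply: lin_closedN (lev_lin _ _) _.
  by apply: lin_closedZ (lev_lin _ _) _; exact: lev1.
- have -> : k.+1%:Z - 1 = k by lia.
  exact: piece_lieF_pos.
- have -> : Negz k - 1 = Negz k.+1 by lia.
  exact: levS.
Qed.

Inductive dec : L -> Prop :=
| Dec0 : dec 0
| DecS k x y : piece k x -> dec y -> dec (x + y).

Lemma dec_piece k x : piece k x -> dec x.
Proof. by move=> kx; rewrite -[x]addr0; apply: DecS kx _; constructor. Qed.

Lemma dec_lin : lin_closed dec.
Proof.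
split=> [|a x y]; first by constructor.
elim=> [|k u v ku _ IH] dy; first by rewrite scaler0 add0r.
rewrite scalerDr -addrA; apply: DecS (IH dy).
by apply: lin_closedZ (piece_lin k) ku.
Qed.

(** Induction over brackets needs more than x in [dec]: stability of [dec] under ad x is carried
    along, since ad [x, y] is the commutator of ad x and ad y. *)
Lemma decP x : dec x.
Proof.
suff [] : dec x /\ (forall y, dec y -> dec (lie x y)) by [].
elim/(km_ind km): x => [|x y [dx Dx] [dy Dy]|u|i|i].
- split=> [|a x y [dx Dx] [dy Dy]]; split; first exact: Dec0.
  + by move=> y _; rewrite lie0l; constructor.
  + exact: (lin_closedP dec_lin).
  + move=> z dz; rewrite lie_linearl; apply: (lin_closedP dec_lin); first exact: Dx.
    exact: Dy.
- split; first exact: Dx.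
  move=> z dz; rewrite lieAl; apply: lin_closedD dec_lin _ _; first by apply/Dx/Dy.
  by apply: lin_closedN dec_lin _; apply/Dy/Dx.
- split; first by apply: (@dec_piece 0); exists u.
  move=> y; elim=> [|k v z kv _ IH]; first by rewrite lie0r; constructor.
  by rewrite lieDr; apply: DecS IH; exact: piece_lieH kv.
- split; first by apply: (@dec_piece 1); exact: lev1.
  move=> y; elim=> [|k v z kv _ IH]; first by rewrite lie0r; constructor.
  by rewrite lieDr; apply: DecS IH; exact: piece_lieE kv.
- split; first by apply: (@dec_piece (Negz 0)); exact: lev1.
  move=> y; elim=> [|k v z kv _ IH]; first by rewrite lie0r; constructor.
  by rewrite lieDr; apply: DecS IH; exact: piece_lieF kv.
Qed.

Variable rho : h.
Hypothesis alpha_rho : forall i, alpha i rho = 1.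

Lemma wt_rho w : wt w rho = (size w)%:R.
Proof.
elim: w => [|i w IH]; first by rewrite wt0 zero_lfunE.
by rewrite wt_cons add_lfunE IH alpha_rho /= -natr1 addrC.
Qed.

(** Unlike [piece], this notion of degree is visibly additive under brackets; [GrP] identifies the
    two. *)
Definition Gr (k : int) x := lie (H rho) x = (k%:~R : C) *: x.

Lemma Gr_lin k : lin_closed (Gr k).
Proof.
split=> [|a x y ex ey]; first by rewrite /Gr lie0r scaler0.
by rewrite /Gr lie_linearr ex ey scalerDr !scalerA mulrC.
Qed.

Lemma piece_Gr k x : piece k x -> Gr k x.
Proof.
case: k => [[|k]|k] /=.
- by move=> [u ->]; rewrite /Gr (lieHH km) scale0r.
- move: x; apply: lev_ind; first exact: Gr_lin.
  by move=> w wk; rewrite /Gr rs_ewE wt_rho wk.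
- move: x; apply: lev_ind; first exact: Gr_lin.
  by move=> w wk; rewrite /Gr rs_ewF opp_lfunE wt_rho wk NegzE mulrNz.
Qed.

Let Drho (t : unit) x := lie (H rho) x.
Let Drho_lin t a x y : Drho t (a *: x + y) = a *: Drho t x + Drho t y.
Proof. exact: lie_linearr. Qed.

Definition awayG (k : int) := awayx Drho (fun _ => k%:~R).

Lemma awayG_lin k : lin_closed (awayG k). Proof. exact: awayx_lin. Qed.

Lemma Gr_awayG k l x : Gr k x -> k != l -> awayG l x.
Proof.
move=> kx kl; apply: (@eigen_awayx _ _ _ _ _ (fun _ => k%:~R)); first by case; exact: kx.
by exists tt => /eqP; rewrite eqr_int (negbTE kl).
Qed.

Lemma Gr_away k (J : L -> Prop) y z :
  lin_closed J -> (forall x, J x -> J (lie (H rho) x)) ->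
  Gr k y -> awayG k z -> J (y + z) -> J y.
Proof.
by move=> JL JH ky; apply: (eigen_away Drho_lin JL) => [[]|[]]; [exact: JH | exact: ky].
Qed.

Lemma lin_closed_zero : lin_closed (fun x : L => x = 0).
Proof. by split=> // a x y -> ->; rewrite scaler0 addr0. Qed.

Lemma Gr_away0 k y z : Gr k y -> awayG k z -> y + z = 0 -> y = 0.
Proof.
move=> ky kz; apply: (Gr_away lin_closed_zero _ ky kz).
by move=> _ ->; rewrite lie0r.
Qed.

Lemma dec_split k x : exists2 y, piece k y & awayG k (x - y).
Proof.
elim: (decP x) => [|l u v lu _ [y ky av]].
  exists 0; first exact: lin_closed0 (piece_lin k).
  by rewrite subr0; exact: lin_closed0 (awayG_lin k).
have [e|lk] := eqVneq l k.
  exists (u + y); last by rewrite opprD addrACA subrr add0r.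
  by apply: lin_closedD (piece_lin k) _ ky; rewrite -e.
exists y => //; rewrite -addrA; apply: lin_closedD (awayG_lin k) _ av.
exact: Gr_awayG (piece_Gr lu) lk.
Qed.

Lemma Gr_piece k x : Gr k x -> piece k x.
Proof.
move=> kx; have [y ky axy] := dec_split k x.
suff /eqP : y - x = 0 by rewrite subr_eq0 => /eqP <-.
apply: (@Gr_away0 k _ (x - y)) => //; last by rewrite addrC subrKA subrr.
by apply: lin_closedD (Gr_lin k) _ (lin_closedN (Gr_lin k) kx); exact: piece_Gr.
Qed.

Lemma GrP k x : Gr k x <-> piece k x.
Proof. by split; [exact: Gr_piece | exact: piece_Gr]. Qed.

Lemma Gr_ind (P : L -> Prop) :
  P 0 -> (forall x y, P x -> P y -> P (x + y)) -> (forall k x, Gr k x -> P x) ->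
  forall x, P x.
Proof.
move=> P0 PD PG x; elim: (decP x) => [//|k u v ku _ Pv].
by apply: PD Pv; apply: (PG k); exact: piece_Gr.
Qed.

Lemma Gr_lie k l x y : Gr k x -> Gr l y -> Gr (k + l) (lie x y).
Proof. by move=> kx ly; rewrite /Gr lieA kx ly lieZl lieZr -scalerDl intrD. Qed.

(** Otherwise x is a sum of vectors of weights other than gamma, and [eigen_away] applied to x + (-
    x) = 0 gives x = 0. That the word has a nonzero bracket later rules out proper multiples of a
    simple root. *)
Lemma rs_lev_wt (X : 'I_n -> L) (f : seq 'I_n -> 'Hom(h, C^o)) k gamma x :
  (forall w, rs (f w) (ew X w)) -> lev X k x -> rs gamma x -> x != 0 ->
  exists w, [/\ size w = k, gamma = f w & ew X w != 0].
Proof.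
move=> fX lx gx x0; apply: contrapT => nex; move/eqP: x0; apply.
have Hlin t a (u v : L) : lie (H t) (a *: u + v) = a *: lie (H t) u + lie (H t) v.
  exact: lie_linearr.
have ax : awayx (fun u => lie (H u)) (fun u => gamma u : C) (- x).
  apply: lin_closedN (awayx_lin Hlin _) _.
  apply: (lev_ind (awayx_lin Hlin _) _ lx) => w wk.
  have [->|w0] := eqVneq (ew X w) 0; first exact: lin_closed0 (awayx_lin _ _).
  apply: (eigen_awayx (chi' := fun u => f w u : C)); first exact: fX.
  apply: contrapT => nw; apply: nex; exists w; split=> //; apply/lfunP => u.
  by apply: contrapT => e; apply: nw; exists u => /esym.
apply: (eigen_away Hlin lin_closed_zero _ _ ax).
- by move=> t x' ->; rewrite lie0r.
- exact: gx.
- by rewrite subrr.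
Qed.

Lemma rs_piece gamma x : rs gamma x -> x != 0 ->
  exists2 k : int, gamma rho = k%:~R & piece k x.
Proof.
move=> gx x0; apply: contrapT => nex; move/eqP: x0; apply.
have ax : awayx Drho (fun _ => gamma rho : C) (- x).
  apply: lin_closedN (awayx_lin Drho_lin _) _.
  elim: (decP x) => [|k u v ku _ IH]; first exact: lin_closed0 (awayx_lin _ _).
  apply: lin_closedD (awayx_lin Drho_lin _) _ IH.
  have [e|ne] := eqVneq (gamma rho : C) (k%:~R); last first.
    apply: (eigen_awayx (chi' := fun _ => k%:~R)) ; first by case; exact: (piece_Gr ku).
    by exists tt => e; move/eqP: ne; rewrite e.
  exfalso; apply: nex; exists k => //; apply: Gr_piece.
  by rewrite /Gr -e; exact: gx.
apply: (eigen_away Drho_lin lin_closed_zero _ _ ax).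
- by move=> t x' ->; rewrite /Drho lie0r.
- by case; exact: gx.
- by rewrite subrr.
Qed.

Lemma root_cases gamma x : gamma != 0 -> rs gamma x -> x != 0 ->
  exists w, (0 < size w)%N /\
   ((gamma = wt w /\ lev E (size w) x /\ ew E w != 0) \/
    (gamma = - wt w /\ lev F (size w) x /\ ew F w != 0)).
Proof.
move=> g0 gx x0; have [k _] := rs_piece gx x0; case: k => [[|k]|k] /= px.
- case/eqP: g0; apply/lfunP => u; rewrite zero_lfunE.
  case: px => v ex; have := gx u; rewrite ex (lieHH km) -ex => /esym/eqP.
  by rewrite scaler_eq0 (negbTE x0) orbF => /eqP.
- have [w [wk -> w0]] := rs_lev_wt rs_ewE px gx x0.
  by exists w; rewrite wk; split=> //; left.
- have [w [wk -> w0]] := rs_lev_wt rs_ewF px gx x0.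
  by exists w; rewrite wk; split=> //; right.
Qed.

End Triangular.

(** * Embedding of h in the Kac-Moody algebra *)

Section PresentedTheory.
Variables (K : fieldType) (X : Type) (rel : lie_term K X -> lie_term K X -> Prop).
Let P : lieAlgType K := presented rel.

Definition pcl (t : lie_term K X) : P := pclass rel t.

Lemma pclD s t : pcl (TAdd s t) = pcl s + pcl t.
Proof. exact/esym/pclassD. Qed.

Lemma pclZ a t : pcl (TScale a t) = a *: pcl t.
Proof. exact/esym/pclassZ. Qed.

Lemma pclL s t : pcl (TLie s t) = lie (pcl s) (pcl t).
Proof. exact/esym/pclassL. Qed.

Lemma presented_ind (Q : P -> Prop) : lin_closed Q ->
  (forall x y, Q x -> Q y -> Q (lie x y)) -> (forall g, Q (pcl (TGen g))) ->
  forall x, Q x.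
Proof.
move=> QL Qlie Qg x; rewrite -[x](pclassK (rel := rel)) -/(pcl _).
elim: (repr x) => [g||s Qs t Qt|a t Qt|s Qs t Qt]; first exact: Qg.
- exact: lin_closed0 QL.
- by rewrite pclD; exact: lin_closedD.
- by rewrite pclZ; exact: lin_closedZ.
- by rewrite pclL; exact: Qlie.
Qed.

End PresentedTheory.

Section Verma.
Variables (K : fieldType) (h : vectType K) (n : nat).
Variables (alpha : 'I_n -> 'Hom(h, K^o)) (alphav : 'I_n -> h).
Variable lam : 'Hom(h, K^o).
Implicit Types (f g : seq 'I_n -> K) (w : seq 'I_n) (u : h).

Fixpoint wtf w u : K := if w is i :: w' then (alpha i u : K) + wtf w' u else 0.

(** Transpose of the Verma rule e_i f_j w v = f_j e_i w v + delta_ij (lam - wt w)(alphav_i) w v,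
    where v is the highest weight vector and w a word in the f's. *)
Fixpoint opF i w f : K :=
  if w is j :: w' then
    opF i w' (fun v => f (j :: v))
    + (if i == j then ((lam (alphav i) : K) - wtf w' (alphav i)) * f w' else 0)
  else 0.

(* The representation on functions of words that is dual to the Verma module of
   highest weight lam, with the roles of the e_i and the f_i exchanged. *)
Fixpoint ev (t : lie_term K (km_gen h n)) f w : K :=
  match t with
  | TGen (GenH u) => ((lam u : K) - wtf w u) * f w
  | TGen (GenE i) => f (i :: w)
  | TGen (GenF i) => opF i w f
  | TZero => 0
  | TAdd s t => ev s f w + ev t f w
  | TScale a t => a * ev t f w
  | TLie s t => ev s (ev t f) w - ev t (ev s f) w
  end.

Lemma opF_lin i w a f g :
  opF i w (fun v => a * f v + g v) = a * opF i w f + opF i w g.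
Proof.
elim: w f g => [|j w IH] f g /=; first by rewrite mulr0 addr0.
by rewrite IH; case: eqP => _; ring.
Qed.

Lemma wtf_lin w a u v : wtf w (a *: u + v) = a * wtf w u + wtf w v.
Proof.
elim: w => [|i w IH] /=; first by rewrite mulr0 addr0.
by rewrite IH linearP /=; rewrite /GRing.scale /=; ring.
Qed.

Lemma ev_lin t a f g w :
  ev t (fun v => a * f v + g v) w = a * ev t f w + ev t g w.
Proof.
elim: t a f g w => [[u|i|i]||s IHs t IHt|b t IHt|s IHs t IHt] a f g w /=.
- by ring.
- by [].
- exact: opF_lin.
- by rewrite mulr0 addr0.
- by rewrite IHs IHt; ring.
- by rewrite IHt; ring.
- have es : ev s (fun v => a * f v + g v) = fun v => a * ev s f v + ev s g v.
    by apply/funext => v; exact: IHs.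
  have et : ev t (fun v => a * f v + g v) = fun v => a * ev t f v + ev t g v.
    by apply/funext => v; exact: IHt.
  by rewrite es et IHs IHt; ring.
Qed.

Lemma opF_weight i w u c f :
  opF i w (fun v => (c - wtf v u) * f v)
  = (c - wtf w u) * opF i w f + (alpha i u : K) * opF i w f.
Proof.
elim: w c f => [|j w IH] c f /=; first by rewrite !mulr0 addr0.
have -> : (fun v => (c - ((alpha j u : K) + wtf v u)) * f (j :: v))
        = (fun v => ((c - (alpha j u : K)) - wtf v u) * f (j :: v)).
  by apply/funext => v; rewrite opprD addrA.
by rewrite IH; case: eqP => [->|_]; ring.
Qed.

Lemma ev_zero t w : ev t (fun _ => 0) w = 0.
Proof.
have := ev_lin t (-1) (fun _ => 0) (fun _ => 0) w.
have -> : (fun v : seq 'I_n => -1 * (0:K) + 0) = fun _ => 0.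
  by apply/funext => v; rewrite mulr0 addr0.
by rewrite mulN1r addNr.
Qed.

Lemma ev_add t f g w : ev t (fun v => f v + g v) w = ev t f w + ev t g w.
Proof.
rewrite -[ev t f w]mul1r -ev_lin; congr ev.
by apply/funext => v; rewrite mul1r.
Qed.

Lemma ev_scale t a f w : ev t (fun v => a * f v) w = a * ev t f w.
Proof.
rewrite -[RHS]addr0 -(ev_zero t w) -ev_lin; congr ev.
by apply/funext => v; rewrite addr0.
Qed.

Lemma ev_sub t f g w : ev t (fun v => f v - g v) w = ev t f w - ev t g w.
Proof.
rewrite -mulN1r -ev_scale -ev_add; congr ev.
by apply/funext => v; rewrite mulN1r.
Qed.

Lemma ev_rel s t : km_rel alpha alphav s t -> ev s = ev t.
Proof.
case=> [a x y|x y|i j|x i|x i]; apply/funext => f; apply/funext => w /=.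
- by rewrite wtf_lin linearP /=; rewrite /GRing.scale /=; ring.
- by ring.
- by rewrite eq_sym; case: eqP => [->|_] /=; ring.
- by ring.
- by rewrite opF_weight; ring.
Qed.

Lemma ev_cong s t : lie_cong (km_rel alpha alphav) s t -> ev s = ev t.
Proof.
elim=> {s t} [s t /ev_rel //|//|//|s t u _ -> _ //|s s' t t' _ e1 _ e2
  |a t t' _ e|s s' t t' _ e1 _ e2|s t u|s t|t|t|a b t|t|a s t|a b t
  |u a s t|u a s t|t|s t u]; apply/funext => f; apply/funext => w /=;
  rewrite ?ev_sub ?ev_lin ?ev_add ?ev_scale;
  by [ring | rewrite e | rewrite e1 e2].
Qed.

End Verma.

Section Tilde.
Variables (K : fieldType) (h : vectType K) (n : nat).
Variables (alpha : 'I_n -> 'Hom(h, K^o)) (alphav : 'I_n -> h).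
Local Notation rel := (km_rel alpha alphav).
Local Notation tilde := (km_tilde alpha alphav).

Lemma functional_neq0 (u : h) : u != 0 -> exists lam : 'Hom(h, K^o), lam u != 0.
Proof.
move=> u0; apply: contrapT => nex; case/eqP: u0.
rewrite (coord_vbasis (memvf u)) big1 // => i _.
suff -> : coord (vbasis {:h}) i u = 0 by rewrite scale0r.
apply: contrapT => ne; apply: nex.
by exists (linfun (coord (vbasis {:h}) i : h -> K^o)); rewrite lfunE; apply/eqP.
Qed.

(** At the empty word u acts by the scalar lam(u), and some functional lam separates a nonzero u
    from 0. *)
Lemma tildeH_inj (u : h) : tildeH alpha alphav u = 0 -> u = 0.
Proof.
move=> /pclassP /ev_cong e; apply: contrapT => /eqP /functional_neq0 [lam].
have := congr1 (fun g => g (fun _ => 1) [::]) (e lam) => /= /eqP.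
by rewrite mulr1 subr0 => ->.
Qed.

End Tilde.

Section TildeC.
Variables (C : numClosedFieldType) (h : vectType C) (n : nat).
Variables (alpha : 'I_n -> 'Hom(h, C^o)) (alphav : 'I_n -> h).
Local Notation rel := (km_rel alpha alphav).
Local Notation tilde := (km_tilde alpha alphav).
Local Notation tH := (tildeH alpha alphav).
Let tE i : tilde := pgen rel (GenE h i).
Let tF i : tilde := pgen rel (GenF h i).

Lemma tilde_relations : km_relations alpha alphav tH tE tF.
Proof.
split=> [a u v|u v|i j|u i|u i|P PL Plie PH PE PF].
- by rewrite /tildeH -!/(pcl rel _) -pclZ -pclD; apply/pclassP/CRel/RelLin.
- by rewrite -[LHS]/(plie _ _) pclassL; apply/pclassP/CRel/RelHH.
- rewrite -[LHS]/(plie _ _) pclassL.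
  have := CRel (RelEF alpha alphav i j).
  by case: (i == j) => c; apply/pclassP.
- by rewrite -[LHS]/(plie _ _) pclassL -pclZ; apply/pclassP/CRel/RelHE.
- by rewrite -[LHS]/(plie _ _) pclassL -pclZ; apply/pclassP/CRel/RelHF.
- by apply: (presented_ind (Q := P) PL Plie) => -[u|i|i]; [exact: PH | exact: PE | exact: PF].
Qed.

Variable S : lie_ideal tilde.
Local Notation g := (kac_moody S).
Definition kmE i : g := qclass S (tE i).
Definition kmF i : g := qclass S (tF i).

Lemma qclD x y : qclass S (x + y) = (qclass S x : g) + qclass S y.
Proof. exact/esym/qclassD0. Qed.

Lemma qclZ a x : qclass S (a *: x) = a *: (qclass S x : g).
Proof. exact/esym/qclassZ0. Qed.

Lemma qclL x y : qclass S (lie x y) = lie (qclass S x : g) (qclass S y).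
Proof. exact/esym/qclassL0. Qed.

Lemma qcl0 : qclass S 0 = 0 :> g. Proof. by []. Qed.

Lemma qcl_eq0 x : (qclass S x : g) = 0 <-> S x.
Proof. by rewrite -qcl0 qclassP subr0. Qed.

Lemma kac_moody_relations : km_relations alpha alphav (kmH S) kmE kmF.
Proof.
have km := tilde_relations.
split=> [a u v|u v|i j|u i|u i|P PL Plie PH PE PF x].
- by rewrite /kmH (H_linear km) qclD qclZ.
- by rewrite -qclL (lieHH km).
- by rewrite -qclL (lieEF km); case: eqP.
- by rewrite -qclL (lieHE km) qclZ.
- by rewrite -qclL (lieHF km) qclZ.
- rewrite -[x](qclassK (J := S)); elim/(km_ind km): (repr x) => [|y z Py Pz|u|i|i].
  + split=> [|a y z Py Pz]; first exact: lin_closed0 PL.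
    by rewrite qclD qclZ; exact: lin_closedP.
  + by rewrite qclL; exact: Plie.
  + exact: PH.
  + exact: PE.
  + exact: PF.
Qed.

Hypothesis Smax : maximal_ideal S.

Lemma kmH_inj u : kmH S u = 0 -> u = 0.
Proof. by move=> /qcl_eq0 /(proj1 Smax); exact: tildeH_inj. Qed.

(** The preimage of I is an ideal of the big algebra that contains S and meets h trivially, so
    maximality puts it inside S. *)
Lemma kac_moody_max (I : g -> Prop) : lin_closed I ->
  (forall x y, I y -> I (lie x y)) -> (forall u, I (kmH S u) -> u = 0) ->
  forall x, I x -> x = 0.
Proof.
move=> IL Ilie IH x.
have J0 : I (qclass S 0) by exact: (lin_closed0 IL).
have JL a y z : I (qclass S y) -> I (qclass S z) -> I (qclass S (a *: y + z)).
  by rewrite qclD qclZ => Iy Iz; exact: (lin_closedP IL).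
have Jlie y z : I (qclass S z) -> I (qclass S (lie y z)).
  by rewrite qclL; exact: Ilie.
have := proj2 Smax (LieIdeal J0 JL Jlie) => /= Jmax.
rewrite -[x](qclassK (J := S)) => Ix; apply/qcl_eq0; apply: Jmax Ix => [u|y].
  by move/IH ->; exact: (H0 tilde_relations).
by move/qcl_eq0 ->.
Qed.

End TildeC.

(** * The antilinear anti-involution *)

Section DualBases.
Variables (K : fieldType) (h : vectType K) (n : nat).

Lemma dual_functionals (v : 'I_n -> h) : free [seq v i | i : 'I_n] ->
  exists phi : 'I_n -> 'Hom(h, K^o), forall i j, phi i (v j) = (i == j)%:R.
Proof.
move=> vfree; pose X := [tuple v i | i < n].
exists (fun i => linfun (coord X i : h -> K^o)) => i j; rewrite lfunE /=.
have -> : v j = X`_j by rewrite -tnth_nth tnth_mktuple.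
have Xf : free X by exact: vfree.
by rewrite (coord_free j i Xf) eq_sym.
Qed.

(** The values of the functionals on a basis form a matrix with independent rows; the columns of a
    right inverse are the coordinates of the dual vectors. *)
Lemma dual_vectors (a : 'I_n -> 'Hom(h, K^o)) : free [seq a i | i : 'I_n] ->
  exists d : 'I_n -> h, forall i j, a i (d j) = (i == j)%:R.
Proof.
move=> afree; pose X := [tuple a i | i < n].
pose b := vbasis {:h}.
pose M : 'M[K]_(n, \dim {:h}) := \matrix_(i, k) (a i b`_k : K).
have /row_freeP[P MP] : row_free M.
  apply/inj_row_free => v vM; apply/rowP => i; rewrite mxE.
  have /freeP/(_ (fun j => v 0 j)) : free X by [].
  apply; apply/lfunP => u; rewrite sum_lfunE zero_lfunE.
  rewrite (coord_vbasis (memvf u)) -/b.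
  under eq_bigr => j _.
    rewrite scale_lfunE -tnth_nth tnth_mktuple linear_sum /= scaler_sumr.
    under eq_bigr => k _ do rewrite linearZ /= scalerA mulrC -scalerA.
    over.
  rewrite exchange_big big1 // => k _; rewrite -scaler_sumr.
  have := congr1 (fun N : 'rV_(_) => N 0 k) vM; rewrite !mxE.
  under eq_bigr => j _ do rewrite mxE.
  by rewrite /GRing.scale /= => ->; rewrite mulr0.
exists (fun j => \sum_k P k j *: b`_k) => i j.
have := congr1 (fun N : 'M_n => N i j) MP; rewrite !mxE => <-.
by rewrite linear_sum; apply: eq_bigr => k _; rewrite linearZ mxE mulrC.
Qed.

End DualBases.

Section StarMap.
Variables (C : numClosedFieldType) (h : vectType C) (n : nat) (sigma : h -> h).

Record star_map (L : lieAlgType C) (H : h -> L) (E F : 'I_n -> L) (star : L -> L) :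
  Prop := StarMap {
  star_lin : forall a x y, star (a *: x + y) = a^* *: star x + star y;
  star_lie : forall x y, star (lie x y) = lie (star y) (star x);
  starE : forall i, star (E i) = F i;
  starF : forall i, star (F i) = E i;
  starH : forall u, star (H u) = H (sigma u) }.

End StarMap.

Section Star.
Variables (C : numClosedFieldType) (h : vectType C) (n : nat).
Variables (alpha : 'I_n -> 'Hom(h, C^o)) (alphav : 'I_n -> h).
Variables (d : 'I_n -> h) (phi : 'I_n -> 'Hom(h, C^o)).
Hypothesis alpha_d : forall i j, alpha i (d j) = (i == j)%:R.
Hypothesis phi_alphav : forall i j, phi i (alphav j) = (i == j)%:R.
Hypothesis alpha_real : forall i j, ((alpha i (alphav j) : C)^*) = alpha i (alphav j).

(** Every simple root vanishes on [r j], the Cartan entries being real. Adding multiples of [r j]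
    therefore repairs the values of [sigma] at the coroots without disturbing those of the simple
    roots. *)
Let r j := alphav j - \sum_i ((alpha i (alphav j) : C)^*) *: d i.

(* A semilinear map that fixes the coroots and commutes with every simple root;
   it need not be an involution. *)
Definition sigma (u : h) : h :=
  \sum_i ((alpha i u : C)^*) *: d i + \sum_j ((phi j u : C)^*) *: r j.

Lemma sum_delta (V : lmodType C) (f : 'I_n -> V) j :
  \sum_i ((i == j)%:R : C) *: f i = f j.
Proof.
rewrite (bigD1 j) //= eqxx scale1r big1 ?addr0 // => i /negbTE ->.
by rewrite scale0r.
Qed.

Lemma alpha_sum i (c : 'I_n -> C) : alpha i (\sum_j c j *: d j) = c i.
Proof.
rewrite linear_sum /= (bigD1 i) //= linearZ /= alpha_d eqxx /GRing.scale /= mulr1.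
rewrite big1 ?addr0 // => j ji; rewrite linearZ /= alpha_d eq_sym (negbTE ji).
by rewrite /GRing.scale /= mulr0.
Qed.

Lemma alpha_sigma i u : alpha i (sigma u) = (alpha i u : C)^*.
Proof.
rewrite /sigma linearD /= alpha_sum linear_sum big1 ?addr0 // => j _.
by rewrite linearZ linearB /= alpha_sum alpha_real subrr scaler0.
Qed.

Lemma sigma_alphav j : sigma (alphav j) = alphav j.
Proof.
rewrite /sigma; under [X in _ + X]eq_bigr => i _ do rewrite phi_alphav conjC_nat.
by rewrite sum_delta /r addrC subrK.
Qed.

Lemma sigma_lin a u v : sigma (a *: u + v) = a^* *: sigma u + sigma v.
Proof.
rewrite /sigma scalerDr addrACA; congr (_ + _); rewrite scaler_sumr -big_split /=;
  apply: eq_bigr => i _; by rewrite linearP /= rmorphD rmorphM scalerDl scalerA.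
Qed.

Section Central.
Variables (L : lieAlgType C) (H : h -> L) (E F : 'I_n -> L).
Hypothesis km : km_relations alpha alphav H E F.

Lemma H_central u x : (forall i, alpha i u = 0) -> lie (H u) x = 0.
Proof.
move=> au0; move: x; apply: (km_ind km) => [|x y ex ey|v|i|i].
- exact: lie_lin_closed (lin_closed_zero L).
- by rewrite lieA ex ey lie0l lie0r addr0.
- exact: (lieHH km).
- by rewrite (lieHE km) au0 scale0r.
- by rewrite (lieHF km) au0 oppr0 scale0r.
Qed.

(** The action of h factors through the values of the simple roots; hence it does no harm that
    [sigma] is not an involution. *)
Lemma H_alpha u v x : (forall i, alpha i u = alpha i v) ->
  lie (H u) x = lie (H v) x.
Proof.
move=> e; apply/eqP; rewrite -subr_eq0 -lieBl -(HN km) -(HD km); apply/eqP.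
by apply: H_central => i; rewrite linearB /= e subrr.
Qed.

Fixpoint evs (t : lie_term C (km_gen h n)) : L :=
  match t with
  | TGen (GenH u) => H (sigma u)
  | TGen (GenE i) => F i
  | TGen (GenF i) => E i
  | TZero => 0
  | TAdd s t => evs s + evs t
  | TScale a t => a^* *: evs t
  | TLie s t => lie (evs t) (evs s)
  end.

Lemma evs_rel s t : km_rel alpha alphav s t -> evs s = evs t.
Proof.
case=> [a x y|x y|i j|x i|x i] /=.
- by rewrite sigma_lin (H_linear km).
- exact: (lieHH km).
- rewrite (lieEF km) eq_sym; case: eqP => [->|_] //=.
  by rewrite sigma_alphav.
- by rewrite lieC (lieHF km) alpha_sigma scaleNr opprK.
- by rewrite lieC (lieHE km) alpha_sigma rmorphN scaleNr.
Qed.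

Lemma evs_cong s t : lie_cong (km_rel alpha alphav) s t -> evs s = evs t.
Proof.
elim=> {s t} [s t /evs_rel //|//|//|s t u _ -> _ //|s s' t t' _ e1 _ e2
  |a t t' _ e|s s' t t' _ e1 _ e2|s t u|s t|t|t|a b t|t|a s t|a b t
  |u a s t|u a s t|t|s t u] /=.
- by rewrite e1 e2.
- by rewrite e.
- by rewrite e1 e2.
- by rewrite addrA.
- by rewrite addrC.
- by rewrite add0r.
- by rewrite rmorphN rmorph1 scaleN1r addNr.
- by rewrite scalerA rmorphM.
- by rewrite rmorph1 scale1r.
- by rewrite scalerDr.
- by rewrite rmorphD scalerDl.
- by rewrite lie_linearr.
- by rewrite lie_linearl.
- by rewrite lie_xx.
- have e (x y z : L) : lie (lie y x) z = lie z (lie x y).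
    by rewrite lieC [lie y x]lieC lieNr opprK.
  by rewrite !e lie_jacobi.
Qed.

Definition st (x : km_tilde alpha alphav) : L := evs (repr x).

Lemma st_pcl t : st (pclass (km_rel alpha alphav) t) = evs t.
Proof. exact/evs_cong/lie_cong_repr. Qed.

Lemma st_lin a x y : st (a *: x + y) = a^* *: st x + st y.
Proof.
rewrite -[x](pclassK (rel := km_rel alpha alphav)).
rewrite -[y](pclassK (rel := km_rel alpha alphav)).
by rewrite -!/(pcl _ _) -pclZ -pclD /pcl !st_pcl.
Qed.

Lemma st_lie x y : st (lie x y) = lie (st y) (st x).
Proof.
rewrite -[x](pclassK (rel := km_rel alpha alphav)).
rewrite -[y](pclassK (rel := km_rel alpha alphav)).
by rewrite -!/(pcl _ _) -pclL /pcl !st_pcl.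
Qed.

End Central.

Variable S : lie_ideal (km_tilde alpha alphav).
Hypothesis Smax : maximal_ideal S.
Local Notation g := (kac_moody S).
Let tkm := tilde_relations alpha alphav.
Let gkm := kac_moody_relations S.
Let rho := \sum_i d i.

Lemma alpha_rho i : alpha i rho = 1.
Proof.
rewrite /rho -[RHS](alpha_sum i (fun _ => 1)); congr (alpha i _).
by apply: eq_bigr => j _; rewrite scale1r.
Qed.

Let stg : km_tilde alpha alphav -> g := @st g (kmH S) (kmE S) (kmF S).

Let stg_lin a x y : stg (a *: x + y) = a^* *: stg x + stg y.
Proof. exact: st_lin. Qed.

Let stg_lie x y : stg (lie x y) = lie (stg y) (stg x).
Proof. exact: st_lie. Qed.

Let stgH u : stg (tildeH alpha alphav u) = kmH S (sigma u).
Proof. exact: (st_pcl gkm (TGen _)). Qed.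

Let stgE i : stg (pgen _ (GenE h i)) = kmF S i.
Proof. exact: (st_pcl gkm (TGen _)). Qed.

Let stgF i : stg (pgen _ (GenF h i)) = kmE S i.
Proof. exact: (st_pcl gkm (TGen _)). Qed.

Lemma st0 : stg 0 = 0. Proof. exact: (st_pcl gkm TZero). Qed.

(** S is stable under ad [rho], hence contains the h-component of each of its elements, and S meets
    h trivially. *)
Lemma ideal_away x : S x -> awayG (tildeH alpha alphav) rho 0 x.
Proof.
have [y /= [u ->] av] := dec_split tkm alpha_rho 0 x => Sx.
suff : S (tildeH alpha alphav u).
  by move=> /(proj1 Smax) u0; rewrite u0 subr0 in av.
have SL : lin_closed S by split; [exact: ideal0 | exact: ideal_lin].
apply: (Gr_away SL _ _ av); first by move=> x'; exact: ideal_lie.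
  by apply: (piece_Gr (k := 0) tkm alpha_rho); exists u.
by rewrite addrC subrK.
Qed.

(** An eigenvalue c of ad [rho] becomes minus the conjugate of c, which is nonzero when c is. *)
Lemma st_away x : awayG (tildeH alpha alphav) rho 0 x -> awayG (kmH S) rho 0 (stg x).
Proof.
case=> m; elim: m x => [|m IH] x /=; first by move->; rewrite st0; exists 0%N.
move=> [c [u [v [-> eu [t ne] av]]]].
rewrite -[u]scale1r stg_lin rmorph1 scale1r.
apply: lin_closedD (awayG_lin (kmH S) rho 0) _ (IH _ av).
apply: (eigen_awayx (chi' := fun _ => - (c t)^*)); last first.
  exists tt => /eqP; rewrite oppr_eq0 conjC_eq0 => /eqP c0; apply: ne.
  by rewrite c0.
case; rewrite -(H_alpha gkm (u := sigma rho)); last first.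
  by move=> i; rewrite alpha_sigma alpha_rho conjC1.
have <- : stg (tildeH alpha alphav rho) = kmH S (sigma rho) by exact: (st_pcl gkm (TGen _)).
rewrite lieC -stg_lie [lie _ u](eu t) -[_ *: u]addr0 stg_lin st0 addr0.
by rewrite scaleNr.
Qed.

(** The image of S is an ideal of the quotient, and by [st_away] it meets h trivially; so it is
    zero, and the map descends. *)
Lemma st_ideal x : S x -> stg x = 0.
Proof.
move=> Sx; pose I (y : g) := exists2 x, S x & y = stg x.
have IL : lin_closed I.
  split=> [|a _ _ [y Sy ->] [z Sz ->]]; first by exists 0; rewrite ?st0 //; exact: ideal0.
  exists (a^* *: y + z); first exact: ideal_lin.
  by rewrite stg_lin conjCK.
have Ilie y z : I y -> I (- lie y (stg z)).
  move=> [y' Sy' ->]; apply: lin_closedN IL _.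
  exists (lie z y'); first exact: ideal_lie.
  by rewrite stg_lie.
apply: (kac_moody_max Smax IL) => [z y Iy|u [y Sy eu]|]; last by exists x.
- elim/(km_ind gkm): z y Iy => [|y z Iy Iz t It|u t It|i y Iy|i y Iy].
  + split=> [y _|a y z Iy Iz t It]; first by rewrite lie0l; exact: lin_closed0 IL.
    by rewrite lie_linearl; apply: (lin_closedP IL); [exact: Iy | exact: Iz].
  + rewrite lieAl; apply: (lin_closedD IL); first by apply/Iy/Iz.
    by apply/(lin_closedN IL)/Iz/Iy.
  (* Stability under u is known only for u in the image of [sigma]; the element chosen there has the
     same simple root values as u, hence the same action. *)
  + rewrite (H_alpha gkm (v := sigma (\sum_i ((alpha i u : C)^*) *: d i))); last first.
      by move=> i; rewrite alpha_sigma alpha_sum conjCK.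
    rewrite lieC.
    by have := Ilie _ (tildeH alpha alphav (\sum_i ((alpha i u : C)^*) *: d i)) It;
      rewrite stgH.
  + by rewrite lieC; have := Ilie _ (pgen _ (GenF h i)) Iy; rewrite ?stgE ?stgF.
  + by rewrite lieC; have := Ilie _ (pgen _ (GenE h i)) Iy; rewrite ?stgE ?stgF.
- apply: (kmH_inj Smax); apply: (Gr_away0 (k := 0) (z := - stg y) (rho := rho) (H := kmH S)).
  + by apply: (piece_Gr (k := 0) gkm alpha_rho); exists u.
  + by apply: lin_closedN (awayG_lin _ _ _) _; apply/st_away/ideal_away.
  + by rewrite eu subrr.
Qed.

Lemma star_exists : exists star : g -> g, star_map sigma (kmH S) (kmE S) (kmF S) star.
Proof.
have stE x : stg (repr (qclass S x)) = stg x.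
  rewrite -[repr _](subrK x) -[repr _ - x]scale1r stg_lin.
  by rewrite (st_ideal (ideal_repr S x)) scaler0 add0r.
exists (fun x => stg (repr x)).
split=> [a x y|x y|i|i|u].
- rewrite -[x in LHS](qclassK (J := S)) -[y in LHS](qclassK (J := S)).
  by rewrite -qclZ -qclD stE stg_lin.
- rewrite -[x in LHS](qclassK (J := S)) -[y in LHS](qclassK (J := S)).
  by rewrite -qclL stE stg_lie.
- by rewrite stE; exact: (st_pcl gkm (TGen _)).
- by rewrite stE; exact: (st_pcl gkm (TGen _)).
- by rewrite stE; exact: (st_pcl gkm (TGen _)).
Qed.

End Star.

(** * The invariant form *)

Section CoweightForm.
Variables (C : fieldType) (V : lmodType C) (n : nat).
Variables (al ph : 'I_n -> V -> C) (q : 'I_n -> C) (av : 'I_n -> V).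
Hypothesis al_lin : forall i a u v, al i (a *: u + v) = a * al i u + al i v.
Hypothesis ph_lin : forall i a u v, ph i (a *: u + v) = a * ph i u + ph i v.
Hypothesis ph_av : forall i j, ph i (av j) = (i == j)%:R.
Hypothesis q_neq0 : forall i, q i != 0.
Hypothesis q_sym : forall i j, q i * al j (av i) = q j * al i (av j).

(** Let P u be the sum of the [ph i u] multiples of [av i], a projection onto the span of the
    coroots. The condition on coroots fixes (P u | v), which is [S u v]; the form (P u | v) + (u | P
    v) - (P u | P v) extends it by making the kernel of P isotropic. *)
Lemma coweight_form : exists hf : V -> V -> C,
  [/\ forall a u u' v, hf (a *: u + u') v = a * hf u v + hf u' v,
      forall u v, hf u v = hf v u
    & forall k v, hf (av k) v = al k v / q k].
Proof.
pose S u v := \sum_i ph i u * (al i v / q i).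
pose T u v := \sum_i \sum_j ph i u * ph j v * (al j (av i) / q j).
pose hf u v : C := S u v + S v u - T u v.
have alE i j : al i (av j) / q i = al j (av i) / q j.
  by apply/eqP; rewrite eqr_div ?q_neq0 //; apply/eqP; rewrite mulrC -q_sym mulrC.
have sumE a (f g : 'I_n -> C) : a * \sum_i f i + \sum_i g i = \sum_i (a * f i + g i).
  by rewrite mulr_sumr big_split.
exists hf; split.
- move=> a u u' v; rewrite /hf.
  have -> : S (a *: u + u') v = a * S u v + S u' v.
    by rewrite sumE; apply: eq_bigr => i _; rewrite ph_lin; ring.
  have -> : S v (a *: u + u') = a * S v u + S v u'.
    by rewrite sumE; apply: eq_bigr => i _; rewrite al_lin; ring.
  have -> : T (a *: u + u') v = a * T u v + T u' v; last by ring.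
  rewrite sumE; apply: eq_bigr => i _; rewrite sumE; apply: eq_bigr => j _.
  by rewrite ph_lin; ring.
- move=> u v; rewrite /hf [X in X - _ = _]addrC; congr (_ - _).
  rewrite /T exchange_big; apply: eq_bigr => i _; apply: eq_bigr => j _.
  by rewrite alE; ring.
- move=> k v; rewrite /hf.
  have -> : S (av k) v = al k v / q k.
    rewrite /S (bigD1 k) //= ph_av eqxx mul1r big1 ?addr0 // => i /negbTE ik.
    by rewrite ph_av ik mul0r.
  have -> : T (av k) v = S v (av k); last by rewrite addrK.
  rewrite /T (bigD1 k) //= [X in _ + X]big1 ?addr0; last first.
    by move=> i /negbTE ik; apply: big1 => j _; rewrite ph_av ik !mul0r.
  by apply: eq_bigr => j _; rewrite ph_av eqxx mul1r.
Qed.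

End CoweightForm.

Section Form.
Variables (C : numClosedFieldType) (h : vectType C) (n : nat).
Variables (alpha : 'I_n -> 'Hom(h, C^o)) (alphav : 'I_n -> h).
Variables (d : 'I_n -> h) (q : 'I_n -> C) (sigma : h -> h).
Hypothesis alpha_d : forall i j, alpha i (d j) = (i == j)%:R.
Hypothesis q_gt0 : forall i, 0 < q i.

Hypothesis sigma_lin : forall a u v, sigma (a *: u + v) = a^* *: sigma u + sigma v.
Hypothesis sigma_alphav : forall i, sigma (alphav i) = alphav i.
Hypothesis alpha_sigma : forall i u, alpha i (sigma u) = (alpha i u : C)^*.

Variable hf : h -> h -> C.
Hypothesis hf_lin : forall a u u' v, hf (a *: u + u') v = a * hf u v + hf u' v.
Hypothesis hf_sym : forall u v, hf u v = hf v u.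
Hypothesis hf_alphav : forall k v, hf (alphav k) v = (alpha k v : C) / q k.

Section LieAlgebra.
Variables (L : lieAlgType C) (H : h -> L) (E F : 'I_n -> L).
Hypothesis km : km_relations alpha alphav H E F.
Hypothesis H_inj : forall u, H u = 0 -> u = 0.
Variable star : L -> L.
Hypothesis star_s : star_map sigma H E F star.

Definition rho := \sum_i d i.
Let ar : forall i, alpha i rho = 1 := alpha_rho alpha_d.
Local Notation Gr := (Gr H rho).
Local Notation away0 := (awayG H rho 0).

Lemma Gr_cast k l x : Gr k x -> k = l -> Gr l x. Proof. by move=> + <-. Qed.

Lemma Gr_H u : Gr 0 (H u).
Proof. by apply: (piece_Gr (k := 0) km ar); exists u. Qed.

Lemma Gr_E i : Gr 1 (E i).
Proof. by apply: (piece_Gr (k := 1) km ar); exact: lev1. Qed.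

Lemma Gr_F i : Gr (-1) (F i).
Proof. by apply: (piece_Gr (k := -1) km ar); exact: lev1. Qed.

Lemma Gr_levE k x : Gr k.+1%:Z x <-> lev E k.+1 x.
Proof. exact: (GrP km ar k.+1). Qed.

Lemma Gr_levF k x : Gr (- k.+1%:Z) x <-> lev F k.+1 x.
Proof. exact: (GrP km ar (Negz k)). Qed.

Lemma Gr0_H x : Gr 0 x -> exists u, x = H u.
Proof. exact: (Gr_piece km ar). Qed.

Lemma away0_lin : lin_closed away0. Proof. exact: awayG_lin. Qed.

Lemma away0_0 x : Gr 0 x -> away0 x -> x = 0.
Proof.
move=> gx ax; apply: (Gr_away0 gx (lin_closedN away0_lin ax)).
by rewrite subrr.
Qed.

Definition pi0 x : h := xget 0 [set u | away0 (x - H u)].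

Lemma pi0P x : away0 (x - H (pi0 x)).
Proof.
rewrite /pi0; case: xgetP => [u _ //|nex]; exfalso.
have [y [u ->] ax] := dec_split km ar 0 x; exact: (nex u).
Qed.

Lemma pi0_eq x u : away0 (x - H u) -> pi0 x = u.
Proof.
move=> ax; apply/eqP; rewrite -subr_eq0; apply/eqP/H_inj.
apply: away0_0; first exact: Gr_H.
rewrite (HD km) (HN km); set v := H (pi0 x).
have -> : v - H u = (x - H u) - (x - v) by rewrite opprB [RHS]addrC addrA subrK.
exact: lin_closedD away0_lin ax (lin_closedN away0_lin (pi0P x)).
Qed.

Lemma pi0_lin a x y : pi0 (a *: x + y) = a *: pi0 x + pi0 y.
Proof.
apply: pi0_eq; rewrite (H_linear km) opprD addrACA -scalerBr.
exact: (lin_closedP away0_lin a (pi0P x) (pi0P y)).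
Qed.

Lemma pi0_0 : pi0 0 = 0.
Proof. by apply: pi0_eq; rewrite (H0 km) subrr; exact: lin_closed0 away0_lin. Qed.

Lemma pi0D x y : pi0 (x + y) = pi0 x + pi0 y.
Proof. by rewrite -[x]scale1r pi0_lin !scale1r. Qed.

Lemma pi0Z a x : pi0 (a *: x) = a *: pi0 x.
Proof. by rewrite -[a *: x]addr0 pi0_lin pi0_0 addr0. Qed.

Lemma pi0N x : pi0 (- x) = - pi0 x.
Proof. by rewrite -scaleN1r pi0Z scaleN1r. Qed.

Lemma pi0H u : pi0 (H u) = u.
Proof. by apply: pi0_eq; rewrite subrr; exact: lin_closed0 away0_lin. Qed.

Lemma Gr0E x : Gr 0 x -> x = H (pi0 x).
Proof. by move=> /Gr0_H[u ->]; rewrite pi0H. Qed.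

Lemma pi0_Gr k x : Gr k x -> k != 0 -> pi0 x = 0.
Proof. by move=> gx k0; apply: pi0_eq; rewrite (H0 km) subr0; exact: Gr_awayG k0. Qed.

Lemma pi0_lieH u x : pi0 (lie (H u) x) = 0.
Proof.
elim/(Gr_ind km ar): x => [|x y ex ey|k x gx]; first by rewrite lie0r pi0_0.
  by rewrite lieDr pi0D ex ey addr0.
have [k0|k0] := eqVneq k 0; last first.
  by apply: pi0_Gr k0; rewrite -[k]add0r; apply: Gr_lie gx; exact: Gr_H.
by rewrite k0 in gx; rewrite (Gr0E gx) (lieHH km) pi0_0.
Qed.

(** The inverse of ad [rho] on the sum of the nonzero degrees, extended by 0 on h. It supplies the
    factor 1 / k of the form in all degrees at once. *)
Definition intg x : L :=
  xget 0 [set u | away0 u /\ lie (H rho) u = x - H (pi0 x)].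

Lemma intgP x : away0 (intg x) /\ lie (H rho) (intg x) = x - H (pi0 x).
Proof.
rewrite /intg; case: xgetP => [u _ //|nex]; exfalso.
have [m] := pi0P x; move: (x - H (pi0 x)) nex => y nex.
suff H1 : forall m y, away (fun (_ : unit) => lie (H rho)) (fun _ => 0%:~R) m y ->
    exists2 u, away0 u & lie (H rho) u = y.
  by move=> /H1 [u au eu]; exact: (nex u).
move=> {x nex y}m; elim: m => [|m IH] y /=.
  by move->; exists 0; rewrite ?lie0r //; exact: lin_closed0 away0_lin.
move=> [c [u [v [-> eu [t ct] /IH[w aw ew]]]]].
have c0 : c t != 0 by apply/eqP; move=> e; apply: ct; rewrite e.
exists ((c t)^-1 *: u + w).
  apply: (lin_closedP away0_lin) aw.
  by apply: (eigen_awayx eu); exists t.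
by rewrite lie_linearr ew (eu t) scalerA mulVf // scale1r.
Qed.

Lemma intg_eq x u : away0 u -> lie (H rho) u = x - H (pi0 x) -> intg x = u.
Proof.
move=> au eu; have [ai ei] := intgP x.
apply/eqP; rewrite -subr_eq0; apply/eqP; apply: away0_0.
  by rewrite /Gr lieBr ei eu subrr scale0r.
exact: lin_closedD away0_lin ai (lin_closedN away0_lin au).
Qed.

Lemma intg_lin a x y : intg (a *: x + y) = a *: intg x + intg y.
Proof.
have [ax ex] := intgP x; have [ay ey] := intgP y.
apply: intg_eq; first exact: (lin_closedP away0_lin a ax ay).
rewrite lie_linearr ex ey pi0_lin (H_linear km) opprD addrACA scalerBr //.
Qed.

Lemma intg_Gr k x : Gr k x -> k != 0 -> intg x = (k%:~R)^-1 *: x.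
Proof.
move=> gx k0; apply: intg_eq.
  by apply: lin_closedZ away0_lin _; exact: Gr_awayG k0.
rewrite (pi0_Gr gx k0) (H0 km) subr0 lieZr gx scalerA mulVf ?scale1r //.
by rewrite intr_eq0.
Qed.

Lemma intg_Gr0 x : Gr 0 x -> intg x = 0.
Proof.
move=> gx; apply: intg_eq; first exact: lin_closed0 away0_lin.
by rewrite lie0r -(Gr0E gx) subrr.
Qed.

(* On elements of opposite nonzero degrees k and -k this is (rho | [x, y]) / k:
   invariance forces (rho | [x, y]) = ([rho, x] | y). *)
Definition fm x y : C := hf (pi0 x) (pi0 y) + hf rho (pi0 (lie (intg x) y)).

Lemma hf_linr a u v v' : hf u (a *: v + v') = a * hf u v + hf u v'.
Proof. by rewrite hf_sym hf_lin ![hf u _]hf_sym. Qed.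

Lemma hf0 u : hf u 0 = 0.
Proof. by have := hf_linr (-1) u 0 0; rewrite scaler0 addr0 mulN1r addNr. Qed.

Lemma hf0l u : hf 0 u = 0. Proof. by rewrite hf_sym hf0. Qed.

Lemma hfN u v : hf u (- v) = - hf u v.
Proof. by rewrite -[- v]addr0 -scaleN1r hf_linr hf0 addr0 mulN1r. Qed.

Lemma hfD u v v' : hf u (v + v') = hf u v + hf u v'.
Proof. by rewrite -[v]scale1r hf_linr mul1r scale1r. Qed.

Lemma fm_linl a x y z : fm (a *: x + y) z = a * fm x z + fm y z.
Proof.
by rewrite /fm pi0_lin hf_lin intg_lin lie_linearl pi0_lin hf_linr mulrDr addrACA.
Qed.

Lemma fm_linr a x y z : fm z (a *: x + y) = a * fm z x + fm z y.
Proof. by rewrite /fm pi0_lin hf_linr lie_linearr pi0_lin hf_linr mulrDr addrACA. Qed.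

Lemma fmr0 x : fm x 0 = 0.
Proof. by rewrite /fm pi0_0 lie0r pi0_0 !hf0 addr0. Qed.

Lemma fm_Gr k x y : Gr k x -> k != 0 ->
  fm x y = (k%:~R)^-1 * hf rho (pi0 (lie x y)).
Proof.
move=> gx k0; rewrite /fm (pi0_Gr gx k0) hf0l add0r (intg_Gr gx k0) lieZl pi0Z.
by rewrite -[_ *: _]addr0 hf_linr hf0 addr0.
Qed.

Lemma fm_Gr0 x y : Gr 0 x -> fm x y = hf (pi0 x) (pi0 y).
Proof. by move=> gx; rewrite /fm (intg_Gr0 gx) lie0l pi0_0 hf0 addr0. Qed.

Lemma fm_orth k l x y : Gr k x -> Gr l y -> k + l != 0 -> fm x y = 0.
Proof.
move=> gx gy kl; have [k0|k0] := eqVneq k 0.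
  rewrite k0 add0r in kl gx; by rewrite (fm_Gr0 _ gx) (pi0_Gr gy kl) hf0.
by rewrite (fm_Gr _ gx k0) (pi0_Gr (Gr_lie gx gy) kl) hf0 mulr0.
Qed.

(** In opposite nonzero degrees, exchanging x and y changes the sign of the bracket and also that of
    the divisor k. *)
Lemma fm_sym x y : fm x y = fm y x.
Proof.
elim/(Gr_ind km ar): x => [|x x' ex ex'|k x gx].
- by rewrite fmr0 /fm pi0_0 (intg_Gr0 (lin_closed0 (Gr_lin _ _ _))) lie0l pi0_0 hf0l hf0 addr0.
- by rewrite -[x]scale1r fm_linl fm_linr ex ex'.
elim/(Gr_ind km ar): y => [|y y' ey ey'|l y gy].
- by rewrite fmr0 /fm pi0_0 (intg_Gr0 (lin_closed0 (Gr_lin _ _ _))) lie0l pi0_0 hf0l hf0 addr0.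
- by rewrite -[y]scale1r fm_linl fm_linr ey ey'.
have [kl|kl] := eqVneq (k + l) 0; last first.
  by rewrite (fm_orth gx gy kl) (fm_orth gy gx) // addrC.
have [k0|k0] := eqVneq k 0.
  rewrite k0 add0r in kl gx; rewrite kl in gy.
  by rewrite (fm_Gr0 _ gx) (fm_Gr0 _ gy) hf_sym.
have lk : l = - k by apply/eqP; rewrite -addr_eq0 addrC kl.
rewrite lk in gy; have nk0 : - k != 0 by rewrite oppr_eq0.
rewrite (fm_Gr _ gx k0) (fm_Gr _ gy nk0).
by rewrite lieC pi0N hfN mulrN rmorphN invrN mulNr.
Qed.

Lemma fm0l x : fm 0 x = 0. Proof. by rewrite fm_sym fmr0. Qed.

Lemma fmDl x y z : fm (x + y) z = fm x z + fm y z.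
Proof. by rewrite -[x]scale1r fm_linl mul1r scale1r. Qed.

Lemma fmZl a x z : fm (a *: x) z = a * fm x z.
Proof. by rewrite -[a *: x]addr0 fm_linl fm0l addr0. Qed.

Lemma fmNl x z : fm (- x) z = - fm x z.
Proof. by rewrite -scaleN1r fmZl mulN1r. Qed.

Lemma fmDr x y z : fm z (x + y) = fm z x + fm z y.
Proof. by rewrite ![fm z _]fm_sym fmDl. Qed.

Lemma fmZr a x z : fm z (a *: x) = a * fm z x.
Proof. by rewrite ![fm z _]fm_sym fmZl. Qed.

Lemma fmNr x z : fm z (- x) = - fm z x.
Proof. by rewrite ![fm z _]fm_sym fmNl. Qed.

Lemma star0 : star 0 = 0.
Proof.
have := star_lin star_s (-1) 0 0.
by rewrite scaler0 addr0 rmorphN rmorph1 scaleN1r addNr.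
Qed.

Lemma starD x y : star (x + y) = star x + star y.
Proof. by have := star_lin star_s 1 x y; rewrite rmorph1 !scale1r. Qed.

Lemma starZ a x : star (a *: x) = a^* *: star x.
Proof. by rewrite -[a *: x]addr0 (star_lin star_s) star0 addr0. Qed.

Lemma starN x : star (- x) = - star x.
Proof. by rewrite -scaleN1r starZ rmorphN rmorph1 scaleN1r. Qed.

Lemma star_Gr k x : Gr k x -> Gr (- k) (star x).
Proof.
move=> gx; rewrite /Gr (H_alpha km (v := sigma rho)); last first.
  by move=> i; rewrite alpha_sigma ar conjC1.
rewrite -(starH star_s) -(star_lie star_s) lieC gx starN starZ.
by rewrite rmorph_int -scaleNr rmorphN.
Qed.

(** Degree 0 is excluded because there [star] is [sigma]. *)
Lemma starK k x : Gr k x -> k != 0 -> star (star x) = x.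
Proof.
have SL : lin_closed (fun x => star (star x) = x).
  split=> [|a y z ey ez]; first by rewrite !star0.
  by rewrite !(star_lin star_s) conjCK ey ez.
have SE X : (forall i, star (star (X i)) = X i) ->
    forall w, star (star (ew X w)) = ew X w.
  move=> SX; elim=> [|i [|j w] IH]; [by rewrite !star0 | exact: SX | ].
  by rewrite ew_cons // !(star_lie star_s) IH SX.
case: k => [[|k]|k] // gx _.
- move/Gr_levE: gx; move: x; apply: lev_ind => // w _; apply: SE => i.
  by rewrite (starE star_s) (starF star_s).
- move: gx; rewrite NegzE => /Gr_levF; move: x; apply: lev_ind => // w _; apply: SE => i.
  by rewrite (starF star_s) (starE star_s).
Qed.

Lemma lam_alphav i : hf rho (alphav i) = (q i)^-1.
Proof. by rewrite hf_sym hf_alphav ar mul1r. Qed.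

(** The bracket reduces to combinations of the [e_i, f_j], that is, of coroots; [sigma] fixes these,
    and (rho | alphav_i) = 1 / q_i is real. *)
Lemma hf_rho_sigma k x y : Gr k.+1%:Z x -> Gr (- k.+1%:Z) y ->
  hf rho (sigma (pi0 (lie x y))) = (hf rho (pi0 (lie x y)))^*.
Proof.
have s0 : sigma 0 = 0.
  by have := sigma_lin (-1) 0 0; rewrite scaler0 addr0 rmorphN rmorph1 scaleN1r addNr.
pose Q z := hf rho (sigma (pi0 z)) = (hf rho (pi0 z))^*.
have QL : lin_closed Q.
  split=> [|a u v eu ev]; first by rewrite /Q pi0_0 s0 hf0 conjC0.
  by rewrite /Q pi0_lin sigma_lin !hf_linr eu ev rmorphD rmorphM.
have QEF i j : Q (lie (E i) (F j)).
  rewrite /Q (lieEF km); case: eqP => _; last by rewrite pi0_0 s0 hf0 conjC0.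
  rewrite pi0H sigma_alphav lam_alphav.
  by rewrite fmorphV /= conj_Creal // gtr0_real.
have QE i z : Gr (-1) z -> Q (lie (E i) z).
  by move/(Gr_levF 0); move: z; apply: lev1_case => //; exact: lie_lin_closed.
move=> gx gy; rewrite -/(Q (lie x y)).
have Qsw u v : Q (lie u v) -> Q (lie v u).
  by rewrite lieC => /(lin_closedN QL); rewrite opprK.
elim: k x y gx gy => [|k IH] x y /Gr_levE gx gy.
  apply: (Qsw); move: x gx; apply: lev1_case; first exact: lie_lin_closed.
  by move=> i; apply: (Qsw); exact: QE.
apply: (Qsw); move: x gx; apply: levS_case; first exact: lie_lin_closed.
move=> i x /Gr_levE gx; apply: (Qsw); rewrite lieAl.
apply: (lin_closedD QL).
  by apply: QE; apply: Gr_cast (Gr_lie gx gy) _; lia.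
apply/(lin_closedN QL)/IH => //; apply: Gr_cast (Gr_lie (Gr_E i) gy) _; lia.
Qed.

Lemma pi0_star x : Gr 0 x -> pi0 (star x) = sigma (pi0 x).
Proof. by move=> /Gr0_H[u ->]; rewrite (starH star_s) !pi0H. Qed.

Lemma fm_star_pos k x y : Gr k.+1%:Z x -> Gr (- k.+1%:Z) y ->
  fm (star x) (star y) = (fm y x)^*.
Proof.
move=> gx gy; rewrite (fm_Gr _ (star_Gr gx)) // (fm_Gr _ gy) // -(star_lie star_s).
rewrite rmorphM fmorphV /= rmorph_int; congr (_ * _).
rewrite pi0_star; last by apply: Gr_cast (Gr_lie gy gx) _; lia.
rewrite lieC !pi0N hfN.
have sN u : sigma (- u) = - sigma u.
  have := sigma_lin (-1) u 0; rewrite rmorphN rmorph1 !scaleN1r !addr0.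
  have := sigma_lin (-1) 0 0; rewrite scaler0 addr0 rmorphN rmorph1 scaleN1r addNr.
  by move->; rewrite addr0.
by rewrite sN hfN (hf_rho_sigma gx gy) rmorphN.
Qed.

Lemma fm_star k x y : k != 0 -> Gr k x -> Gr (- k) y ->
  fm (star x) (star y) = (fm y x)^*.
Proof.
case: k => [[|k]|k] // _; first exact: fm_star_pos.
by rewrite NegzE opprK => gx gy; rewrite fm_sym (fm_star_pos gy gx) fm_sym.
Qed.

(** * Invariance of the form *)

Definition inv x y z := fm (lie x y) z = fm x (lie y z).

Lemma inv_lin1 y z : lin_closed (fun x => inv x y z).
Proof.
split=> [|a x x' ex ex']; first by rewrite /inv lie0l !fm0l.
by rewrite /inv lie_linearl !fm_linl ex ex'.
Qed.

Lemma inv_lin2 x z : lin_closed (fun y => inv x y z).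
Proof.
split=> [|a y y' ey ey']; first by rewrite /inv lie0l lie0r fm0l fmr0.
by rewrite /inv lie_linearl lie_linearr fm_linl fm_linr ey ey'.
Qed.

Lemma inv_lin3 x y : lin_closed (fun z => inv x y z).
Proof.
split=> [|a z z' ez ez']; first by rewrite /inv lie0r !fmr0.
by rewrite /inv lie_linearr !fm_linr ez ez'.
Qed.

Lemma inv_rev x y z : inv x y z <-> inv z y x.
Proof.
rewrite /inv [lie x y]lieC [lie z y]lieC !fmNl.
rewrite [fm x _]fm_sym [fm z _]fm_sym [lie y z]lieC [lie y x]lieC !fmNl.
by split=> <-; rewrite opprK.
Qed.

(** The two brackets differ by [u, [x, z]], which has no h-component. *)
Lemma inv_H k x u z : Gr k x -> Gr (- k) z -> k != 0 -> inv x (H u) z.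
Proof.
move=> gx gz k0; rewrite /inv (fm_Gr _ gx k0) (fm_Gr (k := k)) //; last first.
  by rewrite -[k]addr0; exact: Gr_lie gx (Gr_H u).
by rewrite lieAl pi0D pi0N pi0_lieH oppr0 addr0.
Qed.

(* With lam = (rho | _), the three ratios lam [x, [y, z]] / k1,
   lam [y, [z, x]] / k2 and lam [z, [x, y]] / k3 coincide as soon as two of them
   do, because their numerators and their denominators both add up to 0. *)
Lemma inv_perm k1 k2 k3 x y z : Gr k1 x -> Gr k2 y -> Gr k3 z ->
  k1 != 0 -> k2 != 0 -> k3 != 0 -> k1 + k2 + k3 = 0 -> inv x y z -> inv y x z.
Proof.
move=> gx gy gz n1 n2 n3 s0; rewrite /inv.
rewrite fm_sym (fm_Gr _ gz n3) (fm_Gr _ gx n1).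
rewrite fm_sym (fm_Gr _ gz n3) (fm_Gr _ gy n2).
have := congr1 (fun u => hf rho (pi0 u)) (lie_jacobi x y z).
rewrite !pi0D !hfD pi0_0 hf0 [lie y x]lieC [lie x z]lieC !lieNr !pi0N !hfN.
set X := hf rho _; set Y := hf rho _; set Z := hf rho _ => e1.
have i1 : (k1%:~R : C) != 0 by rewrite intr_eq0.
have i2 : (k2%:~R : C) != 0 by rewrite intr_eq0.
have i3 : (k3%:~R : C) != 0 by rewrite intr_eq0.
have := congr1 (fun k : int => k%:~R : C) s0; rewrite !intrD /=.
move: i1 i2 i3; set c1 := (k1%:~R : C); set c2 := (k2%:~R : C); set c3 := (k3%:~R : C).
move=> i1 i2 i3 e2 e3.
have e4 : X = c1 * (c3^-1 * Z) by rewrite e3 mulrA mulfV // mul1r.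
have e5 : c1 = - c2 - c3 by rewrite -[LHS](addrK (c2 + c3)) addrA e2; ring.
have e6 : Y = - X - Z by rewrite -[LHS](addrK (X + Z)) -[Y + _]addrCA addrA e1; ring.
by rewrite e6 e4 e5; field; rewrite i2 i3.
Qed.

Lemma inv_orth k1 k2 k3 x y z : Gr k1 x -> Gr k2 y -> Gr k3 z ->
  k1 + k2 + k3 != 0 -> inv x y z.
Proof.
move=> gx gy gz s0; rewrite /inv (fm_orth (Gr_lie gx gy) gz) //.
by rewrite (fm_orth gx (Gr_lie gy gz)) // addrA.
Qed.

Lemma fmEF i j : fm (E i) (F j) = if i == j then (q i)^-1 else 0.
Proof.
rewrite (fm_Gr (k := 1)) //; last exact: Gr_E.
rewrite invr1 mul1r (lieEF km); case: eqP => _; last by rewrite pi0_0 hf0.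
by rewrite pi0H lam_alphav.
Qed.

Lemma fmFE i j : fm (F j) (E i) = if i == j then (q i)^-1 else 0.
Proof. by rewrite fm_sym fmEF. Qed.

Lemma fmHH u v : fm (H u) (H v) = hf u v.
Proof. by rewrite (fm_Gr0 _ (Gr_H u)) !pi0H. Qed.

Lemma fmH_EF u i j :
  fm (H u) (lie (E i) (F j)) = if i == j then (alpha i u : C) / q i else 0.
Proof.
rewrite (lieEF km); case: eqP => _; last by rewrite fmr0.
by rewrite fmHH hf_sym hf_alphav.
Qed.

Lemma inv_FEH j i u : inv (F j) (E i) (H u).
Proof.
rewrite /inv lieC fmNl fm_sym fmH_EF lieC (lieHE km) -scaleNr fmZr fmFE.
by case: eqP => _; rewrite ?mulr0 ?oppr0 // mulNr.
Qed.

Lemma inv_EFH j i u : inv (E i) (F j) (H u).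
Proof.
rewrite /inv fm_sym fmH_EF lieC (lieHF km) -scaleNr opprK fmZr fmEF.
by case: eqP => [->|_]; rewrite ?mulr0.
Qed.

Lemma inv_HEF j i u : inv (H u) (E i) (F j).
Proof. by rewrite /inv fmH_EF (lieHE km) fmZl fmEF; case: eqP; rewrite ?mulr0. Qed.

Lemma inv_HFE j i u : inv (H u) (F j) (E i).
Proof.
rewrite /inv [lie (F j) _]lieC fmNr fmH_EF (lieHF km) fmZl fmFE.
by case: eqP => [->|_]; rewrite ?mulr0 ?oppr0 // mulNr.
Qed.

(* Invariance for the generators is proved by induction on the degree, and has to
   be carried together with the invariance for h one degree higher. *)
Definition PIE (j : nat) := forall i x z,
  Gr j x -> Gr (- j.+1%:Z) z -> inv x (E i) z.
Definition PIF (j : nat) := forall i x z,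
  Gr j.+1 x -> Gr (- j%:Z) z -> inv x (F i) z.
Definition PW (j : nat) := forall u x z, Gr j x -> Gr (- j%:Z) z -> inv (H u) x z.

Lemma PIE0 : PIE 0.
Proof.
move=> i x z /Gr0_H[u ->] /Gr_levF; move: z; apply: lev1_case => [|j].
  exact: inv_lin3.
exact: inv_HEF.
Qed.

Lemma PIF0 : PIF 0.
Proof.
move=> i x z + gz; have [u ->] : exists u, z = H u by apply: Gr0_H; rewrite -oppr0.
move=> /(Gr_levE 0); move: x; apply: lev1_case => [|j]; first exact: inv_lin1.
exact: inv_EFH.
Qed.

Lemma PW1 : PW 1.
Proof.
move=> u x z /(Gr_levE 0) gx /(Gr_levF 0); move: z; apply: lev1_case => [|j].
  exact: inv_lin3.
move: x gx; apply: lev1_case => [|i]; first exact: inv_lin2.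
exact: inv_HEF.
Qed.

(** [star] exchanges e_i and f_i and reverses degrees, so invariance for e_i is carried by
    conjugation to invariance for f_i. *)
Lemma PIF_of_PIE j : PIE j.+1 -> PIF j.+1.
Proof.
move=> IE i x z gx gz.
have gu := star_Gr gx; have gv := star_Gr gz; rewrite opprK in gv.
have n1 : - j.+1%:Z != 0 by lia.
have n2 : - j.+2%:Z != 0 by lia.
have gEu : Gr (- j.+1%:Z) (lie (E i) (star x)).
  by apply: Gr_cast (Gr_lie (Gr_E i) gu) _; lia.
have gvE : Gr j.+2 (lie (star z) (E i)).
  by apply: Gr_cast (Gr_lie gv (Gr_E i)) _; lia.
have ex : star (star x) = x by apply: (starK gx); lia.
have ez : star (star z) = z by apply: (starK gz).
rewrite /inv -ex -ez -!(starE star_s) -!(star_lie star_s).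
rewrite (fm_star n1 gEu) ?opprK // (fm_star n2 gu) ?opprK //.
by congr (_^*); apply/esym/IE.
Qed.

(** For j = 0 the last entry lies in h, where [inv_perm] does not apply, and the identity is checked
    on generators. *)
Lemma PT_of_PIF j m x u : PIF j -> Gr j.+1 x -> Gr (- j%:Z) u -> inv (F m) x u.
Proof.
case: j => [|j] IF gx gu.
  have [v ->] : exists u', u = H u' by apply: Gr0_H; rewrite -oppr0.
  move/(Gr_levE 0): gx; move: x; apply: lev1_case => [|i]; first exact: inv_lin2.
  exact: inv_FEH.
by apply: (inv_perm gx (Gr_F m) gu); [lia.. | exact: IF].
Qed.

(** Put a = [x, e_i] and B = ([a, f_m] | z). Invariance in lower degrees gives (x | [e_i, [f_m, z]])
    = B. On the other side (a | [f_m, z]) is 1 / (j + 2) times the value of (rho | _) on [[a, f_m],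
    z] + [f_m, [a, z]]. The first bracket contributes (j + 1) B, by the formula for the form in
    degree j + 1, and the second, where f_m has degree -1, contributes B. *)
Lemma PIE_step j : PIE j -> PIF j -> PW j.+1 -> PIE j.+1.
Proof.
move=> IE IF W i x z gx /Gr_levF; move: z; apply: levS_case => [|m z].
  exact: inv_lin3.
move=> /Gr_levF gz.
have gEz : Gr (- j%:Z) (lie (E i) z) by apply: Gr_cast (Gr_lie (Gr_E i) gz) _; lia.
have gxF : Gr j (lie x (F m)) by apply: Gr_cast (Gr_lie gx (Gr_F m)) _; lia.
have gxE : Gr j.+2 (lie x (E i)) by apply: Gr_cast (Gr_lie gx (Gr_E i)) _; lia.
have gaF : Gr j.+1 (lie (lie x (E i)) (F m)).
  by apply: Gr_cast (Gr_lie gxE (Gr_F m)) _; lia.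
have gxz : Gr 0 (lie x z) by apply: Gr_cast (Gr_lie gx gz) _; lia.
have nj : j.+1%:Z != 0 by lia.
have [v ev] : exists v, lie (E i) (F m) = H v.
  rewrite (lieEF km); case: eqP => _; first by exists (alphav i).
  by exists 0; rewrite (H0 km).
have bE : fm x (lie (F m) (lie (E i) z)) = fm (lie (lie x (F m)) (E i)) z.
  by rewrite -(IF m x _ gx gEz) (IE i _ _ gxF gz).
have aE : fm x (lie (E i) (lie (F m) z)) = fm (lie (lie x (E i)) (F m)) z.
  rewrite [in LHS]lieA fmDr bE ev -(inv_H v gx gz nj) -fmDl; congr fm.
  by rewrite [RHS]lieAl ev [lie (E i) _]lieC opprK.
rewrite /inv aE (fm_Gr _ gxE) // lieA pi0D hfD.
have -> : hf rho (pi0 (lie (lie (lie x (E i)) (F m)) z))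
    = j.+1%:Z%:~R * fm (lie (lie x (E i)) (F m)) z.
  by rewrite (fm_Gr _ gaF) // mulrA mulfV ?mul1r // intr_eq0.
have -> : hf rho (pi0 (lie (F m) (lie (lie x (E i)) z)))
    = fm (lie (lie x (E i)) (F m)) z.
  have -> y : hf rho (pi0 (lie (F m) y)) = - fm (F m) y.
    by rewrite (fm_Gr _ (Gr_F m)) // rmorphN rmorph1 invrN invr1 mulN1r opprK.
  rewrite [in LHS]lieAl fmDr fmNr -(PT_of_PIF m IF gx gEz) lieC fmNl (IF m x _ gx gEz) bE.
  have [w ew] := Gr0_H gxz; rewrite ew.
  rewrite -[fm (F m) _](inv_FEH m i w) -ew.
  rewrite [lie (F m) (E i)]lieC ev -(HN km) -(W _ _ _ gx gz) (HN km).
  rewrite -opprD opprK lieNl -lieC -fmDl; congr fm.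
  by rewrite [RHS]lieAl ev addrC [lie (E i) _]lieC opprK.
have n2 : (j.+2%:Z%:~R : C) != 0 by rewrite intr_eq0.
apply: (mulfI n2); rewrite mulrA mulfV // mul1r.
by rewrite -[X in _ + X]mul1r -mulrDl; congr (_ * _); rewrite -!pmulrn natr1.
Qed.

Lemma PW_step j : PIF j.+1 -> PW j.+1 -> PW j.+2.
Proof.
move=> IF W u x z gx /Gr_levF; move: z; apply: levS_case => [|m z].
  exact: inv_lin3.
move=> /Gr_levF gz.
have gxF : Gr j.+1 (lie x (F m)) by apply: Gr_cast (Gr_lie gx (Gr_F m)) _; lia.
have gxz : Gr 1 (lie x z) by apply: Gr_cast (Gr_lie gx gz) _; lia.
have gux : Gr j.+2 (lie (H u) x) by rewrite -[j.+2%:Z]add0r; exact: Gr_lie (Gr_H u) gx.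
have e2 : inv (H u) (F m) (lie x z).
  move: (lie x z) gxz => y /(Gr_levE 0); move: y; apply: lev1_case => [|i].
    exact: inv_lin3.
  exact: inv_HFE.
rewrite /inv -(IF m _ _ gux gz) [in RHS]lieA fmDr -(W _ _ _ gxF gz) -e2.
rewrite (lieHF km) fmZl -(PT_of_PIF m IF gx gz) [lie (F m) x]lieC fmNl.
rewrite [lie (H u) (lie x _)]lieA fmDl (lieHF km) lieZr fmZl.
by rewrite -addrA -mulrDr subrr mulr0 addr0.
Qed.

Lemma inv_all_levels j : [/\ PIE j, PIF j & PW j.+1].
Proof.
elim: j => [|j [IE IF W]]; first by split; [exact: PIE0 | exact: PIF0 | exact: PW1].
have IE' := PIE_step IE IF W; have IF' := PIF_of_PIE IE'.
by split=> //; exact: PW_step.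
Qed.

Lemma inv_E i x z : inv x (E i) z.
Proof.
elim/(Gr_ind km ar): x => [|x x' ex ex'|k x gx].
- exact: lin_closed0 (inv_lin1 _ _).
- exact: lin_closedD (inv_lin1 _ _) ex ex'.
elim/(Gr_ind km ar): z => [|z z' ez ez'|l z gz].
- exact: lin_closed0 (inv_lin3 _ _).
- exact: lin_closedD (inv_lin3 _ _) ez ez'.
have [kl|kl] := eqVneq (k + 1 + l) 0; last exact: inv_orth gx (Gr_E i) gz kl.
case: k gx kl => [k|k] gx kl.
  by have [IE _ _] := inv_all_levels k; apply: IE => //; apply: Gr_cast gz _; lia.
apply/inv_rev; have [IE _ _] := inv_all_levels k; apply: IE.
  by apply: Gr_cast gz _; lia.
by apply: Gr_cast gx _; lia.
Qed.

Lemma inv_F i x z : inv x (F i) z.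
Proof.
elim/(Gr_ind km ar): x => [|x x' ex ex'|k x gx].
- exact: lin_closed0 (inv_lin1 _ _).
- exact: lin_closedD (inv_lin1 _ _) ex ex'.
elim/(Gr_ind km ar): z => [|z z' ez ez'|l z gz].
- exact: lin_closed0 (inv_lin3 _ _).
- exact: lin_closedD (inv_lin3 _ _) ez ez'.
have [kl|kl] := eqVneq (k - 1 + l) 0; last exact: inv_orth gx (Gr_F i) gz kl.
case: k gx kl => [[|k]|k] gx kl.
- apply/inv_rev; have [_ IF _] := inv_all_levels 0; apply: IF.
    by apply: Gr_cast gz _; lia.
  by apply: Gr_cast gx _; lia.
- by have [_ IF _] := inv_all_levels k; apply: IF => //; apply: Gr_cast gz _; lia.
- apply/inv_rev; have [_ IF _] := inv_all_levels k.+1; apply: IF.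
    by apply: Gr_cast gz _; lia.
  by apply: Gr_cast gx _; lia.
Qed.

(** The admissible middle entries form a subalgebra, so the generators suffice. *)
Lemma fm_inv x y z : fm (lie x y) z = fm x (lie y z).
Proof.
rewrite -/(inv x y z); move: y x z.
apply: (km_ind km) => [|y y' ey ey' x z|u x z|i x z|i x z].
- split=> [x z|a y y' ey ey' x z]; first exact: lin_closed0 (inv_lin2 _ _).
  exact: (lin_closedP (inv_lin2 x z) a (ey x z) (ey' x z)).
- rewrite /inv [in LHS]lieA fmDl [lie y _]lieC fmNl.
  by rewrite ey' !ey ey' lieAl fmDr fmNr.
- elim/(Gr_ind km ar): x => [|x x' ex ex'|k x gx].
  + exact: lin_closed0 (inv_lin1 _ _).
  + exact: lin_closedD (inv_lin1 _ _) ex ex'.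
  elim/(Gr_ind km ar): z => [|z z' ez ez'|l z gz].
  + exact: lin_closed0 (inv_lin3 _ _).
  + exact: lin_closedD (inv_lin3 _ _) ez ez'.
  have [kl|kl] := eqVneq (k + 0 + l) 0; last exact: inv_orth gx (Gr_H u) gz kl.
  have [k0|k0] := eqVneq k 0; last by apply: inv_H gx _ k0; apply: Gr_cast gz _; lia.
  have gz0 : Gr 0 z by apply: Gr_cast gz _; lia.
  rewrite k0 in gx; rewrite /inv (Gr0E gx) (Gr0E gz0) !(lieHH km).
  by rewrite fm0l fmr0.
- exact: inv_E.
- exact: inv_F.
Qed.

(** * Roots and reflections *)

Hypothesis L_max : forall I : L -> Prop, lin_closed I ->
  (forall x y, I y -> I (lie x y)) -> (forall u, I (H u) -> u = 0) ->
  forall x, I x -> x = 0.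
Variable A : 'M[int]_n.
Hypothesis cartanA : gen_cartan A.
Hypothesis alphaA : forall i j, alpha j (alphav i) = (A i j)%:~R.
Hypothesis qA : forall i j, q i * (A i j)%:~R = q j * (A j i)%:~R.

Definition ap (gamma : 'Hom(h, C^o)) (u : h) : C := gamma u.

Lemma apD g1 g2 u : ap (g1 + g2) u = ap g1 u + ap g2 u.
Proof. by rewrite /ap add_lfunE. Qed.

Lemma apN g u : ap (- g) u = - ap g u.
Proof. by rewrite /ap opp_lfunE. Qed.

Lemma ap0 u : ap 0 u = 0. Proof. by rewrite /ap zero_lfunE. Qed.

Lemma apMn g k u : ap (g *+ k) u = ap g u *+ k.
Proof. by elim: k => [|k IH]; rewrite ?mulr0n ?ap0 // !mulrS apD IH. Qed.

Lemma ap_sum g (c : 'I_n -> C) (v : 'I_n -> h) :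
  ap g (\sum_i c i *: v i) = \sum_i c i * ap g (v i).
Proof. by rewrite /ap linear_sum; apply: eq_bigr => i _; rewrite linearZ. Qed.

Lemma ap_d i j : ap (alpha i) (d j) = (i == j)%:R.
Proof. exact: alpha_d. Qed.

Lemma ap_av i j : ap (alpha j) (alphav i) = (A i j)%:~R.
Proof. exact: alphaA. Qed.

(* The element of h that represents gamma (in the span of the roots) for the
   form on the dual of h: (gamma, delta) = delta (tw gamma). *)
Definition tw gamma : h := \sum_i (q i * ap gamma (d i)) *: alphav i.

Lemma ap_tw g1 g2 : ap g2 (tw g1) = \sum_i q i * ap g1 (d i) * ap g2 (alphav i).
Proof. exact: ap_sum. Qed.

(** The identity [x, y] = (x | y) nu^-1(gamma), for x of weight gamma, with [d_i, x] in place of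
    gamma(d_i) x. Without the weight it is linear in x and in y, so it can be proved on spans of
    words. *)
Definition brk x y := pi0 (lie x y)
  = \sum_i (q i * fm (lie (H (d i)) x) y) *: alphav i.

Lemma brk_lin1 y : lin_closed (fun x => brk x y).
Proof.
split=> [|a x x' ex ex'].
  rewrite /brk lie0l pi0_0 big1 // => i _; by rewrite lie0r fm0l mulr0 scale0r.
rewrite /brk lie_linearl pi0_lin ex ex' scaler_sumr -big_split /=; apply: eq_bigr => i _.
by rewrite lie_linearr fm_linl scalerA -scalerDl; congr (_ *: _); ring.
Qed.

Lemma brk_lin2 x : lin_closed (fun y => brk x y).
Proof.
split=> [|a y y' ey ey'].
  rewrite /brk lie0r pi0_0 big1 // => i _; by rewrite fmr0 mulr0 scale0r.
rewrite /brk lie_linearr pi0_lin ey ey' scaler_sumr -big_split /=; apply: eq_bigr => i _.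
by rewrite fm_linr scalerA -scalerDl; congr (_ *: _); ring.
Qed.

Lemma brk_E i y : Gr (-1) y -> brk (E i) y.
Proof.
move/(Gr_levF 0); move: y; apply: lev1_case => [|j]; first exact: brk_lin2.
rewrite /brk (bigD1 i) //= big1 ?addr0 => [|k ki]; last first.
  by rewrite (lieHE km) alpha_d eq_sym (negbTE ki) scale0r fm0l mulr0 scale0r.
rewrite (lieHE km) alpha_d eqxx scale1r fmEF (lieEF km); case: eqP => [->|_].
  by rewrite pi0H mulfV ?scale1r // gt_eqF.
by rewrite pi0_0 mulr0 scale0r.
Qed.

Lemma brk_pos k x y : Gr k.+1%:Z x -> Gr (- k.+1%:Z) y -> brk x y.
Proof.
elim: k x y => [|k IH] x y /Gr_levE gx gy.
  by move: x gx; apply: lev1_case => [|i]; [exact: brk_lin1 | exact: brk_E].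
move: x gx; apply: levS_case => [|i x /Gr_levE gx]; first exact: brk_lin1.
have e1 : brk (E i) (lie x y).
  by apply: brk_E; apply: Gr_cast (Gr_lie gx gy) _; lia.
have e2 : brk x (lie (E i) y).
  by apply: IH => //; apply: Gr_cast (Gr_lie (Gr_E i) gy) _; lia.
rewrite /brk lieAl pi0D pi0N e1 e2 -sumrN -big_split /=; apply: eq_bigr => j _.
rewrite -scalerBl -mulrBr [in RHS]lieA fmDl.
congr (_ * (_ + _) *: _); first by rewrite -fm_inv.
by rewrite -fm_inv [lie _ (E i)]lieC fmNl opprK.
Qed.

Lemma bracket_rs k gamma x y : rs H gamma x -> Gr k x -> Gr (- k) y -> k != 0 ->
  lie x y = fm x y *: H (tw gamma).
Proof.
move=> rx gx gy k0.
have g0 : Gr 0 (lie x y) by apply: Gr_cast (Gr_lie gx gy) _; lia.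
rewrite (Gr0E g0) -(HZ km); congr H.
case: k gx gy k0 {g0} => [[|k]|k] // gx gy _.
  rewrite (brk_pos gx gy) /tw scaler_sumr; apply: eq_bigr => i _.
  by rewrite rx fmZl scalerA /ap; congr (_ *: _); ring.
rewrite NegzE opprK in gx gy.
rewrite lieC pi0N (brk_pos gy gx) /tw scaler_sumr -sumrN; apply: eq_bigr => i _.
rewrite lieC fmNl fm_inv rx fmZr fm_sym scalerA -scaleNr /ap; congr (_ *: _).
by ring.
Qed.

(** * Vectors of positive degree killed by every f_i *)

Section HighestWeight.

(** Closure under the e_i is built in; closure under h and the f_i follows because the base vectors
    are killed by the f_i. So this is already an ideal. *)
Inductive genI : L -> Prop :=
| GenBase k z : Gr k.+1%:Z z -> (forall i, lie (F i) z = 0) -> genI z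
| GenE' i z : genI z -> genI (lie (E i) z)
| GenLin a y z : genI y -> genI z -> genI (a *: y + z).

Lemma genI_lin : lin_closed genI.
Proof.
split; last exact: GenLin.
apply: (@GenBase 0); first exact: lin_closed0 (Gr_lin _ _ _).
by move=> i; rewrite lie0r.
Qed.

Lemma genI_pi0 x : genI x -> pi0 x = 0.
Proof.
move=> gx; have pL : lin_closed (fun x => pi0 x = 0).
  by split=> [|a y z ey ez]; rewrite ?pi0_0 // pi0_lin ey ez scaler0 addr0.
(* Vanishing of [pi0] is not preserved by e_i; lying in the span of the positive degrees is. *)
suff : forall P : L -> Prop, lin_closed P -> (forall k z, Gr k.+1%:Z z -> P z) -> P x.
  by move/(_ _ pL); apply=> k z gz; apply: pi0_Gr gz _.
elim: gx => [k z gz _|i z _ IH|a y z _ IHy _ IHz] P PL Pg.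
- exact: Pg gz.
- apply: (IH (fun z => P (lie (E i) z))); first exact: lie_lin_closed.
  move=> k y gy; apply: (Pg k.+1); apply: Gr_cast (Gr_lie (Gr_E i) gy) _; lia.
- by apply: (lin_closedP PL); [exact: IHy | exact: IHz].
Qed.

Lemma genI_H u x : genI x -> genI (lie (H u) x).
Proof.
elim=> [k z gz Fz|i z gz IH|a y z _ IHy _ IHz].
- apply: (@GenBase k); first by rewrite -[k.+1%:Z]add0r; exact: Gr_lie (Gr_H u) gz.
  move=> i; rewrite lieA Fz lie0r addr0 [lie (F i) _]lieC (lieHF km).
  by rewrite lieNl lieZl Fz scaler0 oppr0.
- rewrite lieA (lieHE km) lieZl; apply: GenLin; first exact: GenE'.
  exact: GenE'.
- by rewrite lie_linearr; exact: GenLin.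
Qed.

Lemma genI_F j x : genI x -> genI (lie (F j) x).
Proof.
elim=> [k z gz Fz|i z gz IH|a y z _ IHy _ IHz].
- by rewrite Fz; exact: lin_closed0 genI_lin.
- rewrite lieA; apply: (lin_closedD genI_lin); last exact: GenE'.
  rewrite [lie (F j) _]lieC lieNl; apply: (lin_closedN genI_lin).
  rewrite (lieEF km); case: eqP => _; first exact: genI_H.
  by rewrite lie0l; exact: lin_closed0 genI_lin.
- by rewrite lie_linearr; exact: GenLin.
Qed.

(* Such a vector generates an ideal of positive degree. *)
Lemma lowest_eq0 k x : Gr k.+1%:Z x -> (forall i, lie (F i) x = 0) -> x = 0.
Proof.
move=> gx Fx; apply: (L_max genI_lin) => [z y|u /genI_pi0|].
- move: z y; apply: (km_ind km) => [|z z' Iz Iz' y gy|u y|i y|i y].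
  + split=> [y _|a z z' Iz Iz' y gy]; first by rewrite lie0l; exact: lin_closed0 genI_lin.
    by rewrite lie_linearl; apply: GenLin; [exact: Iz | exact: Iz'].
  + rewrite lieAl; apply: (lin_closedD genI_lin); first by apply/Iz/Iz'.
    by apply/(lin_closedN genI_lin)/Iz'/Iz.
  + exact: genI_H.
  + exact: GenE'.
  + exact: genI_F.
- by rewrite pi0H.
- exact: GenBase gx Fx.
Qed.

End HighestWeight.

(** * Strings of sl2, Serre relations and reflections *)

Section Sl2.
Variables e f hh : L.
Hypothesis ef : lie e f = hh.
Hypothesis hf2 : lie hh f = (- 2%:R) *: f.

Lemma sl2_weight y M j : lie hh y = M *: y ->
  lie hh (iter j (lie f) y) = (M - j%:R *+ 2) *: iter j (lie f) y.
Proof.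
move=> hy; elim: j => [|j IH]; first by rewrite mul0rn subr0.
rewrite iterS lieA hf2 IH lieZl lieZr -scalerDl; congr (_ *: _).
by rewrite -natr1; ring.
Qed.

Lemma sl2_raise y M j : lie e y = 0 -> lie hh y = M *: y ->
  lie e (iter j.+1 (lie f) y) = (j.+1%:R * (M - j%:R)) *: iter j (lie f) y.
Proof.
move=> ey hy; elim: j => [|j IH].
  by rewrite /= lieA ef ey lie0r addr0 hy subr0 mul1r.
rewrite iterS lieA ef IH (sl2_weight _ hy) lieZr -iterS -scalerDl.
by congr (_ *: _); rewrite -!natr1; ring.
Qed.

End Sl2.

Lemma sl2E i : lie (H (alphav i)) (F i) = (- 2%:R) *: F i.
Proof.
rewrite (lieHF km) alphaA; case: cartanA => -> _ _; by [].
Qed.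

(** The triple (f_i, e_i, - alphav_i) obeys the same relations as (e_i, f_i, alphav_i), so the
    lemmas on strings serve in both directions. *)
Lemma sl2F i : lie (- H (alphav i)) (E i) = (- 2%:R) *: E i.
Proof.
rewrite lieNl (lieHE km) alphaA; case: cartanA => -> _ _; by rewrite scaleNr.
Qed.

Lemma iter_lie_lin (x : L) N a y z :
  iter N (lie x) (a *: y + z) = a *: iter N (lie x) y + iter N (lie x) z.
Proof. by elim: N => //= N ->; rewrite lie_linearr. Qed.

Lemma iter_lie0 (x : L) N : iter N (lie x) 0 = 0.
Proof. by elim: N => //= N ->; rewrite lie0r. Qed.

Lemma iter_lie_comm (x z : L) N y : lie z x = 0 ->
  lie z (iter N (lie x) y) = iter N (lie x) (lie z y).
Proof. by move=> zx; elim: N => //= N IH; rewrite lieA zx lie0l add0r IH. Qed.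

Lemma iter_lie_leib (x : L) M N y z : iter M (lie x) y = 0 -> iter N (lie x) z = 0 ->
  iter (M + N) (lie x) (lie y z) = 0.
Proof.
move: {2}(M + N)%N (erefl (M + N)%N) => s.
elim: s M N y z => [|s IH] [|M] [|N] y z //= es ey ez;
  rewrite ?ey ?ez ?lie0l ?lie0r ?iter_lie0 ?lie0r //.
have -> : lie x (iter (M + N.+1) (lie x) (lie y z))
   = iter (M + N.+1) (lie x) (1 *: lie (lie x y) z + lie y (lie x z)).
  by rewrite scale1r -lieA -iterSr.
rewrite iter_lie_lin (IH M N.+1) ?scaler0 ?add0r; [|lia|by rewrite -iterSr|by []].
by rewrite -addSnnS (IH M.+1 N) //; [lia | rewrite -iterSr].
Qed.

Lemma Gr_iterE i N k x : Gr k x -> Gr (k + N%:Z) (iter N (lie (E i)) x).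
Proof.
move=> gx; elim: N => [|N IH]; first by rewrite addr0.
by apply: Gr_cast (Gr_lie (Gr_E i) IH) _; lia.
Qed.

(** By [lowest_eq0] it is enough that each f_l kills this vector. For l = i the factor m - m of the
    sl2 formula vanishes; for l different from i the bracket with f_l passes through the e_i and
    reaches e_j. *)
Lemma serre i j : i != j -> iter (`|A i j|%N).+1 (lie (E i)) (E j) = 0.
Proof.
move=> ij; have [A2 An A0] := cartanA.
set m := `|A i j|%N; have Am : A i j = - m%:Z by have := An i j ij; rewrite /m; lia.
apply: (@lowest_eq0 m.+1).
  by apply: Gr_cast (Gr_iterE i m.+1 (Gr_E j)) _; lia.
move=> l; have [->|li] := eqVneq l i.
  rewrite (@sl2_raise (F i) (E i) (- H (alphav i)) _ _ _ m%:R m).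
  - by rewrite subrr mulr0 scale0r.
  - by rewrite lieC (lieEF km) eqxx.
  - exact: sl2F.
  - by rewrite lieC (lieEF km) eq_sym (negbTE ij) oppr0.
  - by rewrite lieNl (lieHE km) alphaA Am rmorphN /= scaleNr opprK.
rewrite iter_lie_comm; last by rewrite lieC (lieEF km) eq_sym (negbTE li) oppr0.
rewrite lieC (lieEF km) eq_sym; case: eqP => _; last by rewrite oppr0 iter_lie0.
rewrite iterSr -(HN km) lieC (lieHE km) -scaleNr -[_ *: E i]addr0 iter_lie_lin.
rewrite iter_lie0 addr0.
(* For l = j there remains A_ji (ad e_i)^m e_i. It vanishes for m > 0, and for m = 0 because A_ij =
   0 forces A_ji = 0. *)
case: m Am => [|m] Am; last by rewrite iterSr lie_xx iter_lie0 scaler0.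
have /(A0 i j) e0 : A i j = 0 by rewrite Am oppr0.
by rewrite linearN /= alphaA e0 !oppr0 scale0r.
Qed.

Lemma nilE i x : exists N, iter N (lie (E i)) x = 0.
Proof.
have up N M y : (N <= M)%N -> iter N (lie (E i)) y = 0 -> iter M (lie (E i)) y = 0.
  by move=> /subnK <- e; rewrite iterD e iter_lie0.
move: x; apply: (km_ind km) => [|x y [M ex] [N ey]|u|j|j].
- split=> [|a x y [M ex] [N ey]]; first by exists 0%N.
  exists (maxn M N); rewrite iter_lie_lin (up M) ?leq_maxl // (up N) ?leq_maxr //.
  by rewrite scaler0 addr0.
- by exists (M + N)%N; exact: iter_lie_leib.
- exists 2%N; rewrite /= lieC [lie (E i) (H u)]lieC (lieHE km).
  by rewrite lieNl lieZl lie_xx scaler0 !oppr0.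
- have [->|ij] := eqVneq i j; first by exists 1%N; rewrite /= lie_xx.
  by exists (`|A i j|%N).+1; exact: serre.
- exists 3%N; rewrite /= (lieEF km); case: eqP => _; last by rewrite !lie0r.
  by rewrite [lie (E i) (H _)]lieC (lieHE km) lieNr lieZr lie_xx scaler0 oppr0.
Qed.

Lemma rs_iter gamma i (X : 'I_n -> L) (delta : 'Hom(h, C^o)) N x :
  rs H delta (X i) -> rs H gamma x -> rs H (gamma + delta *+ N) (iter N (lie (X i)) x).
Proof.
move=> rX rx; elim: N => [|N IH]; first by rewrite mulr0n addr0.
by rewrite iterS mulrS addrCA; exact: rs_lie.
Qed.

(** Climb to the top y = (ad e_i)^p x of the string, where alphav_i has the eigenvalue m + 2p. Then
    (ad f_i)^j y is nonzero for j <= m + 2p, and j = m + p steps down lead to gamma - m alpha_i. *)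
Lemma reflect_root gamma x i (m : nat) : rs H gamma x -> x != 0 ->
  ap gamma (alphav i) = m%:R ->
  exists2 y, rs H (gamma - alpha i *+ m) y & y != 0.
Proof.
move=> rx x0 gm.
have exN : exists N, iter N (lie (E i)) x == 0 by have [N /eqP] := nilE i x; exists N.
case: (ex_minnP exN) => -[/= /idP|p /eqP ep minp]; first by rewrite (negbTE x0).
pose y := iter p (lie (E i)) x.
have y0 : y != 0 by apply/negP => /minp; rewrite ltnn.
have ry : rs H (gamma + alpha i *+ p) y by apply: rs_iter => //; exact: rsE km _.
have hy : lie (H (alphav i)) y = (m + p.*2)%:R *: y.
  rewrite ry -/(ap _ _) apD apMn gm ap_av; case: cartanA => -> _ _.
  by congr (_ *: _); rewrite natrD -muln2 natrM; ring.
have ne j : (j <= m + p.*2)%N -> iter j (lie (F i)) y != 0.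
  elim: j => // j IH lj; apply/negP => /eqP e0.
  have := @sl2_raise (E i) (F i) (H (alphav i)) _ _ y _ j ep hy.
  rewrite e0 lie0r => /(_ _ _)/esym/eqP; rewrite scaler_eq0 (negbTE (IH (ltnW lj))) orbF.
  rewrite mulf_eq0 pnatr_eq0 /= subr_eq0 eqr_nat => e.
  have : (m + p.*2 == j)%N by apply: e; [rewrite (lieEF km) eqxx | exact: sl2E].
  by move/eqP => e'; rewrite e' ltnn in lj.
exists (iter (m + p) (lie (F i)) y); last by apply: ne; rewrite leq_add2l -addnn leq_addr.
have -> : gamma - alpha i *+ m = gamma + alpha i *+ p + (- alpha i) *+ (m + p).
  by rewrite mulNrn mulrnDr opprD [- (_ *+ m) + _]addrC addrA addrK.
by apply: rs_iter => //; exact: rsF km i.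
Qed.

(** Stands in for the given form on the dual of h, with which it agrees when the first argument is a
    combination of simple roots. *)
Definition bt g1 g2 : C := ap g2 (tw g1).

(* 2 (rho, gamma) - (gamma, gamma), since (rho, alpha_i) = q_i. *)
Definition cas gamma : C := (\sum_i q i * ap gamma (d i)) *+ 2 - bt gamma gamma.
Local Notation wt := (wt alpha).

Lemma btDl g1 g2 g : bt (g1 + g2) g = bt g1 g + bt g2 g.
Proof.
by rewrite /bt !ap_tw -big_split; apply: eq_bigr => i _; rewrite /= apD mulrDr mulrDl.
Qed.

Lemma btDr g1 g2 g : bt g (g1 + g2) = bt g g1 + bt g g2.
Proof. exact: apD. Qed.

Lemma bt0l g : bt 0 g = 0.
Proof. by rewrite /bt ap_tw big1 // => i _; rewrite ap0 mulr0 mul0r. Qed.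

Lemma btMnl g g' k : bt (g *+ k) g' = bt g g' *+ k.
Proof. by elim: k => [|k IH]; rewrite ?mulr0n ?bt0l // !mulrS btDl IH. Qed.

Lemma btMnr g g' k : bt g' (g *+ k) = bt g' g *+ k.
Proof. exact: apMn. Qed.

Lemma btNl g g' : bt (- g) g' = - bt g g'.
Proof. by apply/eqP; rewrite -addr_eq0 -btDl addNr bt0l. Qed.

Lemma bt_alpha i g : bt (alpha i) g = q i * ap g (alphav i).
Proof.
rewrite /bt ap_tw (bigD1 i) //= ap_d eqxx mulr1 big1 ?addr0 // => j ji.
by rewrite ap_d eq_sym (negbTE ji) mulr0 mul0r.
Qed.

Lemma bt_wt_alpha w i : bt (wt w) (alpha i) = bt (alpha i) (wt w).
Proof.
elim: w => [|j w IH]; first by rewrite (wt0 alpha) bt0l /bt ap0.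
by rewrite wt_cons btDl btDr IH !bt_alpha !ap_av qA.
Qed.

Lemma sum_q_alpha i : \sum_j q j * ap (alpha i) (d j) = q i.
Proof.
rewrite (bigD1 i) //= ap_d eqxx mulr1 big1 ?addr0 // => j ji.
by rewrite ap_d eq_sym (negbTE ji) mulr0.
Qed.

Lemma cas_alpha i : cas (alpha i) = 0.
Proof.
rewrite /cas sum_q_alpha bt_alpha ap_av; case: cartanA => -> _ _.
by apply/eqP; rewrite subr_eq0 mulr_natr.
Qed.

Lemma casD g i m : bt g (alpha i) = bt (alpha i) g ->
  cas (g + alpha i *+ m)
  = cas g + (q i * (m%:R - m%:R ^+ 2 - m%:R * ap g (alphav i))) *+ 2.
Proof.
move=> sym; rewrite /cas.
have -> : \sum_j q j * ap (g + alpha i *+ m) (d j)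
    = \sum_j q j * ap g (d j) + q i *+ m.
  rewrite -(sum_q_alpha i) -sumrMnl -big_split; apply: eq_bigr => j _ /=.
  by rewrite apD apMn mulrDr mulrnAr.
rewrite btDl !btDr btMnl btMnr btMnr btMnl sym !bt_alpha ap_av.
case: cartanA => -> _ _.
set S := \sum_j _; set T := ap g _; set B := bt g g; set Q := q i.
have e x : x *+ m = x * m%:R :> C by rewrite mulr_natr.
rewrite [Q *+ m]e [(Q * T) *+ m]e [(_ *+ m) *+ m]e [(Q * _) *+ m]e.
by move: (m%:R : C) => M {e}; ring.
Qed.

Lemma ap_wt_d w i : ap (wt w) (d i) = (count_mem i w)%:R.
Proof.
elim: w => [|j w IH]; first by rewrite (wt0 alpha) ap0.
by rewrite wt_cons apD IH ap_d /= natrD.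
Qed.

Lemma ap_wt_av w i : exists z : int, ap (wt w) (alphav i) = z%:~R.
Proof.
elim: w => [|j w [z IH]]; first by exists 0; rewrite (wt0 alpha) ap0.
by exists (A i j + z); rewrite wt_cons apD IH ap_av intrD.
Qed.

Lemma ew_nseq k i : ew E (nseq k.+2 i) = 0.
Proof.
elim: k => [|k IH]; first exact: lie_xx.
by rewrite -[LHS]/(lie (E i) (ew E (nseq k.+2 i))) IH lie0r.
Qed.

Lemma root_wt k gamma x : Gr k.+1%:Z x -> rs H gamma x -> x != 0 ->
  exists w, [/\ size w = k.+1, gamma = wt w & ew E w != 0].
Proof. by move/Gr_levE; apply: rs_lev_wt; exact: rs_ewE km. Qed.

Lemma sum_q_wt_gt0 w : (0 < size w)%N -> 0 < \sum_i q i * ap (wt w) (d i).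
Proof.
case: w => // j w _; rewrite (bigD1 j) //= ltr_wpDr //.
  apply: sumr_ge0 => i _; rewrite ap_wt_d; apply: mulr_ge0; first exact: ltW.
  exact: ler0n.
by rewrite ap_wt_d mulr_gt0 // ltr0n /= eqxx.
Qed.

(* If (gamma, alpha_i) > 0 for some i, the reflection of gamma in alpha_i is a
   root of smaller height; otherwise (gamma, gamma) <= 0. *)
Lemma cas_root k gamma x : Gr k.+1%:Z x -> rs H gamma x -> x != 0 ->
  0 <= cas gamma /\ ((0 < k)%N -> 0 < cas gamma).
Proof.
elim/ltn_ind: k gamma x => k IH gamma x gx rx x0.
have [w [wk gw ew0]] := root_wt gx rx x0.
case: k IH gx wk => [|k] IH gx wk.
  split=> //; case: w gw ew0 wk => [|i [|? ?]] // gw _ _.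
  by rewrite gw wt_cons (wt0 alpha) addr0 cas_alpha.
suff: 0 < cas gamma by move=> c0; split=> //; exact: ltW.
case: (pselect (forall i, ap gamma (alphav i) <= 0)) => [neg|].
  have : bt gamma gamma <= 0.
    rewrite /bt ap_tw; apply: sumr_le0 => i _; apply: mulr_ge0_le0 (neg i).
    by rewrite gw ap_wt_d mulr_ge0 ?ler0n // ltW.
  rewrite /cas => b0; rewrite ltr_wpDr ?oppr_ge0 // pmulrn_lgt0 // gw.
  by apply: sum_q_wt_gt0; rewrite wk.
move=> /existsNP[i ni].
have [z ez] := ap_wt_av w i.
have [m zm] : exists m : nat, z = m.+1.
  move: ni; rewrite gw ez lerz0 => /negP; case: z {ez} => [[|m]|m] //= _.
  by exists m.
have am : ap gamma (alphav i) = m.+1%:R by rewrite gw ez zm.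
have [y ry y0] := reflect_root rx x0 am.
(* A word of length at least 2 in the single letter i has bracket 0. So gamma involves another
   simple root alpha_j, whose coefficient the reflection leaves unchanged; hence the reflected root
   is again positive. *)
have [j jw ji] : exists2 j, j \in w & j != i.
  apply/hasP; apply: contraT; rewrite -all_predC => /allP al.
  have /all_pred1P ew_ : all (pred1 i) w.
    by apply/allP => j /al /=; rewrite negbK.
  by move: ew0; rewrite ew_ wk ew_nseq eqxx.
pose beta := gamma - alpha i *+ m.+1.
have bj : ap beta (d j) = (count_mem j w)%:R.
  by rewrite apD apN apMn ap_d eq_sym (negbTE ji) mul0rn subr0 gw ap_wt_d.
have cj : (0 < count_mem j w)%N by rewrite -has_count has_pred1.
have b0 : beta != 0.
  by apply/eqP => e; move: bj; rewrite e ap0 => /esym/eqP; rewrite pnatr_eq0 -leqn0 leqNgt cj.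
have [w' [w'0 [[bw' [ly _]]|[bw' _]]]] := root_cases km ar b0 ry y0; last first.
  move: bj; rewrite bw' apN ap_wt_d => /eqP; rewrite eq_sym -subr_eq0 opprK -natrD.
  by rewrite pnatr_eq0 addn_eq0 -leqn0 leqNgt cj.
have sz : size w' + m.+1 = k.+2 :> nat.
  have : ap beta rho + (m.+1)%:R = k.+2%:R.
    by rewrite /beta apD apN apMn gw /ap (wt_rho ar) wk ar subrK.
  by rewrite bw' /ap (wt_rho ar) -natrD => /eqP; rewrite eqr_nat => /eqP.
have gb : gamma = beta + alpha i *+ m.+1 by rewrite subrK.
have c0 : 0 <= cas beta.
  have e : size w' = (size w').-1.+1 by rewrite prednK.
  rewrite e in ly; have lt : ((size w').-1 < k.+1)%N by lia.
  by have [] := IH _ lt _ _ (proj2 (Gr_levE _ _) ly) ry y0.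
(* Since beta(alphav_i) = -(m + 1), the correction term of [casD] is 2 q_i (m + 1) > 0. *)
rewrite gb casD; last by rewrite bw' bt_wt_alpha.
rewrite ltr_wpDl // pmulrn_lgt0 // mulr_gt0 //.
have -> : ap beta (alphav i) = - m.+1%:R.
  rewrite apD apN apMn am ap_av; case: cartanA => -> _ _.
  by rewrite -mulr_natr; have -> : (2%:~R : C) = 2 by []; ring.
have -> : (m.+1%:R : C) - m.+1%:R ^+ 2 - m.+1%:R * - m.+1%:R = m.+1%:R by ring.
by rewrite ltr0n.
Qed.

(** * Positivity *)

Definition hm x y := fm x (star y).

Lemma hm_linl a x y z : hm (a *: x + y) z = a * hm x z + hm y z.
Proof. exact: fm_linl. Qed.

Lemma hm_sym k x y : k != 0 -> Gr k x -> Gr k y -> hm x y = (hm y x)^*.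
Proof.
move=> k0 gx gy; rewrite /hm -(fm_star _ (star_Gr gx)) ?oppr_eq0 ?opprK //.
by rewrite (starK gx).
Qed.

(** The hypothesis expresses that gamma is a real combination of simple roots. *)
Lemma rs_star gamma x : (forall u v, (forall i, ap (alpha i) v = (ap (alpha i) u)^*) ->
    ap gamma v = (ap gamma u)^*) ->
  rs H gamma x -> rs H (- gamma) (star x).
Proof.
move=> rg rx u; pose v := \sum_i (ap (alpha i) u)^* *: d i.
have av i : ap (alpha i) v = (ap (alpha i) u)^*.
  rewrite ap_sum (bigD1 i) //= ap_d eqxx mulr1 big1 ?addr0 // => j ji.
  by rewrite ap_d eq_sym (negbTE ji) mulr0.
rewrite (H_alpha km (v := sigma v)); last first.
  by move=> i; rewrite alpha_sigma -[alpha i v]/(ap (alpha i) v) av conjCK.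
rewrite -(starH star_s) -(star_lie star_s) lieC starN rx starZ -/(ap _ _) (rg u v av).
by rewrite conjCK -scaleNr -/(ap _ _) apN.
Qed.

Lemma wt_real w u v : (forall i, ap (alpha i) v = (ap (alpha i) u)^*) ->
  ap (wt w) v = (ap (wt w) u)^*.
Proof.
move=> e; elim: w => [|i w IH]; first by rewrite (wt0 alpha) !ap0 conjC0.
by rewrite wt_cons !apD IH e rmorphD.
Qed.

Lemma rs_star_wt w x : rs H (wt w) x -> rs H (- wt w) (star x).
Proof. by apply: rs_star => u v; exact: wt_real. Qed.

Lemma rs_star_Nwt w x : rs H (- wt w) x -> rs H (wt w) (star x).
Proof.
rewrite -[X in _ -> rs H X _]opprK; apply: rs_star => u v e.
by rewrite !apN (wt_real w e) rmorphN.
Qed.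

Lemma hm_orth g1 w x y : rs H g1 x -> rs H (wt w) y -> g1 <> wt w -> hm x y = 0.
Proof.
move=> rx /rs_star_wt ry ne; apply: contrapT => h0; apply: ne.
apply/lfunP => u; have := fm_inv x (H u) (star y).
rewrite lieC fmNl rx ry fmZl fmZr -/(ap _ _) -/(ap _ _) apN mulNr => /oppr_inj /eqP.
by rewrite -subr_eq0 -mulrBl mulf_eq0 subr_eq0 => /orP[/eqP|/eqP].
Qed.

(** * Orthogonal frames and the Casimir operator *)

Section Frames.
Variable k : nat.
Implicit Types Phi : seq (C * L).

(** Expansion in an orthogonal basis. The first components are the inverse squared norms, so no
    vector has to be normalized, and [frame_ok] records the expansion itself instead of
    orthogonality. *)
Definition repro Phi x := x = \sum_(p <- Phi) (p.1 * hm x p.2) *: p.2.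

Lemma repro_lin Phi : lin_closed (repro Phi).
Proof.
split=> [|a x y ex ey]; first by rewrite /repro big1 // => p _; rewrite /hm fm0l mulr0 scale0r.
rewrite /repro {1}ex {1}ey scaler_sumr -big_split; apply: eq_bigr => p _ /=.
by rewrite hm_linl scalerA -scalerDl; congr (_ *: _); ring.
Qed.

Record frame_ok Phi : Prop := FrameOk {
  frame_gt0 : forall p, p \in Phi -> 0 < p.1;
  frame_Gr : forall p, p \in Phi -> Gr k.+1%:Z p.2;
  frame_wt : forall p, p \in Phi -> exists w, rs H (wt w) p.2;
  frame_repro : forall p, p \in Phi -> repro Phi p.2 }.

Definition posdef := forall w x, Gr k.+1%:Z x -> rs H (wt w) x -> x != 0 -> 0 < hm x x.

Lemma star_sum (s : seq (C * L)) (f : C * L -> C) :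
  star (\sum_(p <- s) f p *: p.2) = \sum_(p <- s) (f p)^* *: star p.2.
Proof.
elim: s => [|p s IH]; first by rewrite !big_nil star0.
by rewrite !big_cons starD starZ IH.
Qed.

Lemma hm_sum x (s : seq (C * L)) (f : C * L -> C) :
  hm x (\sum_(p <- s) f p *: p.2) = \sum_(p <- s) (f p)^* * hm x p.2.
Proof.
rewrite /hm; elim: s => [|p s IH]; first by rewrite !big_nil star0 fmr0.
by rewrite !big_cons starD starZ fmDr fmZr IH.
Qed.

Lemma hm_suml x (s : seq (C * L)) (f : C * L -> C) :
  hm (\sum_(p <- s) f p *: p.2) x = \sum_(p <- s) f p * hm p.2 x.
Proof.
rewrite /hm; elim: s => [|p s IH]; first by rewrite !big_nil fm0l.
by rewrite !big_cons fmDl fmZl IH.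
Qed.

(* Gram-Schmidt; the new vector is again a weight vector. *)
Lemma frame_extend Phi w v : posdef -> frame_ok Phi ->
  Gr k.+1%:Z v -> rs H (wt w) v ->
  exists Phi', [/\ frame_ok Phi', repro Phi' v & forall x, repro Phi x -> repro Phi' x].
Proof.
move=> pd ok gv rv.
pose s := \sum_(p <- Phi) (p.1 * hm v p.2) *: p.2.
have gs : Gr k.+1%:Z s.
  rewrite /s big_seq; elim/big_rec: _ => [|p x pP gx]; first exact: lin_closed0 (Gr_lin _ _ _).
  exact: (lin_closedP (Gr_lin _ _ _) _ (frame_Gr ok pP) gx).
have rsv : rs H (wt w) s.
  rewrite /s big_seq; elim/big_rec: _ => [|p x pP rx]; first exact: lin_closed0 (rs_lin _ _).
  apply: (lin_closedD (rs_lin _ _)) rx.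
  have [w' rp] := frame_wt ok pP.
  have [<-|ne] := pselect (wt w' = wt w); first exact: lin_closedZ (rs_lin _ _) rp.
  rewrite (hm_orth rv rp); last by move/esym.
  by rewrite mulr0 scale0r; exact: lin_closed0 (rs_lin _ _).
pose v' := v - s.
have gv' : Gr k.+1%:Z v'.
  exact: lin_closedD (Gr_lin _ _ _) gv (lin_closedN (Gr_lin _ _ _) gs).
have rv' : rs H (wt w) v' by exact: lin_closedD (rs_lin _ _) rv (lin_closedN (rs_lin _ _) rsv).
have kn0 : k.+1%:Z != 0 by [].
have orth p : p \in Phi -> hm v' p.2 = 0.
  move=> pP; have gp := frame_Gr ok pP.
  rewrite /v' /hm fmDl fmNl -!/(hm _ _) hm_suml.
  rewrite {1}(frame_repro ok pP) hm_sum -sumrB big_seq big1 // => p' p'P.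
  rewrite rmorphM /= -(hm_sym kn0 (frame_Gr ok p'P) gp).
  rewrite conj_Creal ?gtr0_real ?(frame_gt0 ok p'P) //.
  by apply/eqP; rewrite subr_eq0; apply/eqP; ring.
have [v'0|v'0] := eqVneq v' 0.
  exists Phi; split=> //; rewrite /repro -/s; apply/eqP; rewrite -subr_eq0 -/v' v'0 //.
have hv := pd _ _ gv' rv' v'0.
pose p0 : C * L := ((hm v' v')^-1, v').
have rPhi p : p \in Phi -> repro (p0 :: Phi) p.2.
  move=> pP; rewrite /repro big_cons /= (hm_sym kn0 (frame_Gr ok pP) gv').
  by rewrite orth // conjC0 mulr0 scale0r add0r -(frame_repro ok pP).
have rp0 : repro (p0 :: Phi) v'.
  rewrite /repro big_cons /= mulVf ?gt_eqF // scale1r big_seq big1 ?addr0 // => p pP.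
  by rewrite orth // mulr0 scale0r.
have mono x : repro Phi x -> repro (p0 :: Phi) x.
  move=> ->; rewrite big_seq; elim/big_rec: _ => [|p y pP ry].
    exact: lin_closed0 (repro_lin _).
  exact: (lin_closedP (repro_lin _) _ (rPhi p pP) ry).
exists (p0 :: Phi); split=> //.
- split=> p; rewrite inE => /orP[/eqP ->|pP] //=.
  + by rewrite invr_gt0.
  + exact: frame_gt0 ok _ pP.
  + exact: frame_Gr ok _ pP.
  + by exists w.
  + exact: frame_wt ok _ pP.
  + exact: rPhi.
- rewrite -[v](subrK s) -/v'; apply: (lin_closedD (repro_lin _)) rp0 _.
  rewrite /s big_seq; elim/big_rec: _ => [|p y pP ry].
    exact: lin_closed0 (repro_lin _).
  exact: (lin_closedP (repro_lin _) _ (rPhi p pP) ry).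
Qed.

Definition frame Phi := frame_ok Phi /\ forall x, Gr k.+1%:Z x -> repro Phi x.

Lemma frame_exists : posdef -> exists Phi, frame Phi.
Proof.
move=> pd.
have H1 (s : seq (seq 'I_n)) : (forall w, w \in s -> size w = k.+1) ->
    exists Phi, frame_ok Phi /\ forall w, w \in s -> repro Phi (ew E w).
  elim: s => [|w s IH] sz; first by exists [::].
  have sz' v : v \in s -> size v = k.+1 by move=> vs; apply: sz; rewrite inE vs orbT.
  have [Phi [ok rPhi]] := IH sz'.
  have wk := sz w (mem_head _ _).
  have gw : Gr k.+1%:Z (ew E w) by apply/Gr_levE; rewrite -wk; exact: lev_ew.
  have [Phi' [ok' rw rw']] := frame_extend pd ok gw (rs_ewE km w).
  exists Phi'; split=> // v; rewrite inE => /orP[/eqP -> //|vs].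
  exact/rw'/rPhi.
have [w wk|Phi [ok rPhi]] := H1 (words n k.+1); first by apply/eqP; rewrite -mem_words.
exists Phi; split=> // x /Gr_levE; move: x; apply: lev_ind; first exact: repro_lin.
by move=> w wk; apply: rPhi; rewrite mem_words wk.
Qed.

(** Apply [star] to the expansion of [star y]. *)
Lemma frame_dual Phi y : frame Phi -> Gr (- k.+1%:Z) y ->
  y = \sum_(p <- Phi) (p.1 * fm p.2 y) *: star p.2.
Proof.
move=> [ok rep] gy.
have n0 : - k.+1%:Z != 0 by [].
have gsy : Gr k.+1%:Z (star y) by have := star_Gr gy; rewrite opprK.
rewrite -{1}(starK gy n0) {1}(rep _ gsy) star_sum big_seq [RHS]big_seq.
apply: eq_bigr => p pP; rewrite rmorphM /= conj_Creal ?gtr0_real ?(frame_gt0 ok pP) //.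
rewrite /hm (fm_star n0 gy) ?conjCK // opprK; exact: (frame_Gr ok pP).
Qed.

End Frames.

(** By invariance, ad f_m from degree k + 2 to k + 1 is the transpose of - ad f_m between the
    opposite degrees. Expanded over both frames, the two sides have the same coefficients. *)
Lemma frame_shift k Phi Psi m x : frame k.+1 Phi -> frame k Psi ->
  \sum_(p <- Phi) p.1 *: lie (lie (F m) p.2) (lie (star p.2) x)
  = - \sum_(p <- Psi) p.1 *: lie p.2 (lie (lie (F m) (star p.2)) x).
Proof.
move=> fPhi fPsi.
have -> : \sum_(p <- Phi) p.1 *: lie (lie (F m) p.2) (lie (star p.2) x)
  = \sum_(p <- Phi) \sum_(p' <- Psi) (p.1 * p'.1 * fm (lie (F m) p.2) (star p'.2))
      *: lie p'.2 (lie (star p.2) x).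
  rewrite big_seq [RHS]big_seq; apply: eq_bigr => p pP.
  have gp := frame_Gr (proj1 fPhi) pP.
  have /(proj2 fPsi) : Gr k.+1%:Z (lie (F m) p.2).
    by apply: Gr_cast (Gr_lie (Gr_F m) gp) _; lia.
  move=> e; rewrite {1}e lie_suml scaler_sumr; apply: eq_bigr => p' _.
  by rewrite lieZl scalerA mulrA.
have -> : \sum_(p <- Psi) p.1 *: lie p.2 (lie (lie (F m) (star p.2)) x)
  = \sum_(p' <- Psi) \sum_(p <- Phi) (p.1 * p'.1 * fm p.2 (lie (F m) (star p'.2)))
      *: lie p'.2 (lie (star p.2) x).
  rewrite big_seq [RHS]big_seq; apply: eq_bigr => p' pP.
  have gp := star_Gr (frame_Gr (proj1 fPsi) pP).
  have /(frame_dual fPhi) : Gr (- k.+2%:Z) (lie (F m) (star p'.2)).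
    by apply: Gr_cast (Gr_lie (Gr_F m) gp) _; lia.
  move=> e; rewrite {1}e lie_suml lie_sumr scaler_sumr; apply: eq_bigr => p _.
  by rewrite lieZl lieZr scalerA mulrCA mulrA.
rewrite exchange_big -sumrN; apply: eq_bigr => p' _; rewrite -sumrN; apply: eq_bigr => p _.
by rewrite -scaleNr lieC fmNl fm_inv mulrN.
Qed.

(** Only degrees 1 to N enter: for x of degree N + 1 the inner brackets then stay in positive
    degree. *)
Definition casimir (Phi : nat -> seq (C * L)) N x :=
  \sum_(j < N) \sum_(p <- Phi j) p.1 *: lie p.2 (lie (star p.2) x).

(* By frame_shift the bracket of casimir Phi N.+1 x with F m telescopes, up to two
   boundary terms, to the value of casimir on lie (F m) x. *)
Lemma casimirE (Phi : nat -> seq (C * L)) N gamma x :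
  (forall j, (j < N)%N -> frame j (Phi j)) ->
  Gr N.+1%:Z x -> rs H gamma x -> casimir Phi N x = cas gamma *: x.
Proof.
elim: N gamma x => [|N IH] gamma x fr gx rx.
  rewrite /casimir big_ord0; have [->|x0] := eqVneq x 0; first by rewrite scaler0.
  have [[|i [|? ?]] [] // _ -> _] := root_wt gx rx x0.
  by rewrite wt_cons (wt0 alpha) addr0 cas_alpha scale0r.
apply/eqP; rewrite -subr_eq0; apply/eqP.
have gT : Gr N.+2%:Z (casimir Phi N.+1 x).
  apply: lin_closed_sum (Gr_lin _ _ _) _ => j.
  rewrite big_seq; elim/big_rec: _ => [|p y pP gy]; first exact: lin_closed0 (Gr_lin _ _ _).
  apply: (lin_closedP (Gr_lin _ _ _)) gy.
  have gp := frame_Gr (proj1 (fr j (ltn_ord j))) pP.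
  by apply: Gr_cast (Gr_lie gp (Gr_lie (star_Gr gp) gx)) _; lia.
apply: (@lowest_eq0 N.+1).
  apply: (lin_closedD (Gr_lin _ _ _) gT); apply: lin_closedN (Gr_lin _ _ _) _.
  exact: lin_closedZ (Gr_lin _ _ _) gx.
move=> m; rewrite lieBr lieZr; set y := lie (F m) x; pose beta := gamma - alpha m.
have gy : Gr N.+1%:Z y by apply: Gr_cast (Gr_lie (Gr_F m) gx) _; lia.
have ry : rs H beta y by rewrite /beta addrC; apply: rs_lie rx; exact: rsF km m.
pose S1 j := \sum_(p <- Phi j) p.1 *: lie (lie (F m) p.2) (lie (star p.2) x).
pose S2 j := \sum_(p <- Phi j) p.1 *: lie p.2 (lie (lie (F m) (star p.2)) x).
pose S3 j := \sum_(p <- Phi j) p.1 *: lie p.2 (lie (star p.2) y).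
have -> : lie (F m) (casimir Phi N.+1 x) = \sum_(j < N.+1) (S1 j + S2 j + S3 j).
  rewrite /casimir lie_sumr; apply: eq_bigr => j _.
  rewrite lie_sumr -!big_split; apply: eq_bigr => p _ /=.
  by rewrite lieZr lieA [lie (F m) (lie _ x)]lieA lieDr -!scalerDr addrA.
rewrite !big_split /=.
(* [frame_shift] turns each [S1] into minus the [S2] one degree lower; [S1 0] and [S2 N] survive. *)
have -> : \sum_(i < N.+1) S1 i = S1 0%N - \sum_(i < N) S2 i.
  rewrite big_ord_recl -sumrN; congr (_ + _); apply: eq_bigr => i _.
  rewrite lift0; apply: frame_shift; apply: fr; last exact: ltnW (ltn_ord i).
  by rewrite ltnS; exact: ltn_ord.
have -> : \sum_(i < N.+1) S2 i = \sum_(i < N) S2 i + S2 N by exact: big_ord_recr.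
have -> : \sum_(i < N.+1) S3 i = cas beta *: y + S3 N.
  rewrite big_ord_recr; congr (_ + _).
  by apply: IH => // j jN; apply: fr; exact: ltnW.
have fN := fr N (ltnSn N).
(* In degree 1 the bracket with f_m is a multiple of alphav_m, and the coefficients resum to f_m by
   [frame_dual]. *)
have e1 : S1 0%N = - (q m * ap beta (alphav m)) *: y.
  have f0 := fr 0%N isT.
  have Fm u : Gr 1 u -> lie (F m) u = - (q m * fm u (F m)) *: H (alphav m).
    have FL : lin_closed (fun u => lie (F m) u = - (q m * fm u (F m)) *: H (alphav m)).
      split=> [|a u' v eu ev]; first by rewrite lie0r fm0l mulr0 oppr0 scale0r.
      by rewrite lie_linearr eu ev scalerA -scalerDl fm_linl; congr (_ *: _); ring.
    move/(Gr_levE 0); move: u; apply: lev1_case => // i.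
    rewrite lieC (lieEF km) fmEF; case: eqP => [->|_]; last by rewrite mulr0 !oppr0 scale0r.
    by rewrite mulfV ?scaleN1r // gt_eqF.
  rewrite /S1 big_seq.
  under eq_bigr => p pP.
    rewrite (Fm _ (frame_Gr (proj1 f0) pP)) lieZl scalerA mulrN mulrCA -mulNr -scalerA.
    rewrite -lieZr -lieZl.
    over.
  rewrite -scaler_sumr -lie_sumr -lie_suml -big_seq.
  have -> : \sum_(p <- Phi 0%N) (p.1 * fm p.2 (F m)) *: star p.2 = F m.
    by rewrite -(frame_dual f0) //; exact: Gr_F.
  by rewrite -/y ry -/(ap _ _) scalerA mulNr.
(* In this term and the next a bracket of opposite degrees lies in h; [bracket_rs] evaluates it, and
   the frame expansion of y resums. *)
have e2 : S2 N = - ap beta (tw gamma) *: y.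
  have t2 p : p \in Phi N -> lie p.2 (lie (lie (F m) (star p.2)) x)
      = - hm y p.2 *: lie (H (tw gamma)) p.2.
    move=> pP; have gp := frame_Gr (proj1 fN) pP.
    have gFp : Gr (- N.+2%:Z) (lie (F m) (star p.2)).
      by apply: Gr_cast (Gr_lie (Gr_F m) (star_Gr gp)) _; lia.
    rewrite [lie (lie (F m) _) x]lieC (bracket_rs rx gx gFp) // lieNr lieZr.
    rewrite [lie p.2 _]lieC scalerN opprK; congr (_ *: _).
    by rewrite -fm_inv [lie x _]lieC fmNl.
  rewrite /S2 scaleNr -[ap beta _ *: y]ry {1}(proj2 fN _ gy) lie_sumr -sumrN.
  rewrite big_seq [RHS]big_seq; apply: eq_bigr => p pP.
  by rewrite t2 // lieZr scalerA mulrN scaleNr.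
have e3 : S3 N = ap beta (tw beta) *: y.
  have t3 p : p \in Phi N -> lie p.2 (lie (star p.2) y)
      = hm y p.2 *: lie (H (tw beta)) p.2.
    move=> pP; have gp := frame_Gr (proj1 fN) pP.
    rewrite [lie _ y]lieC (bracket_rs ry gy (star_Gr gp)) // lieNr lieZr.
    by rewrite [lie p.2 _]lieC scalerN opprK.
  rewrite -[ap beta _ *: y]ry [in RHS](proj2 fN _ gy) lie_sumr /S3.
  rewrite big_seq [RHS]big_seq; apply: eq_bigr => p pP.
  by rewrite t3 // lieZr scalerA.
have -> (s : L) : S1 0%N - s + (s + S2 N) + (cas beta *: y + S3 N) - cas gamma *: y
    = (cas beta - cas gamma - q m * ap beta (alphav m) - ap beta (tw gamma)
       + ap beta (tw beta)) *: y.
  rewrite e1 e2 e3 [_ - s + (s + _)]addrA subrK -!scalerDl -scalerBl; congr (_ *: _).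
  by ring.
have [->|y0] := eqVneq y 0; first by rewrite scaler0.
have [w [_ bw _]] := root_wt gy ry y0.
have gE : gamma = beta + alpha m *+ 1 by rewrite mulr1n subrK.
rewrite -/(bt gamma beta) -/(bt beta beta) {2}gE gE casD; last by rewrite bw bt_wt_alpha.
rewrite mulr1n btDl bt_alpha -[RHS](scale0r y); congr (_ *: _).
by ring.
Qed.

Lemma posdef0 : posdef 0.
Proof.
move=> w x gx _ x0.
pose g (c : 'I_n -> C) := \sum_i c i *: E i.
have [c ex] : exists c, x = g c.
  move/(Gr_levE 0): gx; move: x {x0}; apply: lev1_case => [|i].
    split=> [|a _ _ [c ->] [c' ->]].
      by exists (fun=> 0); rewrite /g big1 // => i _; rewrite scale0r.
    exists (fun i => a * c i + c' i); rewrite /g scaler_sumr -big_split.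
    by apply: eq_bigr => i _ /=; rewrite scalerA scalerDl.
  exists (fun j => (j == i)%:R); rewrite /g (bigD1 i) //= eqxx scale1r big1 ?addr0 //.
  by move=> j /negbTE ->; rewrite scale0r.
have hE i j : hm (E i) (E j) = if i == j then (q i)^-1 else 0.
  by rewrite /hm (starE star_s) fmEF.
have hx : hm x x = \sum_i `|c i| ^+ 2 / q i.
  have hl y : hm (g c) y = \sum_i c i * hm (E i) y.
    rewrite /g; elim: (index_enum _) => [|i s IH]; first by rewrite !big_nil /hm fm0l.
    by rewrite !big_cons hm_linl IH.
  have hr i : hm (E i) (g c) = (c i)^* / q i.
    rewrite (hm_sym (k := 1)) //; [|exact: Gr_E|by rewrite -ex].
    rewrite hl (bigD1 i) //= hE eqxx big1 ?addr0; last first.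
      by move=> j ji; rewrite hE (negbTE ji) mulr0.
    by rewrite rmorphM fmorphV /= [(q i)^*]conj_Creal ?gtr0_real.
  by rewrite ex hl; apply: eq_bigr => i _; rewrite hr mulrA -normCK.
rewrite hx lt_neqAle eq_sym; apply/andP; split; last first.
  by apply: sumr_ge0 => i _; rewrite mulr_ge0 ?invr_ge0 ?exprn_ge0 // ltW.
apply: contra x0; rewrite psumr_eq0 => [/allP c0|i _]; last first.
  by rewrite mulr_ge0 ?invr_ge0 ?exprn_ge0 // ltW.
rewrite ex /g big1 // => i _.
have := c0 i (mem_index_enum i); rewrite /= mulf_eq0 invr_eq0 (gt_eqF (q_gt0 i)) orbF.
by rewrite expf_eq0 /= normr_eq0 => /eqP ->; rewrite scale0r.
Qed.

Lemma posdef_all k : posdef k.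
Proof.
elim/ltn_ind: k => -[|N] IH; first exact: posdef0.
have /choice[Phi fr] : forall j, exists Phi, (j < N.+1)%N -> frame j Phi.
  move=> j; have [jN|_] := boolP (j < N.+1)%N; last by exists [::].
  by have [Phi fPhi] := frame_exists (IH j jN); exists Phi.
move=> w x gx rx x0.
have [_ /(_ isT) c0] := cas_root gx rx x0.
have := casimirE fr gx rx => e.
have star2 j p : (j < N.+1)%N -> p \in Phi j -> Gr j.+1%:Z p.2 /\ star (star p.2) = p.2.
  move=> jN pP; have gp := frame_Gr (proj1 (fr j jN)) pP.
  by split=> //; exact: (starK gp).
have hlie j p : (j < N.+1)%N -> p \in Phi j ->
   hm (lie p.2 (lie (star p.2) x)) x = hm (lie (star p.2) x) (lie (star p.2) x).
  move=> jN pP; have [gp sp] := star2 j p jN pP.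
  rewrite /hm [lie p.2 _]lieC fmNl fm_inv -fmNr; congr fm.
  by rewrite (star_lie star_s) sp lieC opprK.
have term_ge0 j p : (j < N.+1)%N -> p \in Phi j ->
   0 <= hm (lie (star p.2) x) (lie (star p.2) x) /\
   (lie (star p.2) x != 0 -> 0 < hm (lie (star p.2) x) (lie (star p.2) x)).
  move=> jN pP; have [gp sp] := star2 j p jN pP.
  have gy : Gr (N - j).+1%:Z (lie (star p.2) x).
    by apply: Gr_cast (Gr_lie (star_Gr gp) gx) _; lia.
  have [w' rp] := frame_wt (proj1 (fr j jN)) pP.
  have ry := rs_lie (rs_star_wt rp) rx.
  have [y0|y0] := eqVneq (lie (star p.2) x) 0; first by rewrite y0 /hm fm0l.
  have [w2 [_ ew2 _]] := root_wt gy ry y0; rewrite ew2 in ry.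
  have lt : (N - j < N.+1)%N by lia.
  by have := IH _ lt _ _ gy ry y0 => y1; split=> //; exact: ltW.
have hc : cas (wt w) * hm x x = \sum_(j < N.+1) \sum_(p <- Phi j)
    p.1 * hm (lie (star p.2) x) (lie (star p.2) x).
  rewrite /hm -fmZl -e /casimir.
  have hs (I : Type) (s : seq I) (f : I -> L) z :
      fm (\sum_(i <- s) f i) z = \sum_(i <- s) fm (f i) z.
    by apply: (big_morph (fm^~ z)) => [u v|]; rewrite ?fmDl ?fm0l.
  rewrite hs; apply: eq_bigr => j _; rewrite hs big_seq [RHS]big_seq.
  apply: eq_bigr => p pP; rewrite fmZl -!/(hm _ _).
  by rewrite (hlie j).
rewrite -(pmulr_rgt0 _ c0) hc lt_neqAle; apply/andP; split; last first.
  apply: sumr_ge0 => j _; rewrite big_seq; apply: sumr_ge0 => p pP.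
  apply: mulr_ge0; last by have [] := term_ge0 j p (ltn_ord j) pP.
  exact/ltW/(frame_gt0 (proj1 (fr j (ltn_ord j))) pP).
apply/negP; rewrite eq_sym psumr_eq0 => [/allP s0|j _]; last first.
  rewrite big_seq; apply: sumr_ge0 => p pP.
  apply: mulr_ge0; last by have [] := term_ge0 j p (ltn_ord j) pP.
  exact/ltW/(frame_gt0 (proj1 (fr j (ltn_ord j))) pP).
(* Strictness: if all squares vanish, those of degree 1 already say that every f_m kills x, against
   [lowest_eq0]. *)
have := s0 ord0 (mem_index_enum _); rewrite /= big_seq.
rewrite psumr_eq0 => [/allP p0|p pP]; last first.
  apply: mulr_ge0; last by have [] := term_ge0 0%N p isT pP.
  exact/ltW/(frame_gt0 (proj1 (fr 0%N isT)) pP).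
have z0 p : p \in Phi 0%N -> lie (star p.2) x = 0.
  move=> pP; have := p0 p pP; rewrite pP /= mulf_eq0 gt_eqF; last first.
    exact: (frame_gt0 (proj1 (fr 0%N isT)) pP).
  have [_ pos] := term_ge0 0%N p isT pP => /= h0; apply/eqP/negPn/negP => /pos.
  by move/eqP: h0 => ->; rewrite ltxx.
move/eqP: x0; apply; apply: (lowest_eq0 gx) => m.
rewrite (frame_dual (fr 0%N isT) (Gr_F m)) lie_suml big_seq big1 // => p pP.
by rewrite lieZl z0 // scaler0.
Qed.

Lemma rs_height gamma x : gamma != 0 -> rs H gamma x -> x != 0 ->
  exists w, (gamma = wt w \/ gamma = - wt w) /\
    exists k : int, [/\ k != 0, Gr k x & rs H (- gamma) (star x)].
Proof.
move=> g0 rx x0.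
have [w [w0 [[gw [lx _]]|[gw [lx _]]]]] := root_cases km ar g0 rx x0; exists w.
  split; first by left.
  exists (size w)%:Z; split; first by lia.
    by move: lx; rewrite -(prednK w0) => /Gr_levE.
  by rewrite gw; apply: rs_star_wt; rewrite -gw.
split; first by right.
exists (- (size w)%:Z); split; first by lia.
  by move: lx; rewrite -(prednK w0) => /Gr_levF.
by rewrite gw opprK; apply: rs_star_Nwt; rewrite -gw.
Qed.

(** For a negative root, the squared norm of x equals that of [star x], a vector of a positive
    root. *)
Lemma hm_root_gt0 gamma x : gamma != 0 -> rs H gamma x -> x != 0 -> 0 < hm x x.
Proof.
move=> g0 rx x0.
have [w [w0 [[gw [lx _]]|[gw [lx _]]]]] := root_cases km ar g0 rx x0.
  have ex : size w = (size w).-1.+1 by rewrite prednK.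
  rewrite gw in rx; rewrite ex in lx.
  exact: posdef_all (proj2 (Gr_levE _ _) lx) rx x0.
have ex : size w = (size w).-1.+1 by rewrite prednK.
rewrite ex in lx; have gx := proj2 (Gr_levF _ _) lx.
have sx : star (star x) = x by exact: (starK gx).
rewrite /hm fm_sym -{2}sx -/(hm _ _).
have gsx := star_Gr gx; rewrite opprK in gsx.
have rsx : rs H (wt w) (star x) by apply: rs_star_Nwt; rewrite -gw.
apply: posdef_all gsx rsx _.
by apply: contra x0 => /eqP e; rewrite -sx e star0.
Qed.

(* For x in g_a, y in g_b with [x, y] = 0, the vector z = [x^*, y] would have
   squared norm |x|^2 (a, b) |y|^2 < 0. *)
Theorem lie_root_neq0 a b x y : a != 0 -> b != 0 -> a != b -> bt a b < 0 ->
  rs H a x -> rs H b y -> x != 0 -> y != 0 -> lie x y != 0.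
Proof.
move=> a0 b0 ab neg rx ry x0 y0; apply/negP => /eqP xy0.
have [_ [_ [k [k0 gx rsx]]]] := rs_height a0 rx x0.
have [_ [_ [l [l0 gy rsy]]]] := rs_height b0 ry y0.
have hx := hm_root_gt0 a0 rx x0; have hy := hm_root_gt0 b0 ry y0.
pose z := lie (star x) y.
have rz : rs H (- a + b) z by exact: rs_lie.
have ba : - a + b != 0 by rewrite addrC subr_eq0 eq_sym.
have hz : 0 <= hm z z.
  have [->|z0] := eqVneq z 0; first by rewrite /hm fm0l.
  exact/ltW/(hm_root_gt0 ba rz z0).
have xz : lie x z = (hm x x * bt a b) *: y.
  rewrite /z lieA xy0 lie0r addr0 (bracket_rs rx gx (star_Gr gx) k0) lieZl ry scalerA.
  by [].
have : hm z z = hm x x * bt a b * hm y y.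
  rewrite {1}/hm {2}/z (star_lie star_s) (starK gx k0).
  rewrite -[lie (star y) x]opprK -lieC fmNr -fm_inv [lie z x]lieC fmNl opprK xz fmZl.
  by [].
move=> e; move: hz; rewrite e lt_geF //.
by rewrite pmulr_llt0 // pmulr_rlt0.
Qed.

End LieAlgebra.
End Form.

(** * Hopf's lemma *)

Section Eigenvectors.
Import VectorInternalTheory.
Variable C : numClosedFieldType.

Lemma lfun_eigenvector (V : vectType C) (f : 'End(V)) : (0 < dim V)%N ->
  exists c, exists2 v, v != 0 & f v = c *: v.
Proof.
move=> V0; pose M := lin1_mx (v2r \o f \o r2v).
have [c /eigenvalueP[v vM v0]] := eigenvalue_closed M V0.
exists c, (r2v v); first by rewrite -(inj_eq (@v2r_inj _ _)) linear0 r2vK.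
by apply: v2r_inj; rewrite linearZ /= r2vK -vM mul_rV_lin1.
Qed.

Lemma pencil_eigenvector (V W : vectType C) (z b : 'Hom(V, W)) :
  lker z == 0%VS -> dim V = dim W -> (0 < dim V)%N ->
  exists c, exists2 v, v != 0 & b v = c *: z v.
Proof.
move=> z0 dVW V0; have [c [v v0 e]] := lfun_eigenvector (z^-1 \o b)%VF V0.
exists c, v => //; rewrite -linearZ -e lfunE /= limg_lfunVK //.
suff -> : limg z = fullv by exact: memvf.
apply/eqP; rewrite eqEdim subvf /= !dimvf -dVW.
by rewrite (limg_dim_eq (f := z)) ?dimvf // (eqP z0) capv0.
Qed.

End Eigenvectors.

Section GradedModule.
Variables (C : numClosedFieldType) (T : finType) (E : nat -> vectType C).
(** [E N] plays the dual of the degree N part of a commutative graded algebra, and [act t] the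
    transpose of multiplication by an element of degree 1; [act_faithful] says that these elements
    generate. On the dual side, quotients become common kernels. *)
Variable act : T -> forall N, 'Hom(E N.+1, E N).
Hypothesis actC : forall s t N x, act s N (act t N.+1 x) = act t N (act s N.+1 x).
Hypothesis act_faithful : forall N x, (forall t, act t N x = 0) -> x = 0.
Local Notation form := {ffun T -> C^o}.
Implicit Types (l : form) (G : {vspace form}) (N : nat).

Definition op l N : 'Hom(E N.+1, E N) := \sum_t (l t : C) *: act t N.

Lemma opE l N x : op l N x = \sum_t (l t : C) *: act t N x.
Proof. by rewrite sum_lfunE; apply: eq_bigr => t _; rewrite scale_lfunE. Qed.

Lemma op_lin a l l' N x : op (a *: l + l') N x = a *: op l N x + op l' N x.
Proof.
rewrite !opE scaler_sumr -big_split; apply: eq_bigr => t _ /=.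
by rewrite !ffunE scalerDl scalerA.
Qed.

Lemma opC l l' N x : op l N (op l' N.+1 x) = op l' N (op l N.+1 x).
Proof.
rewrite !opE.
under eq_bigr do rewrite linear_sum scaler_sumr.
under [RHS]eq_bigr do rewrite linear_sum scaler_sumr.
rewrite exchange_big; apply: eq_bigr => t _; apply: eq_bigr => s _ /=.
by rewrite !linearZ /= actC !scalerA mulrC.
Qed.

Definition delta t : form := [ffun s => (s == t)%:R].

Lemma op_delta t N x : op (delta t) N x = act t N x.
Proof.
rewrite opE (bigD1 t) //= ffunE eqxx scale1r big1 ?addr0 // => s /negbTE st.
by rewrite ffunE st scale0r.
Qed.

(* The dual of the degree N + 1 part of the quotient by the ideal of G. *)
Definition kr G N : {vspace E N.+1} := (\bigcap_(l <- vbasis G) lker (op l N))%VS.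

Lemma mem_kr G N x : reflect (forall l, l \in G -> op l N x = 0) (x \in kr G N).
Proof.
have -> : (x \in kr G N) = all (fun l => op l N x == 0) (vbasis G).
  rewrite /kr; elim: (vbasis G : seq _) => [|l s IH]; first by rewrite big_nil memvf.
  by rewrite big_cons memv_cap IH memv_ker.
apply: (iffP allP) => [e l lG|e l /vbasis_mem lG]; last exact/eqP/e.
rewrite (coord_vbasis lG).
have : forall s : seq 'I_(\dim G),
   op (\sum_(i <- s) coord (vbasis G) i l *: (vbasis G)`_i) N x = 0.
  elim=> [|i s IH]; first by rewrite big_nil opE big1 // => t _; rewrite ffunE scale0r.
  rewrite big_cons op_lin IH addr0 (eqP (e _ _)) ?scaler0 // mem_nth //.
  by rewrite size_tuple.
exact.
Qed.

Lemma kr_act G N t x : x \in kr G N.+1 -> act t N.+1 x \in kr G N.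
Proof.
move=> /mem_kr xK; apply/mem_kr => l lG.
by rewrite -op_delta opC xK // linear0.
Qed.

Lemma kr_op G N l x : x \in kr G N.+1 -> op l N.+1 x \in kr G N.
Proof. by move=> /mem_kr xK; apply/mem_kr => l' lG; rewrite opC xK // linear0. Qed.

Definition good G := forall N, kr G N != 0%VS.

Lemma kr0_up G N M : kr G N = 0%VS -> kr G (M + N) = 0%VS.
Proof.
move=> K0; elim: M => // M IH; apply/eqP; rewrite -subv0; apply/subvP => x xK.
rewrite memv0; apply/eqP/act_faithful => t; apply/eqP; rewrite -memv0 -IH.
exact: kr_act.
Qed.

Lemma not_goodP G : ~ good G -> exists N, forall M, (N <= M)%N -> kr G M = 0%VS.
Proof.
move=> /existsNP[N /negP]; rewrite negbK => /eqP K0; exists N => M NM.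
by rewrite -(subnK NM); exact: kr0_up.
Qed.

Lemma kr_addv G l N x :
  (x \in kr (G + <[l]>)%VS N) = (x \in kr G N) && (op l N x == 0).
Proof.
apply/mem_kr/andP => [xK|[/mem_kr xK /eqP xl]].
  split; first by apply/mem_kr => l' lG; apply: xK; exact: (subvP (addvSl _ _)) lG.
  by apply/eqP/xK; exact: (subvP (addvSr _ _)) (memv_line l).
move=> l' /memv_addP[l1 l1G [_ /vlineP[a ->] ->]].
by rewrite addrC op_lin xl xK // scaler0 addr0.
Qed.

(* If z lies outside the maximal good space G, contraction by z is injective in
   high degrees, hence bijective once dimensions stabilize; an eigenvector of
   z^-1 b shows that G + <b - c z> is still good. *)
Lemma good_extend G z b : good G -> ~ good (G + <[z]>)%VS ->
  exists c : C, good (G + <[b - c *: z]>)%VS.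
Proof.
move=> gG /not_goodP[N0 zinj].
have z0 M x : (N0 <= M)%N -> x \in kr G M -> op z M x = 0 -> x = 0.
  move=> NM xK xz; apply/eqP; rewrite -memv0 -(zinj M NM) kr_addv xK.
  exact/eqP.
pose dm M := \dim (kr G (M + N0)).
pose zU l N : 'Hom(subvs_of (kr G N.+1), subvs_of (kr G N)) :=
  linfun (vsproj (kr G N) \o op l N.+1 \o vsval).
have zUE l N u : vsval (zU l N u) = op l N.+1 (vsval u).
  by rewrite /zU lfunE /= vsprojK // kr_op // subvsP.
have zker M : lker (zU z (M + N0)) == 0%VS.
  rewrite -subv0; apply/subvP => u; rewrite memv_ker memv0 => /eqP e.
  apply/eqP/subvs_inj; rewrite linear0; apply: (z0 (M + N0).+1) (subvsP u) _.
    by rewrite -addSn leq_addl.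
  by rewrite -zUE e linear0.
have dm_mono M : (dm M.+1 <= dm M)%N.
  have e : \dim (limg (zU z (M + N0))) = dm M.+1.
    by rewrite limg_dim_eq ?dimvf // (eqP (zker M)) capv0.
  have -> : dm M = \dim {:subvs_of (kr G (M + N0))} by rewrite dimvf.
  by rewrite -e dimvS // subvf.
have [M0 stab] : exists M0, forall M, (M0 <= M)%N -> dm M = dm M0.
  have dec M M' : (M <= M')%N -> (dm M' <= dm M)%N.
    by move=> /subnK <-; elim: (M' - M)%N => // k IH; exact: leq_trans (dm_mono _) IH.
  have ex : exists k, `[< exists M, dm M = k >].
    by exists (dm 0%N); apply/asboolP; exists 0%N.
  case: (ex_minnP ex) => k /asboolP[M0 eM] kmin; exists M0 => M MM.
  apply/eqP; rewrite eqn_leq dec //= eM kmin //; apply/asboolP; by exists M.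
have dm0 M : (0 < dm M)%N by rewrite lt0n dimv_eq0.
have [||c [u u0 ec]] := pencil_eigenvector (zU b (M0 + N0)) (zker M0).
- exact: (stab M0.+1 (leqnSn _)).
- exact: (dm0 M0.+1).
exists c.
(* The eigenvector lives in one degree. Beyond it z is onto, which gives preimages in all higher
   degrees, and injectivity of z shows that b - c z still kills them. Lower degrees follow by
   [kr0_up]. *)
have lift M : exists2 x, x != 0 & x \in kr (G + <[b - c *: z]>)%VS (M + M0.+1 + N0).
  elim: M => [|M [x x0]].
    exists (vsval u).
      by apply: contra u0 => /eqP e; apply/eqP/subvs_inj; rewrite e linear0.
    suff : vsval u \in kr (G + <[b - c *: z]>)%VS (M0 + N0).+1 by [].
    rewrite kr_addv subvsP /= [b - _]addrC -scaleNr op_lin.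
    by rewrite -!zUE ec linearZ /= scaleNr addNr.
  rewrite kr_addv => /andP[xK /eqP xe].
  set N := (M + M0.+1 + N0)%N in x x0 xK xe *.
  have zsurj : limg (zU z N) = fullv.
    apply/eqP; rewrite eqEdim subvf /= (limg_dim_eq (f := zU z N)).
      rewrite !dimvf -[X in (X <= _)%N]/(dm (M + M0.+1)%N).
      rewrite -[X in (_ <= X)%N]/(dm (M + M0.+1).+1) !stab //; lia.
    by rewrite (eqP (zker _)) capv0.
  pose y := (zU z N)^-1%VF (vsproj (kr G N) x).
  have zy : op z N.+1 (vsval y) = x.
    by rewrite -zUE limg_lfunVK ?zsurj ?memvf // vsprojK.
  exists (vsval y).
    by apply: contra x0 => /eqP e; rewrite -zy e linear0.
  suff : vsval y \in kr (G + <[b - c *: z]>)%VS N.+1 by [].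
  rewrite kr_addv subvsP /=; apply/eqP.
  apply: (z0 N); first by rewrite /N leq_addl.
    by apply: kr_op; exact: subvsP.
  by rewrite opC zy.
move=> N; apply/negP => /eqP K0.
have := lift N; rewrite -addnA addnC (kr0_up _ K0) => -[y y0].
by rewrite memv0 (negbTE y0).
Qed.

(** Modulo a maximal good space G every [delta t] is a multiple c_t of one form z, so t acts on the
    kernel of G as c_t z. As z is injective there, equal products of two actions give equal products
    of the numbers c_t. *)
Lemma good_point (Fs : {vspace form}) : good Fs ->
  exists c : T -> C, [/\ exists t, c t != 0,
    forall l, l \in Fs -> \sum_t (l t : C) * c t = 0
  & forall s t s' t', (forall N x, act s N (act t N.+1 x) = act s' N (act t' N.+1 x)) ->
      c s * c t = c s' * c t'].
Proof.
move=> gF.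
have [G [FG gG Gmax]] : exists G, [/\ (Fs <= G)%VS, good G
    & forall l, good (G + <[l]>)%VS -> l \in G].
  have ex : exists k, `[< exists G, [/\ (Fs <= G)%VS, good G & \dim G = k] >].
    by exists (\dim Fs); apply/asboolP; exists Fs; rewrite subvv.
  have bd k : `[< exists G, [/\ (Fs <= G)%VS, good G & \dim G = k] >] ->
      (k <= \dim {:form})%N.
    by move=> /asboolP[G [_ _ <-]]; rewrite dimvS // subvf.
  case: (ex_maxnP ex bd) => k /asboolP[G [FG gG dG]] kmax; exists G; split=> // l gl.
  have : (\dim (G + <[l]>) <= \dim G)%N.
    rewrite dG kmax //; apply/asboolP; exists (G + <[l]>)%VS; split=> //.
    by rewrite (subv_trans FG) // addvSl.
  move=> dl; have /eqP -> : G == (G + <[l]>)%VS by rewrite eqEdim addvSl.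
  exact: (subvP (addvSr _ _)) (memv_line l).
have [z zG] : exists z, z \notin G.
  apply: contrapT => nex; have := gG 0%N; rewrite -subv0 => /negP; apply.
  apply/subvP => x /mem_kr xK; rewrite memv0; apply/eqP/act_faithful => t.
  rewrite -op_delta; apply: xK; apply: contrapT => /negP ne; apply: nex.
  by exists (delta t).
have bad : ~ good (G + <[z]>)%VS by move=> /Gmax; exact/negP.
have /choice[c cP] : forall t, exists c : C, delta t - c *: z \in G.
  by move=> t; have [c /Gmax cG] := good_extend (delta t) gG bad; exists c.
exists c.
have sumG l : l - (\sum_t (l t : C) * c t) *: z \in G.
  have e : l = \sum_t (l t : C) *: delta t.
    apply/ffunP => s; rewrite sum_ffunE (bigD1 s) //= !ffunE eqxx big1 ?addr0.
      by rewrite /GRing.scale /= mulr1.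
    by move=> t ts; rewrite !ffunE eq_sym (negbTE ts) scaler0.
  rewrite {1}e scaler_suml -sumrB; apply: memv_suml => t _.
  by rewrite -scalerA -scalerBr memvZ.
have actE N x t : x \in kr G N -> act t N x = c t *: op z N x.
  move=> /mem_kr/(_ _ (cP t)); rewrite [delta t - _]addrC -scaleNr op_lin op_delta.
  by rewrite scaleNr => /eqP; rewrite addrC subr_eq0 => /eqP.
have zinj N x : x \in kr G N -> op z N x = 0 -> x = 0.
  by move=> xK xz; apply: act_faithful => t; rewrite actE // xz scaler0.
split.
- apply: contrapT => nex; case/negP: zG.
  have := sumG z; rewrite big1 ?scale0r ?subr0 // => t _.
  apply/eqP; rewrite mulf_eq0; apply/orP; right; apply: contrapT => /negP ne.
  by apply: nex; exists t.
- move=> l /(subvP FG) lG; apply: contrapT => /eqP ne; case/negP: zG.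
  have : (\sum_t (l t : C) * c t) *: z \in G.
    by rewrite -[_ *: z](subKr l) memvB.
  by move=> /(memvZ (\sum_t (l t : C) * c t)^-1); rewrite scalerA mulVf // scale1r.
- move=> s t s' t' e.
  have [x xK x0] : exists2 x, x \in kr G 1 & x != 0.
    by exists (vpick (kr G 1)); rewrite ?memv_pick // vpick0 gG.
  have xz := kr_op z xK.
  have zz0 : op z 0 (op z 1 x) != 0.
    by apply: contra x0 => /eqP /(zinj _ _ xz) /(zinj _ _ xK) ->.
  have := e 0%N x; rewrite !(actE 1%N) // !linearZ /= !(actE 0%N) // !scalerA => /eqP.
  rewrite -subr_eq0 -scalerBl scaler_eq0 (negbTE zz0) orbF subr_eq0 => /eqP.
  by rewrite mulrC => ->; rewrite mulrC.
Qed.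

End GradedModule.

(** * Growth of dimensions *)

Section Counting.
Variables (C : numClosedFieldType) (T : finType) (E : nat -> vectType C).
Variable act : T -> forall N, 'Hom(E N.+1, E N).
Hypothesis actC : forall s t N x, act s N (act t N.+1 x) = act t N (act s N.+1 x).
Hypothesis act_faithful : forall N x, (forall t, act t N x = 0) -> x = 0.
Variables (r : nat) (f : 'I_r.+1 -> {ffun T -> C^o}).

Fixpoint opw d N (w : seq 'I_r.+1) : 'Hom(E (d + N)%N, E N) :=
  if d is d'.+1 then (opw d' N (behead w) \o op act (f (head ord0 w)) (d' + N)%N)%VF
  else \1%VF.

Lemma opwS d N k w x : opw d.+1 N (k :: w) x = opw d N w (op act (f k) (d + N)%N x).
Proof. by rewrite /= lfunE. Qed.

Lemma opw_rem d N w k x : size w = d.+1 -> k \in w ->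
  opw d.+1 N w x = opw d.+1 N (k :: rem k w) x.
Proof.
have rem_head l v : rem l (l :: v) = v :> seq 'I_r.+1 by rewrite /= eqxx.
elim: d w x => [|d IH] [|l w] x // [sw]; rewrite inE.
  by case: w sw => // _; rewrite orbF => /eqP ->; rewrite rem_head.
have [->|kl] := eqVneq k l; first by rewrite rem_head.
rewrite /= => kw; rewrite [l == k]eq_sym (negbTE kl) opwS IH // !opwS.
by rewrite (opC actC).
Qed.

Lemma opw_perm d N w w' x : size w = d -> perm_eq w w' -> opw d N w x = opw d N w' x.
Proof.
elim: d w w' x => [|d IH] [|k w] w' x // [sw] pw.
have kw' : k \in w' by rewrite -(perm_mem pw) mem_head.
have sw' : size w' = d.+1 by rewrite -(perm_size pw) /= sw.
rewrite (opw_rem _ sw' kw') !opwS; apply: IH => //.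
by rewrite -(perm_cons k) (permPl pw) perm_to_rem.
Qed.

Local Notation srt t := (sorted leq [seq val i | i <- t]).
(** Monomials of degree d in m variables. *)
Definition sorted_tuples m d := {t : d.-tuple 'I_m | srt t}.

Lemma card_sorted_tuple m d : #|{: sorted_tuples m.+1 d}| = 'C(d + m, d).
Proof. by rewrite -card_sorted_tuples card_sig; apply: eq_card => t; rewrite inE. Qed.

(** Once the forms generate all of degree N + 1 they generate every higher degree. Dually, a vector
    killed by all monomials of degree d in the forms is 0; as the operators commute, sorted words
    suffice. *)
Lemma opw_sorted_inj d N x : kr act <<[seq f i | i : 'I_r.+1]>> N = 0%VS ->
  (forall w : sorted_tuples r.+1 d, opw d N.+1 (val w) x = 0) -> x = 0.
Proof.
set G := <<_>>%VS => K0 xw.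
have {xw} : forall w, size w = d -> opw d N.+1 w x = 0.
  move=> w /eqP sw; pose leT := relpre (val : 'I_r.+1 -> nat) leq.
  have tot : total leT by move=> i j; exact: leq_total.
  pose t := sort_tuple leT (Tuple sw).
  have ts : srt t by rewrite sorted_map sort_sorted.
  rewrite (@opw_perm d _ w t) ?(eqP sw) //; first exact: (xw (exist _ t ts)).
  by rewrite /= perm_sym perm_sort.
elim: d x => [|d IH] x xw; first by have := xw [::] erefl; rewrite /= lfunE.
have K1 : kr act G (d + N.+1) = 0%VS.
  by rewrite addnS -addSn; exact: (kr0_up actC act_faithful d.+1 K0).
have fx k : op act (f k) (d + N.+1) x = 0.
  by apply: IH => w sw; rewrite -(opwS k) xw //= sw.
suff : x \in kr act G (d + N.+1) by rewrite K1 memv0 => /eqP.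
apply/mem_kr => l lG.
have lX : l \in <<[tuple f i | i < r.+1]>>%VS by exact: lG.
rewrite (coord_span lX).
pose X := [tuple f i | i < r.+1].
have : forall s : seq 'I_r.+1,
   op act (\sum_(i <- s) coord X i l *: X`_i) (d + N.+1) x = 0.
  elim=> [|i s IHs]; first by rewrite big_nil opE big1 // => t _; rewrite ffunE scale0r.
  by rewrite big_cons op_lin IHs addr0 -tnth_nth tnth_mktuple fx scaler0.
exact.
Qed.

Definition opw_sorted d N (x : E (d + N.+1)) : {ffun sorted_tuples r.+1 d -> E N.+1} :=
  [ffun w : sorted_tuples r.+1 d => opw d N.+1 (val w) x].

Lemma opw_sorted_is_linear d N : linear (@opw_sorted d N).
Proof. by move=> a u v; apply/ffunP => w; rewrite !ffunE linearP. Qed.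

HB.instance Definition _ d N :=
  GRing.isLinear.Build C _ _ _ (@opw_sorted d N) (@opw_sorted_is_linear d N).

Lemma dim_growth d N : kr act <<[seq f i | i : 'I_r.+1]>> N = 0%VS ->
  (dim (E (d + N.+1)%N) <= 'C(d + r, d) * dim (E N.+1))%N.
Proof.
move=> K0; rewrite -card_sorted_tuple.
have ker0 : lker (linfun (@opw_sorted d N)) == 0%VS.
  rewrite -subv0; apply/subvP => x; rewrite memv_ker lfunE memv0 => /eqP e.
  apply/eqP/(opw_sorted_inj K0) => w.
  by have := congr1 (fun g : {ffun _} => g w) e; rewrite !ffunE.
rewrite -[X in (X <= _)%N]dimvf -(limg_dim_eq (f := linfun (@opw_sorted d N))).
  rewrite -[X in (_ <= X)%N]/(dim {ffun sorted_tuples r.+1 d -> E N.+1}).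
  by rewrite -dimvf dimvS ?subvf.
by rewrite (eqP ker0) capv0.
Qed.

End Counting.

(** * Bihomogeneous polynomials and the common zero *)

Section HopfLemma.
Variable C : numClosedFieldType.
Variables m' n' : nat.
Local Notation m := m'.+1.
Local Notation n := n'.+1.
Local Notation srt t := (sorted leq [seq val i | i <- t]).

Let leT k := relpre (val : 'I_k -> nat) leq.

Fact ins_subproof k N (i : 'I_k) (t : sorted_tuples k N) :
  srt (sort_tuple (@leT k) (cons_tuple i (val t))).
Proof. by rewrite sorted_map sort_sorted // => a b; exact: leq_total. Qed.

Definition ins k N (i : 'I_k) (t : sorted_tuples k N) : sorted_tuples k N.+1 :=
  exist _ (sort_tuple (@leT k) (cons_tuple i (val t))) (ins_subproof i t).

Lemma insC k N (i j : 'I_k) (t : sorted_tuples k N) : ins i (ins j t) = ins j (ins i t).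
Proof.
do 2!apply: val_inj => /=; apply/perm_sortP.
- by move=> a b; exact: leq_total.
- by move=> a b c; exact: leq_trans.
- by move=> a b ab; apply/val_inj/anti_leq.
by apply/permP => P /=; rewrite !(permP (permEl (perm_sort _ _))) /= addnCA.
Qed.

Lemma ins_surj k N (t : sorted_tuples k N.+1) : exists i u, t = ins i u.
Proof.
case: t => t; case/tupleP: t => i u st.
have su : srt u by move: st => /= /path_sorted.
exists i, (exist _ u su); do 2!apply: val_inj => /=.
rewrite sorted_sort //; first by move=> a b c; exact: leq_trans.
by rewrite -sorted_map.
Qed.

(* Pairs of monomials of degree N; E N is the dual of the space of
   bihomogeneous polynomials of bidegree (N, N). *)
Definition shapes N := (sorted_tuples m N * sorted_tuples n N)%type.
Let E N : vectType C := {ffun shapes N -> C^o}.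

(** Transpose of multiplication by x_i y_j; [ins] multiplies a monomial by a variable. *)
Definition contract (p : 'I_m * 'I_n) N (g : E N.+1) : E N :=
  [ffun x : shapes N => g (ins p.1 x.1, ins p.2 x.2)].

Lemma contract_is_linear p N : linear (@contract p N).
Proof. by move=> a u v; apply/ffunP => w; rewrite !ffunE. Qed.

HB.instance Definition _ p N :=
  GRing.isLinear.Build C _ _ _ (@contract p N) (@contract_is_linear p N).

Definition cact p N : 'Hom(E N.+1, E N) := linfun (@contract p N).

Lemma cactE p N g x : cact p N g x = g (ins p.1 x.1, ins p.2 x.2).
Proof. by rewrite /cact lfunE /= ffunE. Qed.

Lemma cactC s t N x : cact s N (cact t N.+1 x) = cact t N (cact s N.+1 x).
Proof. by apply/ffunP => w; rewrite !cactE /= insC [ins t.2 _]insC. Qed.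

(** The source of rank one: through [good_point] it becomes c_ij c_kl = c_il c_kj, the vanishing of
    the minors of order 2. *)
Lemma cact_swap (i k : 'I_m) (j l : 'I_n) N x :
  cact (i, j) N (cact (k, l) N.+1 x) = cact (i, l) N (cact (k, j) N.+1 x).
Proof. by apply/ffunP => w; rewrite !cactE /= [ins l _]insC. Qed.

Lemma cact_faithful N x : (forall t, cact t N x = 0) -> x = 0.
Proof.
move=> x0; apply/ffunP => -[t1 t2].
have [i [u1 ->]] := ins_surj t1; have [j [u2 ->]] := ins_surj t2.
by have := congr1 (fun g : E N => g (u1, u2)) (x0 (i, j)); rewrite cactE !ffunE.
Qed.

Lemma dimE N : dim (E N) = ('C(N + m', N) * 'C(N + n', N))%N.
Proof.
rewrite -[LHS]/(#|{: sorted_tuples m N * sorted_tuples n N}| * 1)%N.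
by rewrite card_prod !card_sorted_tuple muln1.
Qed.

Lemma bin_addC a k : 'C(a + k, a) = 'C(a + k, k).
Proof. by rewrite -(bin_sub (leq_addl a k)) addnK. Qed.

(** Crude bounds are enough here and in [bin_upper]: only the exponent k matters. *)
Lemma bin_lower a k : (a.+1 ^ k <= k`! * 'C(a + k, a))%N.
Proof.
rewrite bin_addC mulnC bin_ffact.
elim: k => [|k IH]; first by rewrite addn0.
by rewrite addnS ffactSS expnS leq_mul // ltnS leq_addr.
Qed.

Lemma bin_upper a k : ('C(a + k, a) <= (k.+1 * a.+1) ^ k)%N.
Proof.
rewrite bin_addC.
apply: leq_trans (leq_pmulr _ (fact_gt0 k)) _; rewrite bin_ffact.
have : (a + k <= k.+1 * a.+1)%N by nia.
move: (k.+1 * a.+1)%N (a + k)%N => M b bM.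
elim: k b bM => [|k IH] b bM; first by [].
rewrite ffactnS expnS leq_mul // IH //; exact: leq_trans (leq_pred _) bM.
Qed.

Lemma good_forms r (f : 'I_r.+1 -> {ffun 'I_m * 'I_n -> C^o}) : (r < m' + n')%N ->
  good cact <<[seq f i | i : 'I_r.+1]>>.
Proof.
move=> rmn N; apply/negP => /eqP K0.
have [D eD] : {D | D = dim (E N.+1)} by exists (dim (E N.+1)).
(* The comparison in degree d reads (d + 1)^(m' + n') <= M (d + 1)^r. It fails for d = M, because m'
   + n' > r and M + 1 > M. *)
pose M := (m'`! * n'`! * D * r.+1 ^ r)%N.
have growth d := dim_growth cactC cact_faithful d K0.
have := growth M; rewrite -eD dimE => H.
have : (M.+1 ^ (m' + n') <= m'`! * n'`! * (D * (r.+1 * M.+1) ^ r))%N.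
  apply: leq_trans (_ : m'`! * 'C(M + N.+1 + m', M + N.+1)
     * (n'`! * 'C(M + N.+1 + n', M + N.+1)) <= _)%N.
    have le e : (M.+1 ^ e <= (M + N.+1).+1 ^ e)%N.
      by elim: e => // e IH; rewrite !expnS leq_mul // ltnS leq_addr.
    by rewrite expnD leq_mul //; apply: leq_trans (bin_lower _ _); exact: le.
  rewrite mulnACA leq_mul //; apply: leq_trans H _.
  by rewrite mulnC leq_mul // bin_upper.
rewrite expnMn; have : (M.+1 ^ r.+1 <= M.+1 ^ (m' + n'))%N by rewrite leq_pexp2l.
by move=> h1 /(leq_trans h1); rewrite expnS !mulnA -/M leq_pmul2r ?expn_gt0 // ltnn.
Qed.

Lemma good_point_rank1 (Fs : {vspace {ffun 'I_m * 'I_n -> C^o}}) : good cact Fs ->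
  exists u : 'I_m -> C, exists v : 'I_n -> C,
    [/\ exists i, u i != 0, exists j, v j != 0
      & forall l, l \in Fs -> \sum_i \sum_j (l (i, j) : C) * (u i * v j) = 0].
Proof.
move=> gF.
have [c [[[i0 j0] c0] cF cc]] := good_point cactC cact_faithful gF.
exists (fun i => c (i, j0)), (fun j => c (i0, j) / c (i0, j0)); split.
- by exists i0.
- by exists j0; rewrite mulfV ?oner_eq0.
move=> l lF; rewrite pair_bigA /= -[RHS](cF l lF); apply: eq_bigr => -[i j] _ /=.
congr (_ * _); rewrite mulrA [_ * c (i0, j)](cc _ _ (i, j) (i0, j0)) ?mulfK //.
by move=> N x; exact: cact_swap.
Qed.

End HopfLemma.

Theorem hopf_lemma (C : numClosedFieldType) (m n w : nat)
    (l : 'I_w -> 'I_m -> 'I_n -> C) : (0 < m)%N -> (0 < n)%N -> (w.+1 < m + n)%N ->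
  exists u : 'I_m -> C, exists v : 'I_n -> C,
    [/\ exists i, u i != 0, exists j, v j != 0
      & forall k, \sum_i \sum_j l k i j * (u i * v j) = 0].
Proof.
case: m l => // m l _; case: n l => // n l _; case: w l => [|w] l lt.
  exists (fun _ => 1), (fun _ => 1); split; [exists ord0|exists ord0|by case];
    exact: oner_neq0.
pose f (k : 'I_w.+1) : {ffun 'I_m.+1 * 'I_n.+1 -> C^o} := [ffun p => l k p.1 p.2].
have wmn : (w < m + n)%N by lia.
have [u [v [u0 v0 uv]]] := good_point_rank1 (good_forms f wmn).
exists u, v; split=> // k.
rewrite -[RHS](uv (f k)); last by apply: memv_span; exact: (codom_f f k).
by apply: eq_bigr => i _; apply: eq_bigr => j _; rewrite ffunE.
Qed.

(** * The dimension inequality *)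

Section SpanDimension.
Variables (C : numClosedFieldType) (R : realType).

Definition independent (V : lmodType C) m (b : 'I_m -> V) :=
  forall c : 'I_m -> C, \sum_i c i *: b i = 0 -> forall i, c i = 0.

Lemma bounded_basis (V : lmodType C) (A : set V) N : lin_closed A ->
  (forall m (b : 'I_m -> V), independent b -> (forall i, A (b i)) -> (m <= N)%N) ->
  exists m (b : 'I_m -> V), is_basis A b.
Proof.
move=> AL bd.
pose P m := `[< exists b : 'I_m -> V, independent b /\ forall i, A (b i) >].
have exP : exists m, P m.
  by exists 0%N; apply/asboolP; exists (fun _ => 0); split=> [c _|] [].
have bdP m : P m -> (m <= N)%N by move=> /asboolP[b [ib Ab]]; exact: bd ib Ab.
case: (ex_maxnP exP bdP) => m /asboolP[b [ib Ab]] mmax; exists m, b; split=> //.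
apply/seteqP; split=> [x Ax|_ [c _ <-]]; last first.
  by apply: (@lin_closed_sum _ _ A _ _ _ AL) => i; exact: (lin_closedZ _ AL (Ab i)).
pose b' (i : 'I_m.+1) := oapp b x (unlift ord0 i).
have : ~ independent b'.
  move=> ib'; suff /mmax : P m.+1 by rewrite ltnn.
  apply/asboolP; exists b'; split=> // i; rewrite /b'.
  by case: (unlift ord0 i).
move=> /existsNP[c /not_implyP[c0 /existsNP[i ci]]].
move: c0; rewrite big_ord_recl /b' unlift_none /=.
under eq_bigr do rewrite liftK /=.
have [c00|c00] := eqVneq (c ord0) 0.
  rewrite c00 scale0r add0r => /(ib (fun j => c (lift ord0 j))) cz; exfalso; apply: ci.
  by case: (unliftP ord0 i) => [j ->|->].
move=> /eqP; rewrite addr_eq0 => /eqP e.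
exists (fun j => - (c ord0)^-1 * c (lift ord0 j)) => //.
under eq_bigr do rewrite -scalerA.
by rewrite -scaler_sumr scaleNr -scalerN -e scalerA mulVf // scale1r.
Qed.

Lemma sdim_basis (V : lmodType C) (A : set V) : (exists m (b : 'I_m -> V), is_basis A b) ->
  exists m (b : 'I_m -> V), is_basis A b /\ sdim R A = m%:R%:E.
Proof.
move=> [m [b bb]]; rewrite /sdim; case: xgetP => [d _ [m' [b' [bb' ->]]]|/(_ m%:R%:E)].
  by exists m', b'.
by case; exists m, b.
Qed.

Lemma sum_lie (L : lieAlgType C) m n (u : 'I_m -> C) (v : 'I_n -> C) (x : 'I_m -> L)
    (y : 'I_n -> L) :
  lie (\sum_i u i *: x i) (\sum_j v j *: y j) = \sum_i \sum_j (u i * v j) *: lie (x i) (y j).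
Proof.
rewrite lie_suml; apply: eq_bigr => i _; rewrite lieZl lie_sumr scaler_sumr.
by apply: eq_bigr => j _; rewrite lieZr scalerA.
Qed.

(** The coordinates of the [x_i, y_j] in the basis z are w bilinear forms. A common zero from Hopf's
    lemma would give two nonzero vectors with bracket 0. *)
Lemma independent_bracket (L : lieAlgType C) (A B W : set L) w (z : 'I_w -> L) m n
    (x : 'I_m -> L) (y : 'I_n -> L) :
  lin_closed A -> lin_closed B -> is_basis W z ->
  (forall a b, A a -> B b -> W (lie a b)) ->
  (forall a b, A a -> B b -> a != 0 -> b != 0 -> lie a b != 0) ->
  independent x -> (forall i, A (x i)) -> independent y -> (forall j, B (y j)) ->
  (0 < m)%N -> (0 < n)%N -> (m + n <= w.+1)%N.
Proof.
move=> AL BL [_ Wz] AB nz ix Ax iy By m0 n0; rewrite leqNgt; apply/negP => lt.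
have ex i j : exists c : 'I_w -> C, lie (x i) (y j) = \sum_k c k *: z k.
  by have := AB _ _ (Ax i) (By j); rewrite Wz => -[c _ <-]; exists c.
have /choice[l lP] : forall p : 'I_m * 'I_n, exists c : 'I_w -> C,
    lie (x p.1) (y p.2) = \sum_k c k *: z k by move=> p; exact: ex.
have [u [v [[i ui] [j vj] uv]]] := hopf_lemma (fun k i j => l (i, j) k) m0 n0 lt.
have AX : A (\sum_i u i *: x i).
  by apply: (@lin_closed_sum _ _ A _ _ _ AL) => i'; exact: (lin_closedZ _ AL (Ax i')).
have BY : B (\sum_j v j *: y j).
  by apply: (@lin_closed_sum _ _ B _ _ _ BL) => j'; exact: (lin_closedZ _ BL (By j')).
have /negP : lie (\sum_i u i *: x i) (\sum_j v j *: y j) != 0.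
  by apply: nz => //; [apply: contra ui => /eqP /ix -> | apply: contra vj => /eqP /iy ->].
apply; apply/eqP.
rewrite sum_lie.
under eq_bigr => i' _ do under eq_bigr => j' _ do rewrite (lP (i', j')) scaler_sumr.
under eq_bigr => i' _ do rewrite exchange_big.
rewrite exchange_big big1 // => k _.
under eq_bigr => i' _ do under eq_bigr => j' _ do rewrite scalerA mulrC.
under eq_bigr => i' _ do rewrite -scaler_suml.
by rewrite -scaler_suml uv scale0r.
Qed.

(** If W has no finite basis its [sdim] is infinite. Otherwise an independent family in one factor,
    paired with a single nonzero vector of the other, has at most w members; so both factors have
    bases and [independent_bracket] applies to them. *)
Lemma sdim_bracket (L : lieAlgType C) (A B W : set L) :
  lin_closed A -> lin_closed B ->
  (exists2 x, A x & x != 0) -> (exists2 y, B y & y != 0) ->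
  (forall a b, A a -> B b -> W (lie a b)) ->
  (forall a b, A a -> B b -> a != 0 -> b != 0 -> lie a b != 0) ->
  (sdim R A + sdim R B - 1 <= sdim R W)%E.
Proof.
move=> AL BL [x Ax x0] [y By y0] AB nz.
have [exW|nW] := pselect (exists m (b : 'I_m -> L), is_basis W b); last first.
  have -> : sdim R W = +oo%E; last exact: leey.
  rewrite /sdim; case: xgetP => // d _ [m [b [bb _]]]; exfalso; apply: nW.
  by exists m, b.
have [w [z [bz ->]]] := sdim_basis exW.
have ind1 (v : L) : v != 0 -> independent (fun _ : 'I_1 => v).
  move=> v0 c; rewrite big_ord1 => /eqP; rewrite scaler_eq0 (negbTE v0) orbF.
  by move=> /eqP e i; rewrite ord1.
have exA : exists m (b : 'I_m -> L), is_basis A b.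
  apply: (bounded_basis (N := w) AL) => -[//|m] b ib Ab.
  have := independent_bracket AL BL bz AB nz ib Ab (ind1 y y0) (fun _ => By).
  by rewrite addn1; apply.
have exB : exists m (b : 'I_m -> L), is_basis B b.
  apply: (bounded_basis (N := w) BL) => -[//|m] b ib Ab.
  have := independent_bracket AL BL bz AB nz (ind1 x x0) (fun _ => Ax) ib Ab.
  by rewrite add1n; apply.
have [m [a [[ia Aa] ->]]] := sdim_basis exA.
have [n [b [[ib Bb] ->]]] := sdim_basis exB.
have mem k (f : 'I_k -> L) (U : set L) i :
    U = [set \sum_i c i *: f i | c in [set: 'I_k -> C]]%classic -> U (f i).
  move=> ->; exists (fun j => (j == i)%:R) => //.
  rewrite (bigD1 i) //= eqxx scale1r big1 ?addr0 // => j /negbTE ->.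
  by rewrite scale0r.
have pos k (f : 'I_k -> L) (U : set L) v : U v -> v != 0 ->
    U = [set \sum_i c i *: f i | c in [set: 'I_k -> C]]%classic -> (0 < k)%N.
  move=> Uv v0 e; move: Uv; rewrite e => -[c _ ev]; case: k f e c ev => // f e c.
  by rewrite big_ord0 => ev; rewrite -ev eqxx in v0.
have := independent_bracket AL BL bz AB nz ia (fun i => mem _ _ _ i Aa) ib
   (fun i => mem _ _ _ i Bb) (pos _ _ _ _ Ax x0 Aa) (pos _ _ _ _ By y0 Bb).
by move=> le; rewrite -EFinD lee_fin lerBlDr -natrD natr1 ler_nat.
Qed.

End SpanDimension.

Lemma km_lie_neq0 (R : realType) (n : nat) (A : 'M[int]_n) (q : 'rV[rat]_n)
    (h : vectType R[i]) (alpha : 'I_n -> 'Hom(h, R[i]^o)) (alphav : 'I_n -> h)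
    (SA : lie_ideal (km_tilde alpha alphav))
    (form : {symmetric 'Hom(h, R[i]^o)})
    (a b : 'Hom(h, R[i]^o)) x y :
  gen_cartan A -> symmetrizer A q -> realization alpha alphav A -> maximal_ideal SA ->
  (forall i (gamma : 'Hom(h, R[i]^o)),
     form (alpha i) gamma = ratr (q 0 i) * gamma (alphav i)) ->
  a != 0 -> b != 0 -> a != b -> form a b < 0 ->
  root_space SA a x -> root_space SA b y -> x != 0 -> y != 0 -> lie x y != 0.
Proof.
move=> cA [q0 qs] [_ fa fav aA] SAmax formE a0 b0 ab neg rx ry x0 y0.
pose C : numClosedFieldType := R[i].
have [d dP] := dual_vectors fa.
have [phi phiP] := dual_functionals fav.
pose q' i : C := ratr (q 0 i).
have q'0 i : 0 < q' i by rewrite /q' ltr0q.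
have q'A i j : q' i * (A i j)%:~R = q' j * (A j i)%:~R.
  have := congr1 (fun M : 'M[rat]_n => M j i) qs; rewrite !mxE.
  rewrite (bigD1 i) //= big1 ?addr0; last first.
    by move=> k ki; rewrite !mxE eq_sym (negbTE ki) mulr0n mul0r.
  rewrite (bigD1 j) //= big1 ?addr0; last first.
    by move=> k kj; rewrite !mxE eq_sym (negbTE kj) mulr0n mul0r.
  rewrite !mxE !eqxx !mulr1n => e.
  by rewrite /q' -!(ratr_int C) -!rmorphM e.
have areal i j : (alpha i (alphav j) : C)^* = alpha i (alphav j).
  by rewrite aA rmorph_int.
have [star starP] := star_exists dP phiP areal SAmax.
have q'n0 i : q' i != 0 by rewrite gt_eqF.
have lin (f : 'Hom(h, C^o)) c u v : (f (c *: u + v) : C) = c * f u + f v by rewrite linearP.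
have [hf [hf1 hf2 hf3]] := coweight_form (al := fun i u => alpha i u : C)
  (ph := fun i u => phi i u : C) (q := q') (av := alphav)
  (fun i => lin (alpha i)) (fun i => lin (phi i)) phiP q'n0
  (fun i j => etrans (congr1 _ (aA i j)) (etrans (q'A i j) (esym (congr1 _ (aA j i))))).
(* A root is plus or minus a sum of simple roots, and on those the given form is prescribed. *)
have btE g : form a g = bt alphav d q' a g.
  have wE w : form (wt alpha w) g = bt alphav d q' (wt alpha w) g.
    elim: w => [|i w IH]; first by rewrite wt0 linear0l bt0l.
    by rewrite wt_cons linearDl /= btDl IH formE (bt_alpha alphav q' dP).
  have [w [_ [[-> _]|[-> _]]]] := root_cases (kac_moody_relations SA) (alpha_rho dP) a0 rx x0.
    exact: wE.
  by rewrite linearNl /= btNl wE.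
have bt0 : bt alphav d q' a b < 0 by rewrite -btE.
exact: (lie_root_neq0 dP q'0 (sigma_lin alpha alphav d phi)
  (sigma_alphav alpha d phiP) (alpha_sigma phi dP areal)
  hf1 hf2 hf3 (kac_moody_relations SA) (kmH_inj SAmax) starP
  (kac_moody_max SAmax) cA aA q'A a0 b0 ab bt0 rx ry x0 y0).
Qed.

Theorem theorem1p4 (R : realType) (n : nat) (A : 'M[int]_n) (q : 'rV[rat]_n)
    (h : vectType R[i]) (alpha : 'I_n -> 'Hom(h, R[i]^o)) (alphav : 'I_n -> h)
    (SA : lie_ideal (km_tilde alpha alphav))
    (form : {symmetric 'Hom(h, R[i]^o)})
    (a b : 'Hom(h, R[i]^o)) :
  gen_cartan A ->
  symmetrizer A q ->
  realization alpha alphav A ->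
  maximal_ideal SA ->
  nondegenerate form ->
  (forall i (gamma : 'Hom(h, R[i]^o)),
     form (alpha i) gamma = ratr (q 0 i) * gamma (alphav i)) ->
  km_root SA a -> km_root SA b -> a <> b ->
  form a b < 0 ->
  (sdim R (root_space SA a) + sdim R (root_space SA b) - 1
     <= sdim R (root_space SA (a + b)%R))%E.
Proof.
move=> cA qs re SAmax _ formE [a0 [x rx x0]] [b0 [y ry y0]] /eqP ab neg.
have rsE gamma : root_space SA gamma = rs (kmH SA) gamma by [].
apply: sdim_bracket.
- exact: rs_lin.
- exact: rs_lin.
- by exists x.
- by exists y.
- by move=> u v; exact: rs_lie.
- move=> u v ru rv u0 v0.
  exact: (km_lie_neq0 cA qs re SAmax formE a0 b0 ab neg ru rv u0 v0).
Qed.
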